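(* The following decision problem is coNP-complete: given $n$ and a (rational) point $x\in\mathbb{R}^{n^2\times n^2}$ (i.e. $x\in\mathbb{R}^{n^4}$) with $x\geqslant 0$, decide whether $x$ satisfies every inequality of the form $$\sum_{r=1}^{m}Y_{i_rj_r,i_rj_r}-\sum_{1\leqslant r<s\leqslant m}Y_{i_rj_r,i_sj_s}\leqslant 1,$$ where $m,n\geqslant 7$, $i_1,\dots,i_m\in[n]$ are distinct and $j_1,\dots,j_m\in[n]$ are distinct.
   Context: Points $Y\in\mathbb{R}^{n^2\times n^2}$ have rows and columns indexed by pairs $(ij)$ with $i,j\in[n]$; $Y_{ij,kl}$ is the entry in row $(ij)$ and column $(kl)$. *)

(* Defs.v *)
From HB Require Import structures.
From mathcomp Require Import all_boot all_order all_algebra.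
Set Implicit Arguments.
Unset Strict Implicit.
Unset Printing Implicit Defensive.
Import Order.TTheory GRing.Theory Num.Theory.

(** * Deterministic multitape Turing machines *)

(* A two-way infinite tape as a zipper around the scanned cell: [tleft] lists
   the cells to its left, nearest first, and [tright] those to its right.
   [None] is the blank, and all cells not listed are blank. *)
Record tape (S : Type) := Tape {
  tleft : seq (option S);
  tcur : option S;
  tright : seq (option S)
}.

Definition blank_tape (S : Type) : tape S := Tape [::] None [::].

Definition word_tape (S : Type) (w : seq S) : tape S :=
  if w is a :: w' then Tape [::] (Some a) (map Some w') else blank_tape S.

Inductive direction := MoveLeft | Stay | MoveRight.

Definition tape_write (S : Type) (a : option S) (t : tape S) : tape S :=
  Tape (tleft t) a (tright t).

Definition tape_move (S : Type) (d : direction) (t : tape S) : tape S :=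
  match d with
  | MoveLeft =>
      Tape (behead (tleft t)) (head None (tleft t)) (tcur t :: tright t)
  | Stay => t
  | MoveRight =>
      Tape (tcur t :: tleft t) (head None (tright t)) (behead (tright t))
  end.

(* [I] holds the symbols that may occur in inputs and outputs; [tm_work] holds
   the auxiliary tape symbols.  There are [tm_k.+1] tapes. *)
Record TM (I : finType) := MkTM {
  tm_k : nat;
  tm_work : finType;
  tm_state : finType;
  tm_start : tm_state;
  tm_halt : pred tm_state;
  tm_accept : pred tm_state;
  tm_trans : tm_state -> {ffun 'I_tm_k.+1 -> option (I + tm_work)} ->
    tm_state * {ffun 'I_tm_k.+1 -> option (I + tm_work) * direction}
}.

Section Run.
Variables (I : finType) (M : TM I).

Definition tm_symbol : Type := I + tm_work M.

Record config := Config {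
  cstate : tm_state M;
  ctapes : {ffun 'I_(tm_k M).+1 -> tape tm_symbol}
}.

(* The input is on the first tape, with the head on its first symbol. *)
Definition init_config (w : seq I) : config :=
  Config (tm_start M)
    [ffun t => if t == ord0 then word_tape (map inl w) else blank_tape _].

Definition halted (c : config) : bool := tm_halt (cstate c).
Definition accepting (c : config) : bool := tm_accept (cstate c).

Definition step (c : config) : config :=
  if halted c then c else
  let: (q, act) := tm_trans (cstate c) [ffun t => tcur (ctapes c t)] in
  Config q
    [ffun t => tape_move (act t).2 (tape_write (act t).1 (ctapes c t))].

Definition run (w : seq I) (t : nat) : config := iter t step (init_config w).

Fixpoint nonblank_prefix (S : Type) (s : seq (option S)) : seq S :=
  if s is Some a :: s' then a :: nonblank_prefix s' else [::].

(* The output is the word on the last tape from the head up to the first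
   blank. *)
Definition output (c : config) : seq tm_symbol :=
  let t := ctapes c ord_max in nonblank_prefix (tcur t :: tright t).

End Run.

(** * Polynomial time, NP, coNP *)

Definition language (A : finType) := seq A -> Prop.

Definition decides_in_time (A : finType) (M : TM A) (p : {poly nat})
    (L : language A) : Prop :=
  forall w, exists t,
    [/\ t <= p.[size w]%R, halted (run M w t)
      & L w <-> accepting (run M w t)].

Definition inP (A : finType) (L : language A) : Prop :=
  exists (M : TM A) (p : {poly nat}), decides_in_time M p L.

Definition computes_in_time (A B : finType) (M : TM (A + B)%type)
    (p : {poly nat}) (f : seq A -> seq B) : Prop :=
  forall w, exists t,
    let c := run M (map inl w) t in
    [/\ t <= p.[size w]%R, halted c
      & output c = map (fun b => inl (inr b)) (f w)].

Definition poly_time (A B : finType) (f : seq A -> seq B) : Prop :=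
  exists (M : TM (A + B)%type) (p : {poly nat}), computes_in_time M p f.

(* The input [w] and the certificate [c] are written in disjoint alphabets, so
   their concatenation determines both. *)
Definition inNP (A : finType) (L : language A) : Prop :=
  exists (V : language (A + bool)%type) (p : {poly nat}),
    inP V /\
    forall w, L w <-> exists c : seq bool,
      size c <= p.[size w]%R /\ V (map inl w ++ map inr c).

Definition in_coNP (A : finType) (L : language A) : Prop :=
  inNP (fun w => ~ L w).

Definition reduces (A B : finType) (L : language A) (K : language B) : Prop :=
  exists f : seq A -> seq B, poly_time f /\ forall w, L w <-> K (f w).

Definition coNP_hard (B : finType) (K : language B) : Prop :=
  forall (A : finType) (L : language A), in_coNP L -> reduces L K.

Definition coNP_complete (B : finType) (K : language B) : Prop :=
  in_coNP K /\ coNP_hard K.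

(** * The membership problem *)

Definition point (n : nat) : Type := 'I_n * 'I_n -> 'I_n * 'I_n -> rat.

Definition satisfies_inequalities (n : nat) (Y : point n) : Prop :=
  forall m : nat, 7 <= m -> 7 <= n ->
  forall i j : 'I_m -> 'I_n, injective i -> injective j ->
  (\sum_(r < m) Y (i r, j r) (i r, j r)
   - \sum_(r < m) \sum_(s < m | (r < s)%N) Y (i r, j r) (i s, j s) <= 1)%R.

(* Binary value, most significant bit first; leading zeros are allowed. *)
Definition bits_val (b : seq bool) : nat :=
  foldl (fun a (x : bool) => a.*2 + x) 0 b.

(* Words over {0, 1, #}, with [None] as #, which ends every field. *)
Definition fields_word (fs : seq (seq bool)) : seq (option bool) :=
  flatten [seq rcons (map Some b) None | b <- fs].

Definition index_pairs (n : nat) : seq ('I_n * 'I_n) :=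
  [seq (i, j) | i <- enum 'I_n, j <- enum 'I_n].

(* [w] lists n, then numerator and denominator (not necessarily coprime) of
   each of the n^4 entries of [x] in row-major order, all in binary. Numerators
   carry no sign, since instances have nonnegative entries. *)
Definition encodes (w : seq (option bool)) (n : nat) (x : point n) : Prop :=
  exists (bn : seq bool) (num den : 'I_n * 'I_n -> 'I_n * 'I_n -> seq bool),
    [/\ bits_val bn = n,
        forall a b, 0 < bits_val (den a b),
        forall a b,
          x a b = ((bits_val (num a b))%:R / (bits_val (den a b))%:R)%R
      & w = fields_word
          (bn :: flatten [seq [:: num a b; den a b]
                         | a <- index_pairs n, b <- index_pairs n])].

(* The encodings of the yes-instances. *)
Definition inequalities_problem : language (option bool) :=
  fun w => exists (n : nat) (x : point n),
    [/\ encodes w x, forall a b, (0 <= x a b)%R & satisfies_inequalities x].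

(* Main.v *)
(** Membership.  A violated inequality is certified by the list of the pairs
    (i_r, j_r): both sums are computed exactly as fractions in binary and
    compared, and ill-formed words are accepted at once.

    Hardness.  On the cells (v, v) put 1/T on the diagonal of the point, 1 at
    pairs of incompatible vertices and 0 elsewhere.  As 1 >= 1/T, dropping one
    vertex of an incompatible pair never decreases the left-hand side, so some
    inequality is violated iff there is a clique of more than T vertices.
    For a verifier running in time T, a vertex describes one step: its time, the
    state, the scanned symbols, the length of the certificate, the head
    positions, and for every head the time of the last earlier visit of its
    cell.  With these last-visit times the correctness of a run involves only
    pairs of steps, so cliques of size T + 1 are the accepting runs, with the
    certificate read off the first visits.

    Polynomial time.  A value is stored as a binary tree, written in prefix
    order on a stack, which makes pairing a single push.  The functions computed
    on the top of this stack in polynomial time are closed under composition,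
    pairing, branching and folds with polynomially bounded intermediate
    results. *)

Require Import Defs.
From mathcomp Require Import all_boot all_order all_algebra.
From mathcomp Require Import zify ring lra.
From Stdlib Require Import Classical.
Import Order.TTheory GRing.Theory Num.Theory.
Set Implicit Arguments.
Unset Strict Implicit.
Unset Printing Implicit Defensive.

(** * Stack programs and their compilation to Turing machines *)

Section StackPrograms.
Variables (I W : finType) (k : nat).
Notation sym := (I + W)%type.
Notation reg := 'I_k.+1.

Definition store : Type := seq (seq sym).

Definition get_stack (s : store) (r : reg) : seq sym := nth [::] s r.

Definition set_stack (s : store) (r : reg) (v : seq sym) : store :=
  set_nth [::] s r v.

Lemma get_set_stack s r v r' :
  get_stack (set_stack s r v) r' = if r' == r then v else get_stack s r'.
Proof. by rewrite /get_stack nth_set_nth. Qed.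

Lemma size_set_stack s r v : size s = k.+1 -> size (set_stack s r v) = k.+1.
Proof. by move=> sz; rewrite size_set_nth sz; apply/maxn_idPr. Qed.

Definition copy_top s r r' : store :=
  if get_stack s r is a :: _ then set_stack s r' (a :: get_stack s r') else s.

Inductive cmd :=
  | Skip
  | Push of reg & sym
  | Copy of reg & reg
  | Pop of reg
  | Seq of cmd & cmd
  | If of reg & pred (option sym) & cmd & cmd
  | While of reg & pred (option sym) & cmd.

(* The last argument bounds the number of machine steps from above. *)
Inductive exec : cmd -> store -> store -> nat -> Prop :=
  | ExecSkip s : exec Skip s s 0
  | ExecPush r a s : exec (Push r a) s (set_stack s r (a :: get_stack s r)) 2
  | ExecCopy r r' s : r != r' -> ~~ nilp (get_stack s r) ->
      exec (Copy r r') s (copy_top s r r') 2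
  | ExecPop r s : exec (Pop r) s (set_stack s r (behead (get_stack s r))) 1
  | ExecSeq c1 c2 s1 s2 s3 n1 n2 :
      exec c1 s1 s2 n1 -> exec c2 s2 s3 n2 -> exec (Seq c1 c2) s1 s3 (n1 + n2)
  | ExecIfTrue r (P : pred (option sym)) c1 c2 s s' n :
      P (ohead (get_stack s r)) ->
      exec c1 s s' n -> exec (If r P c1 c2) s s' n.+2
  | ExecIfFalse r (P : pred (option sym)) c1 c2 s s' n :
      ~~ P (ohead (get_stack s r)) ->
      exec c2 s s' n -> exec (If r P c1 c2) s s' n.+1
  | ExecWhileFalse r (P : pred (option sym)) c s :
      ~~ P (ohead (get_stack s r)) -> exec (While r P c) s s 1
  | ExecWhileTrue r (P : pred (option sym)) c s1 s2 s3 n1 n2 :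
      P (ohead (get_stack s1 r)) -> exec c s1 s2 n1 ->
      exec (While r P c) s2 s3 n2 -> exec (While r P c) s1 s3 (n1 + n2).+2
  | ExecWeaken c s s' n m : exec c s s' n -> n <= m -> exec c s s' m.

Definition reading : Type := {ffun reg -> option sym}.

Definition instr : Type := reading -> nat * (reg -> option sym * direction).

Definition jump (f : reading -> nat) : instr :=
  fun rd => (f rd, fun t => (rd t, Stay)).

Definition act_on (r : reg) (f : reading -> option sym * direction) (o : nat) :
    instr :=
  fun rd => (o, fun t => if t == r then f rd else (rd t, Stay)).

Definition push_code (r : reg) (f : reading -> option sym) (o : nat) :
    seq instr :=
  [:: act_on r (fun rd => (rd r, MoveLeft)) o.+1;
      act_on r (fun rd => (f rd, Stay)) o.+2].

(* [o] is the address of the first instruction; jumps are absolute. *)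
Fixpoint code (c : cmd) (o : nat) : seq instr :=
  match c with
  | Skip => [::]
  | Push r a => push_code r (fun=> Some a) o
  | Copy r r' => push_code r' (fun rd => rd r) o
  | Pop r => [:: act_on r (fun rd => (rd r, MoveRight)) o.+1]
  | Seq c1 c2 => let k1 := code c1 o in k1 ++ code c2 (o + size k1)
  | If r P c1 c2 =>
      let k1 := code c1 o.+1 in
      let o2 := (o.+1 + size k1).+1 in
      let k2 := code c2 o2 in
      jump (fun rd => if P (rd r) then o.+1 else o2) ::
      k1 ++ jump (fun=> o2 + size k2) :: k2
  | While r P c =>
      let k1 := code c o.+1 in
      jump (fun rd => if P (rd r) then o.+1 else (o.+1 + size k1).+1) ::
      k1 ++ [:: jump (fun=> o)]
  end.

(* The states [size K] and [(size K).+1] reject and accept. *)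
Definition machine (K : seq instr) : TM I :=
  @MkTM I k W 'I_(size K).+2 ord0 (fun q => size K <= q)
    (fun q => val q == (size K).+1)
    (fun q rd => let: (o, act) := nth (jump (fun=> 0)) K q rd in
                 (inord o, [ffun t => act t])).

Definition tape_stack (t : tape sym) (v : seq sym) : Prop :=
  exists m, tcur t :: tright t = map Some v ++ nseq m None.

Definition tapes : Type := {ffun reg -> tape sym}.

Definition tapes_store (tp : tapes) (s : store) : Prop :=
  forall r, tape_stack (tp r) (get_stack s r).

Definition machine_config K o (tp : tapes) : config (machine K) :=
  @Config I (machine K) (inord o) tp.

Lemma tape_stack_top t v : tape_stack t v -> tcur t = ohead v.
Proof.
by case=> m; case: v => [|a v] /=; [case: m => //= m|]; case=> -> _.
Qed.

Lemma tape_stack_pop t v :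
  tape_stack t v -> tape_stack (tape_move MoveRight t) (behead v).
Proof.
case=> m; rewrite /tape_stack /=.
case: v => [|a v] /=; first case: m => //= m [_ ->].
  by case: m => [|m]; [exists 1 | exists m.+1].
case=> _ ->; case: v => [|b v] /=; last by exists m.
by case: m => [|m]; [exists 1 | exists m.+1].
Qed.

Lemma tape_stack_push t v a : tape_stack t v ->
  tape_stack (tape_write (Some a) (tape_move MoveLeft t)) (a :: v).
Proof. by case=> m e; exists m; rewrite /= e. Qed.

Lemma tape_write_cur (t : tape sym) : tape_write (tcur t) t = t.
Proof. by case: t. Qed.

Section Segments.
Variable K : seq instr.

Definition code_at (o : nat) (l : seq instr) : Prop :=
  exists pre post, K = pre ++ l ++ post /\ size pre = o.

Lemma code_at_cat o l1 l2 : code_at o (l1 ++ l2) ->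
  code_at o l1 /\ code_at (o + size l1) l2.
Proof.
case=> pre [post [eK <-]]; split.
  by exists pre, (l2 ++ post); rewrite eK -!catA.
by exists (pre ++ l1), post; rewrite size_cat eK -!catA.
Qed.

Lemma code_at_cons o ins l :
  code_at o (ins :: l) -> code_at o [:: ins] /\ code_at o.+1 l.
Proof. by rewrite -cat1s => /code_at_cat; rewrite addn1. Qed.

Definition steps_to (o o' : nat) (s s' : store) (n : nat) : Prop :=
  forall tp, tapes_store tp s ->
  exists m tp', [/\ m <= n,
    iter m (@step I (machine K)) (machine_config K o tp)
      = machine_config K o' tp'
    & tapes_store tp' s'].

Lemma steps_to_refl o s : steps_to o o s s 0.
Proof. by move=> tp rp; exists 0, tp. Qed.

Lemma steps_to_trans o1 o2 o3 s1 s2 s3 n1 n2 :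
  steps_to o1 o2 s1 s2 n1 -> steps_to o2 o3 s2 s3 n2 ->
  steps_to o1 o3 s1 s3 (n1 + n2).
Proof.
move=> st1 st2 tp /st1[m1 [tp1 [le1 e1 /st2[m2 [tp2 [le2 e2 rp2]]]]]].
by exists (m1 + m2), tp2; split; rewrite ?leq_add // addnC iterD e1.
Qed.

Lemma steps_to_weaken o o' s s' n m :
  steps_to o o' s s' n -> n <= m -> steps_to o o' s s' m.
Proof.
move=> st le tp /st[m' [tp' [le' e rp]]].
by exists m', tp'; split=> //; apply: leq_trans le.
Qed.

Lemma step_instr o ins (tp : tapes) : code_at o [:: ins] ->
  step (machine_config K o tp) =
    let: (o', act) := ins [ffun t => tcur (tp t)] in
    machine_config K o'
      [ffun t => tape_move (act t).2 (tape_write (act t).1 (tp t))].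
Proof.
case=> pre [post [eK <-]]; have lt : size pre < size K.
  by rewrite eK size_cat /=; lia.
have insE : nth (jump (fun=> 0)) K (size pre) = ins.
  by rewrite eK nth_cat ltnn subnn.
rewrite /step /halted /= inordK; last by lia.
rewrite leqNgt lt insE /=.
case: (ins _) => o' act /=; congr (Config _ _).
by apply/ffunP=> t; rewrite !ffunE.
Qed.

Lemma step_act_on r f o o' (tp : tapes) : code_at o [:: act_on r f o'] ->
  step (machine_config K o tp) =
    let: (x, d) := f [ffun t => tcur (tp t)] in
    machine_config K o'
      [ffun t => if t == r then tape_move d (tape_write x (tp t)) else tp t].
Proof.
move/step_instr->; case ef: (f _) => [x d]; congr machine_config.
apply/ffunP=> t; rewrite !ffunE ef.
by case: eqP => // _; rewrite /= ?ffunE tape_write_cur.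
Qed.

Lemma steps_to_jump o (f : reading -> nat) s : code_at o [:: jump f] ->
  steps_to o (f [ffun r => ohead (get_stack s r)]) s s 1.
Proof.
move=> at_o tp rp; exists 1, tp; split=> //=.
rewrite (step_instr _ at_o) /=; congr machine_config; last first.
  by apply/ffunP=> t; rewrite !ffunE tape_write_cur.
by congr f; apply/ffunP=> t; rewrite !ffunE (tape_stack_top (rp t)).
Qed.

Lemma steps_to_push o r (f : reading -> option sym) a s :
  code_at o (push_code r f o) ->
  (forall rd : reading, (forall t, t != r -> rd t = ohead (get_stack s t)) ->
    f rd = Some a) ->
  steps_to o (o + 2) s (set_stack s r (a :: get_stack s r)) 2.
Proof.
move=> /code_at_cons[at0 at1] fE tp rp.
exists 2, [ffun t => if t == r
  then tape_write (Some a) (tape_move MoveLeft (tp t)) else tp t].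
split=> // [|r'].
  rewrite /= (step_act_on _ at0) ffunE (step_act_on _ at1) fE ?addn2.
    congr machine_config; apply/ffunP=> t; rewrite !ffunE.
    by case: eqP => // ->; rewrite tape_write_cur.
  by move=> t /negbTE tr; rewrite !ffunE tr (tape_stack_top (rp t)).
rewrite ffunE get_set_stack; case: eqP => [->|_]; last exact: rp.
exact/tape_stack_push/rp.
Qed.

Lemma steps_to_pop o r s :
  code_at o [:: act_on r (fun rd => (rd r, MoveRight)) o.+1] ->
  steps_to o (o + 1) s (set_stack s r (behead (get_stack s r))) 1.
Proof.
move=> at_o tp rp.
exists 1, [ffun t => if t == r then tape_move MoveRight (tp t) else tp t].
split=> // [|r'].
  rewrite /= (step_act_on _ at_o) addn1; congr machine_config.
  apply/ffunP=> t; rewrite !ffunE.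
  by case: eqP => // ->; rewrite tape_write_cur.
rewrite ffunE get_set_stack; case: eqP => [->|_]; last exact: rp.
exact/tape_stack_pop/rp.
Qed.

Lemma code_correct c s s' n : exec c s s' n ->
  forall o, code_at o (code c o) -> steps_to o (o + size (code c o)) s s' n.
Proof.
elim=> {c s s' n} /=.
- by move=> s o _; rewrite addn0; apply: steps_to_refl.
- by move=> r a s o at_o; apply: steps_to_push at_o _.
- move=> r r' s ne; rewrite /copy_top; case top: (get_stack s r) => [//|a v] _.
  by move=> o at_o; apply: steps_to_push at_o _ => rd -> //; rewrite top.
- by move=> r s o; apply: steps_to_pop.
- move=> c1 c2 s1 s2 s3 n1 n2 _ IH1 _ IH2 o /code_at_cat[at1 at2].
  by rewrite size_cat addnA; apply: steps_to_trans (IH1 _ at1) (IH2 _ at2).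
- move=> r P c1 c2 s s' n Ps _ IH o /code_at_cons[atj].
  case/code_at_cat=> at1 /code_at_cons[atj' _].
  have := steps_to_jump (s := s) atj; rewrite ffunE Ps.
  move/steps_to_trans/(_ (IH _ at1))/steps_to_trans/(_ (steps_to_jump atj')).
  by rewrite size_cat /= add1n addn1 !addnS !addSn addnA.
- move=> r P c1 c2 s s' n Ps _ IH o /code_at_cons[atj].
  case/code_at_cat=> _ /code_at_cons[_ at2].
  have := steps_to_jump (s := s) atj; rewrite ffunE (negbTE Ps).
  move/steps_to_trans/(_ (IH _ at2)).
  by rewrite size_cat /= add1n !addnS !addSn addnA.
- move=> r P c s Ps o /code_at_cons[atj _].
  have := steps_to_jump (s := s) atj; rewrite ffunE (negbTE Ps).
  by rewrite size_cat /= addn1 !addnS addSn.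
- move=> r P c s1 s2 s3 n1 n2 Ps _ IH1 _ IH2 o at_o.
  have [atj /code_at_cat[at1 atj']] := code_at_cons at_o.
  have := steps_to_jump (s := s1) atj; rewrite ffunE Ps.
  move/steps_to_trans/(_ (IH1 _ at1))/steps_to_trans/(_ (steps_to_jump atj')).
  move/steps_to_trans/(_ (IH2 _ at_o)).
  by rewrite add1n addn1 !addSn.
- by move=> c s s' n m _ IH le o /IH st; apply: steps_to_weaken le.
Qed.

End Segments.

Definition halting_code (c : cmd) (r : reg) (P : pred (option sym)) :
    seq instr :=
  let K := code c 0 in
  rcons K (jump (fun rd => if P (rd r) then (size K).+2 else (size K).+1)).

Lemma run_halting_code c r (P : pred (option sym)) w s s' n :
  (forall r', get_stack s r' = if r' == ord0 then map inl w else [::]) ->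
  exec c s s' n ->
  exists2 m, m <= n.+1 & let cf := run (machine (halting_code c r P)) w m in
    [/\ halted cf, accepting cf = P (ohead (get_stack s' r))
      & tapes_store (ctapes cf) s'].
Proof.
set K := halting_code c r P => init_s ec.
have szK : size K = (size (code c 0)).+1 by rewrite size_rcons.
have at0 : code_at K 0 (code c 0).
  by exists [::], [:: last (jump (fun=> 0)) K]; rewrite /K last_rcons cats1.
have at1 : code_at K (size (code c 0)) [:: last (jump (fun=> 0)) K].
  by exists (code c 0), [::]; rewrite /K last_rcons cats0 cats1.
rewrite /K last_rcons -/K in at1.
pose tp0 : tapes := ctapes (init_config (machine K) w).
have tp0s : tapes_store tp0 s.
  move=> r'; rewrite init_s ffunE; case: eqP => _; last by exists 1.
  by case: (w) => [|a v]; [exists 1 | exists 0; rewrite /= cats0].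
have := steps_to_trans (code_correct ec at0) (steps_to_jump at1).
case/(_ tp0 tp0s) => m [tp [le_m e tps]]; exists m; first by rewrite -addn1.
have -> : run (machine K) w m = machine_config K
    (if P (ohead (get_stack s' r)) then (size K).+1 else size K) tp.
  move: e; rewrite ffunE -szK => <-; rewrite /run; congr iter.
  by congr Config; apply: val_inj; rewrite /= inordK.
rewrite /halted /accepting /=; case: (P _); rewrite inordK ?eqxx //; split=> //.
by apply/eqP; lia.
Qed.

Fixpoint copy_all (r : reg) (rs : seq reg) : cmd :=
  if rs is r' :: rs' then Seq (Copy r r') (copy_all r rs') else Skip.

Definition pushed (s : store) (a : sym) (rs : seq reg) : store :=
  foldl (fun s r => set_stack s r (a :: get_stack s r)) s rs.

Lemma get_pushed s a rs r : uniq rs ->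
  get_stack (pushed s a rs) r =
    if r \in rs then a :: get_stack s r else get_stack s r.
Proof.
rewrite /pushed; elim: rs s => //= r' rs IH s /andP[nr' u].
rewrite IH // get_set_stack inE; case: eqP => [->|_] //=.
by rewrite (negbTE nr').
Qed.

Lemma size_pushed s a rs : size s = k.+1 -> size (pushed s a rs) = k.+1.
Proof.
rewrite /pushed; elim: rs s => //= r rs IH s sz.
exact/IH/size_set_stack.
Qed.

Lemma exec_copy_all r rs a v s : r \notin rs -> get_stack s r = a :: v ->
  exec (copy_all r rs) s (pushed s a rs) (2 * size rs).
Proof.
rewrite /pushed; elim: rs s => [|r' rs IH] s /=.
  by move=> _ _; exact: ExecSkip.
rewrite inE negb_or => /andP[ne nr] top.
have copyE : copy_top s r r' = set_stack s r' (a :: get_stack s r').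
  by rewrite /copy_top top.
rewrite -copyE mulnS; apply: ExecSeq (IH _ nr _).
  by apply: ExecCopy; rewrite ?top.
by rewrite copyE get_set_stack (negbTE ne).
Qed.

Definition drain (r : reg) (rs : seq reg) : cmd :=
  While r isSome (Seq (copy_all r rs) (Pop r)).

Definition drained (s : store) (r : reg) (rs : seq reg) : store :=
  mkseq (fun i => if i == r then [::]
    else if i \in map val rs then catrev (get_stack s r) (nth [::] s i)
    else nth [::] s i) k.+1.

Lemma get_drained s r rs r' : get_stack (drained s r rs) r' =
  if r' == r then [::]
  else if r' \in rs then catrev (get_stack s r) (get_stack s r')
  else get_stack s r'.
Proof. by rewrite /get_stack nth_mkseq // (mem_map val_inj). Qed.

Lemma store_ext s s' : size s = k.+1 -> size s' = k.+1 ->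
  (forall r, get_stack s r = get_stack s' r) -> s = s'.
Proof.
move=> sz sz' e; apply: (@eq_from_nth _ [::]) => [|i]; rewrite sz // => lt.
exact: (e (Ordinal lt)).
Qed.

Lemma exec_drain r rs s : size s = k.+1 -> r \notin rs -> uniq rs ->
  exec (drain r rs) s (drained s r rs)
    ((2 * size rs + 3) * size (get_stack s r) + 1).
Proof.
move=> szs nr uniq_rs; move top: (get_stack s r) => v.
elim: v s szs top => [|a v IH] s sz top.
  rewrite muln0; have -> : drained s r rs = s.
    apply: store_ext; rewrite ?size_mkseq // => r'.
    by rewrite get_drained; case: eqP => [->|_] //; rewrite top; case: ifP.
  by apply: ExecWhileFalse; rewrite top.
pose s' := set_stack (pushed s a rs) r v.
have top' : get_stack (pushed s a rs) r = a :: v.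
  by rewrite get_pushed // (negbTE nr).
have sz' : size s' = k.+1.
  exact/size_set_stack/size_pushed.
have -> : drained s r rs = drained s' r rs.
  apply: store_ext; rewrite ?size_mkseq // => r'.
  rewrite !get_drained !get_set_stack eqxx; case: eqP => // _.
  by rewrite get_pushed // top; case: ifP.
apply: (@ExecWeaken _ _ _
  (2 * size rs + 1 + ((2 * size rs + 3) * size v + 1)).+2).
  apply: ExecWhileTrue (IH _ sz' _); first by rewrite top.
    apply: ExecSeq (exec_copy_all nr top) _.
    rewrite /s' -[v in set_stack _ _ v]/(behead (a :: v)) -top'.
    exact: ExecPop.
  by rewrite get_set_stack eqxx.
by rewrite /= mulnS; lia.
Qed.

End StackPrograms.

Arguments Skip {I W k}.
Arguments Push {I W k}.
Arguments Copy {I W k}.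
Arguments Pop {I W k}.
Arguments drain {I W k}.

(** * Binary trees on a stack *)

Inductive tree := Leaf | Node of tree & tree.

Fixpoint tree_bits (x : tree) : seq bool :=
  if x is Node l r then true :: tree_bits l ++ tree_bits r else [:: false].

Definition tree_size (x : tree) : nat := size (tree_bits x).

Lemma tree_size_gt0 x : 0 < tree_size x. Proof. by case: x. Qed.

Lemma tree_size_Node l r :
  tree_size (Node l r) = (tree_size l + tree_size r).+1.
Proof. by rewrite /tree_size /= size_cat. Qed.

Class Encoding (T : Type) := Encode {
  enc : T -> tree;
  enc_inj : injective enc
}.
Arguments enc {T Encoding} _ : simpl never.

Definition enc_size {T} {eT : Encoding T} (x : T) : nat := tree_size (enc x).

#[global] Instance enc_unit : Encoding unit.
Proof. by exists (fun=> Leaf) => -[] []. Defined.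

#[global] Instance enc_bool : Encoding bool.
Proof.
by exists (fun b => if b then Node Leaf Leaf else Leaf) => -[] [].
Defined.

#[global] Instance enc_nat : Encoding nat.
Proof.
exists (fun n => iter n (Node Leaf) Leaf).
by elim=> [|m IH] [|n] //= [/IH ->].
Defined.

#[global] Instance enc_tree : Encoding tree.
Proof. by exists id. Defined.

#[global] Instance enc_prod S T {eS : Encoding S} {eT : Encoding T} :
  Encoding (S * T).
Proof.
exists (fun p => Node (enc p.1) (enc p.2)).
by move=> [a b] [c d] [/(@enc_inj S eS) /= -> /(@enc_inj T eT) /= ->].
Defined.

#[global] Instance enc_seq T {eT : Encoding T} : Encoding (seq T).
Proof.
exists (foldr (fun a t => Node (enc a) t) Leaf).
by elim=> [|a s IH] [|b t] //= [/(@enc_inj T eT) -> /IH ->].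
Defined.

#[global] Instance enc_option T {eT : Encoding T} : Encoding (option T).
Proof.
exists (fun x => if x is Some a then Node Leaf (enc a) else Leaf).
by move=> [a|] [b|] //= [/(@enc_inj T eT) ->].
Defined.

(* Low priority: the structural encodings of [bool], [option T] and products
   are preferred. *)
#[global] Instance enc_finType (T : finType) : Encoding T | 100.
Proof.
exists (fun a => enc (nat_of_ord (enum_rank a))).
by move=> a b /(@enc_inj nat enc_nat)/val_inj/enum_rank_inj.
Defined.

Section EncodingSize.
Context {S T : Type} {eS : Encoding S} {eT : Encoding T}.

Lemma enc_pair (a : S) (b : T) : enc (a, b) = Node (enc a) (enc b).
Proof. by []. Qed.

Lemma enc_cons (a : S) s : enc (a :: s) = Node (enc a) (enc s).
Proof. by []. Qed.

Lemma enc_size_gt0 (a : S) : 0 < enc_size a.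
Proof. exact: tree_size_gt0. Qed.

Lemma enc_size_pair (a : S) (b : T) :
  enc_size (a, b) = (enc_size a + enc_size b).+1.
Proof. exact: tree_size_Node. Qed.

Lemma enc_size_Some (a : S) : enc_size (Some a) = (enc_size a).+2.
Proof. by rewrite [LHS]tree_size_Node. Qed.

Lemma enc_size_None : enc_size (None : option S) = 1.
Proof. by []. Qed.

Lemma enc_size_nil : enc_size ([::] : seq S) = 1.
Proof. by []. Qed.

Lemma enc_size_cons (a : S) s :
  enc_size (a :: s) = (enc_size a + enc_size s).+1.
Proof. exact: tree_size_Node. Qed.

Lemma enc_size_cat (s t : seq S) :
  (enc_size (s ++ t)).+1 = enc_size s + enc_size t.
Proof. by elim: s => [|a s IH] //; rewrite cat_cons !enc_size_cons; lia. Qed.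

Lemma enc_size_rcons (s : seq S) a :
  enc_size (rcons s a) = enc_size s + (enc_size a).+1.
Proof.
by have := enc_size_cat s [:: a]; rewrite cats1 enc_size_cons enc_size_nil; lia.
Qed.

Lemma size_le_enc_size (s : seq S) : size s <= enc_size s.
Proof. by elim: s => //= a s IH; rewrite enc_size_cons; lia. Qed.

Lemma enc_size_take (s : seq S) n : enc_size (take n s) <= enc_size s.
Proof.
by elim: s n => [|a s IH] [|n] //=; rewrite !enc_size_cons; have := IH n; lia.
Qed.

Lemma enc_size_behead (s : seq S) : enc_size (behead s) <= enc_size s.
Proof. by case: s => // a s; rewrite enc_size_cons /=; lia. Qed.

End EncodingSize.

Lemma enc_size_nat (n : nat) : enc_size n = n.*2.+1.
Proof.
elim: n => // n IH; have -> : enc_size n.+1 = (1 + enc_size n).+1.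
  exact: tree_size_Node.
by rewrite IH; lia.
Qed.

Lemma enc_size_tree (t : tree) : enc_size t = tree_size t.
Proof. by []. Qed.

Lemma enc_size_bool (b : bool) : enc_size b <= 3.
Proof. by case: b. Qed.

Definition input_reg : 'I_6 := @Ordinal 6 0 isT.
Definition main_reg : 'I_6 := @Ordinal 6 1 isT.
Definition aux_reg (r : bool) : 'I_6 :=
  if r then @Ordinal 6 2 isT else @Ordinal 6 3 isT.
Definition count_reg : 'I_6 := @Ordinal 6 4 isT.
Definition output_reg : 'I_6 := @Ordinal 6 5 isT.

Section TreePrograms.
Variable I : finType.
Notation sym := (I + bool)%type.
Notation one := (inr true : sym).
Notation zero := (inr false : sym).
Notation cmd := (cmd I bool 5).

(* [a] lies on the auxiliary stack selected by [r], and [b] on the other one. *)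
Definition stacks (r : bool) (i d a b c o : seq sym) : store I bool :=
  if r then [:: i; d; a; b; c; o] else [:: i; d; b; a; c; o].

Lemma get_count r i d a b c o : get_stack (stacks r i d a b c o) count_reg = c.
Proof. by case: r. Qed.

Definition is_one (x : option sym) : bool :=
  if x is Some (inr b) then b else false.

Definition tree_word (x : tree) : seq sym := map inr (tree_bits x).

Lemma tree_word_Node l r :
  tree_word (Node l r) = one :: tree_word l ++ tree_word r.
Proof. by rewrite /tree_word /= map_cat. Qed.

Lemma size_tree_word x : size (tree_word x) = tree_size x.
Proof. exact: size_map. Qed.

Lemma exec_conv (c : cmd) s s1 s' n m :
  exec c s s1 n -> s1 = s' -> n <= m -> exec c s s' m.
Proof. by move=> e <-; apply: ExecWeaken. Qed.

Definition unload_body (r : bool) : cmd :=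
  Seq (Copy main_reg (aux_reg r))
    (If main_reg is_one (Seq (Pop main_reg) (Push count_reg one))
                        (Seq (Pop main_reg) (Pop count_reg))).

Lemma exec_unload_body r v i d a b c o :
  exec (unload_body r) (stacks r i (inr v :: d) a b (one :: c) o)
    (stacks r i d (inr v :: a) b (if v then one :: one :: c else c) o) 7.
Proof.
case: v; case: r; (apply: ExecWeaken;
  [apply: ExecSeq (ExecCopy _ _) _ => // | ]).
1,3: exact: ExecIfTrue (ExecSeq (ExecPop _ _) (ExecPush _ _ _)).
3,5: exact: ExecIfFalse (ExecSeq (ExecPop _ _) (ExecPop _ _)).
all: by [].
Qed.

(* The counter holds one symbol for each subtree still to be read. *)
Definition unload (r : bool) : cmd := While count_reg isSome (unload_body r).

Lemma exec_unload r x i d a b c o s' n :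
  exec (unload r) (stacks r i d (catrev (tree_word x) a) b c o) s' n ->
  exec (unload r) (stacks r i (tree_word x ++ d) a b (one :: c) o) s'
    (n + 9 * tree_size x).
Proof.
elim: x d a c s' n => [|x IHx y IHy] d a c s' n exec_rest.
  apply: (@ExecWeaken _ _ _ _ _ _ (7 + n).+2); last first.
    by rewrite /tree_size /=; lia.
  apply: ExecWhileTrue (exec_unload_body _ _ _ _ _ _ _ _) exec_rest.
  by rewrite get_count.
rewrite tree_word_Node in exec_rest *; rewrite cat_cons -catA.
apply: (@ExecWeaken _ _ _ _ _ _
  (7 + (n + 9 * tree_size y + 9 * tree_size x)).+2).
  apply: ExecWhileTrue (exec_unload_body _ _ _ _ _ _ _ _) _.
    by rewrite get_count.
  by apply: IHx; apply: IHy; rewrite -catrev_catl.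
by rewrite tree_size_Node; lia.
Qed.

Definition move_tree (r : bool) : cmd := Seq (Push count_reg one) (unload r).

Lemma exec_move_tree r x i d b o :
  exec (move_tree r) (stacks r i (tree_word x ++ d) [::] b [::] o)
    (stacks r i d (rev (tree_word x)) b [::] o) (9 * tree_size x + 3).
Proof.
have push : exec (Push count_reg one)
    (stacks r i (tree_word x ++ d) [::] b [::] o)
    (stacks r i (tree_word x ++ d) [::] b [:: one] o) 2.
  by case: r; exact: ExecPush.
apply: ExecWeaken.
  apply: ExecSeq push (exec_unload _); apply: ExecWhileFalse.
  by rewrite get_count.
by lia.
Qed.

Definition main_word (i d o : seq sym) : store I bool :=
  stacks true i d [::] [::] [::] o.

Definition drop_prog : cmd := Seq (move_tree true) (drain (aux_reg true) [::]).

Lemma exec_drop x i d o :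
  exec drop_prog (main_word i (tree_word x ++ d) o) (main_word i d o)
    (20 * tree_size x).
Proof.
apply: ExecWeaken.
  by apply: ExecSeq (exec_move_tree _ _ _ _ _ _) _; apply: exec_drain.
by rewrite /= size_rev size_tree_word; have := tree_size_gt0 x; lia.
Qed.

Lemma catrev_rev_tree_word x d :
  catrev (rev (tree_word x)) d = tree_word x ++ d.
Proof. by rewrite catrevE revK. Qed.

Definition drain_main (r : bool) : cmd := drain (aux_reg r) [:: main_reg].
Definition drain_aux (r : bool) : cmd := drain (aux_reg r) [:: aux_reg (~~ r)].
Definition drain_both (r : bool) : cmd :=
  drain (aux_reg r) [:: main_reg; aux_reg (~~ r)].

Lemma exec_drain_main r i d a b c o : exec (drain_main r)
  (stacks r i d a b c o) (stacks r i (catrev a d) [::] b c o) (5 * size a + 1).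
Proof. by case: r; apply: exec_drain. Qed.

Lemma exec_drain_aux r i d a b c o : exec (drain_aux r)
  (stacks r i d a b c o) (stacks r i d [::] (catrev a b) c o) (5 * size a + 1).
Proof. by case: r; apply: exec_drain. Qed.

Lemma exec_drain_both r i d a b c o : exec (drain_both r)
  (stacks r i d a b c o) (stacks r i (catrev a d) [::] (catrev a b) c o)
  (7 * size a + 1).
Proof. by case: r; apply: exec_drain. Qed.

Definition swap_prog : cmd := Seq (move_tree true)
  (Seq (move_tree false) (Seq (drain_main true) (drain_main false))).

Lemma exec_swap x y i d o :
  exec swap_prog (main_word i (tree_word x ++ tree_word y ++ d) o)
    (main_word i (tree_word y ++ tree_word x ++ d) o)
    (24 * (tree_size x + tree_size y)).
Proof.
apply: exec_conv.
- apply: ExecSeq (exec_move_tree true _ _ _ _ _) _.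
  apply: ExecSeq (exec_move_tree false _ _ _ _ _) _.
  exact: ExecSeq (exec_drain_main true _ _ _ _ _ _)
                 (exec_drain_main false _ _ _ _ _ _).
- by rewrite !catrev_rev_tree_word.
- rewrite !size_rev !size_tree_word.
  by have := tree_size_gt0 x; have := tree_size_gt0 y; lia.
Qed.

Definition dup_prog : cmd :=
  Seq (move_tree true)
    (Seq (drain_both true) (Seq (drain_aux false) (drain_main true))).

Lemma exec_dup x i d o :
  exec dup_prog (main_word i (tree_word x ++ d) o)
    (main_word i (tree_word x ++ tree_word x ++ d) o) (40 * tree_size x).
Proof.
apply: exec_conv.
- apply: ExecSeq (exec_move_tree true _ _ _ _ _) _.
  apply: ExecSeq (exec_drain_both true _ _ _ _ _ _) _.
  exact: ExecSeq (exec_drain_aux false _ _ _ _ _ _)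
                 (exec_drain_main true _ _ _ _ _ _).
- by rewrite !catrevE !cats0 !revK.
- rewrite !catrevE !cats0 !revK !size_rev !size_tree_word.
  by have := tree_size_gt0 x; lia.
Qed.

Fixpoint push_bits (u : seq bool) : cmd :=
  if u is b :: u' then Seq (push_bits u') (Push main_reg (inr b)) else Skip.

Lemma exec_push_bits r u i d a b c o :
  exec (push_bits u) (stacks r i d a b c o)
    (stacks r i (map inr u ++ d) a b c o) (2 * size u).
Proof.
elim: u => [|v u IH]; first exact: ExecSkip.
rewrite /= mulnS addnC; apply: ExecSeq IH _.
by case: r; apply: ExecPush.
Qed.

Definition tree_exec (P : cmd) (t u : tree) (n : nat) : Prop :=
  forall i s o, exec P (main_word i (tree_word t ++ s) o)
                       (main_word i (tree_word u ++ s) o) n.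

Lemma tree_exec_weaken P t u n m :
  tree_exec P t u n -> n <= m -> tree_exec P t u m.
Proof. by move=> e le i s o; apply: ExecWeaken (e i s o) le. Qed.

Lemma tree_exec_Seq P Q t u v n m :
  tree_exec P t u n -> tree_exec Q u v m -> tree_exec (Seq P Q) t v (n + m).
Proof. by move=> e f i s o; apply: ExecSeq (e i s o) (f i s o). Qed.

Lemma tree_exec_Skip t : tree_exec Skip t t 0.
Proof. by move=> i s o; apply: ExecSkip. Qed.

Definition const_prog (t : tree) : cmd :=
  Seq drop_prog (push_bits (tree_bits t)).

Lemma tree_exec_const t u :
  tree_exec (const_prog u) t u (20 * tree_size t + 2 * tree_size u).
Proof.
move=> i s o.
exact: ExecSeq (exec_drop _ _ _ _) (exec_push_bits _ _ _ _ _ _ _ _).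
Qed.

Definition pair_prog (P Q : cmd) : cmd :=
  Seq dup_prog
    (Seq P (Seq swap_prog (Seq Q (Seq swap_prog (Push main_reg one))))).

Lemma tree_exec_pair P Q t u v n m : tree_exec P t u n -> tree_exec Q t v m ->
  tree_exec (pair_prog P Q) t (Node u v)
    (n + m + 100 * (tree_size t + tree_size u + tree_size v)).
Proof.
move=> eP eQ i s o; apply: exec_conv.
- apply: ExecSeq (exec_dup _ _ _ _) _; apply: ExecSeq (eP _ _ _) _.
  apply: ExecSeq (exec_swap _ _ _ _ _) _; apply: ExecSeq (eQ _ _ _) _.
  by apply: ExecSeq (exec_swap _ _ _ _ _) (ExecPush _ _ _).
- by rewrite tree_word_Node /= -catA.
- by have := tree_size_gt0 t; lia.
Qed.

Definition fst_prog : cmd := Seq (Pop main_reg) (Seq swap_prog drop_prog).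
Definition snd_prog : cmd := Seq (Pop main_reg) drop_prog.

Lemma tree_exec_fst t u :
  tree_exec fst_prog (Node t u) t (100 * tree_size (Node t u)).
Proof.
move=> i s o; rewrite tree_word_Node /= -catA; apply: ExecWeaken.
  apply: ExecSeq (ExecPop _ _) _.
  exact: ExecSeq (exec_swap _ _ _ _ _) (exec_drop _ _ _ _).
by rewrite tree_size_Node; lia.
Qed.

Lemma tree_exec_snd t u :
  tree_exec snd_prog (Node t u) u (100 * tree_size (Node t u)).
Proof.
move=> i s o; rewrite tree_word_Node /= -catA; apply: ExecWeaken.
  by apply: ExecSeq (ExecPop _ _) _; apply: exec_drop.
by rewrite tree_size_Node; lia.
Qed.

Definition if_prog (B P Q : cmd) : cmd :=
  Seq dup_prog (Seq B (If main_reg is_one (Seq drop_prog P) (Seq drop_prog Q))).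

Lemma tree_exec_if B (b : bool) P Q t u n m :
  tree_exec B t (enc b) n -> tree_exec (if b then P else Q) t u m ->
  tree_exec (if_prog B P Q) t u (n + m + 200 * tree_size t).
Proof.
move=> eB eP i s o; apply: (@ExecWeaken _ _ _ _ _ _
    (40 * tree_size t + (n + (20 * 3 + m).+2))); last first.
  by have := tree_size_gt0 t; lia.
apply: ExecSeq (exec_dup _ _ _ _) _; apply: ExecSeq (eB _ _ _) _.
case: b {eB} eP => eP.
  by apply: ExecIfTrue => //; apply: ExecSeq (exec_drop _ _ _ _) (eP _ _ _).
apply: (@ExecWeaken _ _ _ _ _ _ (20 * 1 + m).+1); last by lia.
by apply: ExecIfFalse => //; apply: ExecSeq (exec_drop Leaf _ _ _) (eP _ _ _).
Qed.

Definition case_prog (P Q : cmd) : cmd := If main_reg is_one P Q.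

Lemma tree_exec_case_Node P Q t u v n :
  tree_exec P (Node t u) v n -> tree_exec (case_prog P Q) (Node t u) v n.+2.
Proof. by move=> e i s o; apply: ExecIfTrue (e i s o). Qed.

Lemma tree_exec_case_Leaf P Q v n :
  tree_exec Q Leaf v n -> tree_exec (case_prog P Q) Leaf v n.+2.
Proof.
by move=> e i s o; apply: ExecWeaken (ExecIfFalse _ _ (e i s o)) _.
Qed.

Definition fold_body (P : cmd) : cmd :=
  pair_prog (Seq fst_prog snd_prog)
            (Seq (pair_prog (Seq fst_prog fst_prog) snd_prog) P).

(* The loop keeps the remaining list on top of the accumulator, and the two are
   joined into one tree while the body runs. *)
Definition fold_loop (P : cmd) : cmd :=
  While main_reg is_one
    (Seq (Push main_reg one) (Seq (fold_body P) (Pop main_reg))).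

Definition fold_prog (P : cmd) : cmd :=
  Seq (Pop main_reg) (Seq (fold_loop P) (Pop main_reg)).

Section Fold.
Context {A S : Type} {eA : Encoding A} {eS : Encoding S}.
Variables (G : S -> A -> S) (P : cmd) (time : nat -> nat).
Hypothesis time_homo : {homo time : m n / m <= n}.
Hypothesis execP : forall a s,
  tree_exec P (enc (a, s)) (enc (G s a)) (time (enc_size (a, s))).

Lemma tree_exec_fold_body a l s :
  tree_exec (fold_body P) (enc (a :: l, s)) (enc (l, G s a))
    (time (enc_size (a, s)) + 1000 * (enc_size (a :: l, s) + enc_size (G s a))).
Proof.
rewrite !enc_pair !enc_cons; apply: tree_exec_weaken.
  apply: tree_exec_pair.
    exact: tree_exec_Seq (tree_exec_fst _ _) (tree_exec_snd _ _).
  apply: tree_exec_Seq (execP a s); apply: tree_exec_pair (tree_exec_snd _ _).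
  exact: tree_exec_Seq (tree_exec_fst _ _) (tree_exec_fst _ _).
by rewrite !enc_size_pair enc_size_cons !tree_size_Node /enc_size /=; lia.
Qed.

Lemma exec_fold_loop m l s i d o :
  (forall j, enc_size (foldl G s (take j l)) <= m) ->
  exec (fold_loop P)
    (main_word i (tree_word (enc l) ++ tree_word (enc s) ++ d) o)
    (main_word i (zero :: tree_word (enc (foldl G s l)) ++ d) o)
    (size l * (time (enc_size l + m).+1 + 2000 * (enc_size l + m).+1) + 1).
Proof.
elim: l s => [|a l IH] s le_m; first exact: ExecWhileFalse.
have le_s : enc_size s <= m := le_m 0.
have le_G : enc_size (G s a) <= m by have := le_m 1; rewrite /= take0.
have le_time : time (enc_size (a, s)) <= time (enc_size (a :: l) + m).+1.
  by apply: time_homo; rewrite enc_size_pair enc_size_cons; lia.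
have le_time' : time (enc_size l + m).+1 <= time (enc_size (a :: l) + m).+1.
  by apply: time_homo; rewrite enc_size_cons; lia.
have body := tree_exec_fold_body a l s i d o.
rewrite !enc_pair !enc_cons !tree_word_Node !cat_cons -!catA /= in body.
apply: ExecWeaken.
  apply: ExecWhileTrue; [by [] | | exact: IH (fun j => le_m j.+1)].
  rewrite enc_cons tree_word_Node cat_cons -!catA.
  by apply: ExecSeq (ExecPush _ _ _) _; apply: ExecSeq body (ExecPop _ _).
have le_iter : time (enc_size l + m).+1 + 2000 * (enc_size l + m).+1 <=
    time (enc_size (a :: l) + m).+1 + 2000 * (enc_size (a :: l) + m).+1.
  by rewrite leq_add ?leq_mul // enc_size_cons; lia.
rewrite -[size (a :: l)]/(size l).+1 [(size l).+1 * _]mulSn.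
have := leq_mul (leqnn (size l)) le_iter.
by rewrite !enc_size_pair !enc_size_cons in le_time *; lia.
Qed.

Lemma tree_exec_foldl m l s :
  (forall j, enc_size (foldl G s (take j l)) <= m) ->
  tree_exec (fold_prog P) (enc (l, s)) (enc (foldl G s l))
    (size l * (time (enc_size l + m).+1 + 2000 * (enc_size l + m).+1) + 3).
Proof.
move=> le_m i d o; rewrite enc_pair tree_word_Node; apply: exec_conv.
- apply: ExecSeq (ExecPop _ _) _; rewrite /= -catA.
  by apply: ExecSeq (exec_fold_loop _ _ _ le_m) (ExecPop _ _).
- by [].
- by lia.
Qed.

End Fold.
End TreePrograms.

(** * Polynomial-time functions on encoded data *)

Definition poly_bounded (g : nat -> nat) : Prop :=
  exists d, forall n, g n <= n.+2 ^ d.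

Lemma leq_exp2r_homo d : {homo expn^~ d : m n / m <= n}.
Proof. by case: d => // d m n le; rewrite leq_exp2r. Qed.

Lemma poly_bounded_le g h :
  (forall n, g n <= h n) -> poly_bounded h -> poly_bounded g.
Proof. by move=> le [d hd]; exists d => n; apply: leq_trans (hd n). Qed.

Lemma poly_bounded_const c : poly_bounded (fun=> c).
Proof.
exists c => n; apply: (@leq_trans (2 ^ c)); first exact/ltnW/ltn_expl.
exact: leq_exp2r_homo.
Qed.

Lemma poly_bounded_id : poly_bounded id.
Proof. by exists 1 => n; rewrite expn1; lia. Qed.

Lemma poly_bounded_add g h :
  poly_bounded g -> poly_bounded h -> poly_bounded (fun n => g n + h n).
Proof.
move=> [d hd] [e he]; exists (d + e).+1 => n.
apply: leq_trans (leq_add (hd n) (he n)) _.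
rewrite expnS; apply: (@leq_trans (2 * n.+2 ^ (d + e))); last exact: leq_mul.
by rewrite mul2n -addnn leq_add // leq_pexp2l //; lia.
Qed.

Lemma poly_bounded_mul g h :
  poly_bounded g -> poly_bounded h -> poly_bounded (fun n => g n * h n).
Proof.
by move=> [d hd] [e he]; exists (d + e) => n; rewrite expnD leq_mul.
Qed.

Lemma poly_bounded_S g : poly_bounded g -> poly_bounded (fun n => (g n).+1).
Proof.
move=> pg; apply: poly_bounded_le (poly_bounded_add pg (poly_bounded_const 1)).
by move=> n; lia.
Qed.

Lemma poly_bounded_exp g k : poly_bounded g -> poly_bounded (fun n => g n ^ k).
Proof.
move=> pg; elim: k => [|k IH]; first exact: poly_bounded_const.
by apply: poly_bounded_le (poly_bounded_mul pg IH) => n; rewrite expnS.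
Qed.

Lemma poly_bounded_comp g h :
  poly_bounded g -> poly_bounded h -> poly_bounded (fun n => g (h n)).
Proof.
move=> [d hd] ph; apply: (@poly_bounded_le _ (fun n => (h n).+2 ^ d)) => //.
exact/poly_bounded_exp/poly_bounded_S/poly_bounded_S.
Qed.

Create HintDb poly_bounded.
#[export] Hint Resolve poly_bounded_const poly_bounded_id poly_bounded_add
  poly_bounded_mul poly_bounded_S poly_bounded_exp : poly_bounded.
Ltac poly_bounded := solve [auto 40 with poly_bounded].

Definition ptime (I : finType) {X Y : Type} {eX : Encoding X} {eY : Encoding Y}
    (f : X -> Y) : Prop :=
  exists P d, forall x,
    tree_exec (I := I) P (enc x) (enc (f x)) ((enc_size x).+2 ^ d)
    /\ enc_size (f x) <= (enc_size x).+2 ^ d.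

Section PtimeIntro.
Context {I : finType} {X Y : Type} {eX : Encoding X} {eY : Encoding Y}.
Notation ptime := (@ptime I _ _ _ _).

Lemma ptime_intro (f : X -> Y) P g h : poly_bounded g -> poly_bounded h ->
  (forall x, tree_exec (I := I) P (enc x) (enc (f x)) (g (enc_size x))) ->
  (forall x, enc_size (f x) <= h (enc_size x)) -> ptime f.
Proof.
move=> pg ph; case: (poly_bounded_add pg ph) => d hd eP le; exists P, d => x.
split; first by apply: tree_exec_weaken (eP x) _; apply: leq_trans (hd _); lia.
by apply: leq_trans (le x) _; apply: leq_trans (hd _); lia.
Qed.

Lemma ptime_size_bound (f : X -> Y) : ptime f ->
  exists2 h, poly_bounded h & forall x, enc_size (f x) <= h (enc_size x).
Proof.
case=> P [d run_f]; exists (fun n => n.+2 ^ d); first by poly_bounded.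
by move=> x; case: (run_f x).
Qed.

Lemma eq_ptime (f g : X -> Y) : f =1 g -> ptime f -> ptime g.
Proof.
by move=> e [P [d run_f]]; exists P, d => x; have := run_f x; rewrite e.
Qed.

Lemma ptime_cast (f : X -> Y) : (forall x, enc (f x) = enc x) -> ptime f.
Proof.
move=> e; apply: (ptime_intro (P := Skip) (g := id) (h := id)).
- by poly_bounded.
- by poly_bounded.
- by move=> x; rewrite e; apply: tree_exec_weaken; first exact: tree_exec_Skip.
- by move=> x; rewrite /enc_size e.
Qed.

Lemma ptime_const (c : Y) : ptime (fun _ : X => c).
Proof.
apply: (ptime_intro (P := const_prog I (enc c))
  (g := fun n => 20 * n + 2 * enc_size c) (h := fun=> enc_size c)) => //.
- by poly_bounded.
- by poly_bounded.
- by move=> x; apply: tree_exec_const.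
Qed.

End PtimeIntro.

Section PtimeClosure.
Context {I : finType} {X Y Z : Type}.
Context {eX : Encoding X} {eY : Encoding Y} {eZ : Encoding Z}.
Notation ptime := (@ptime I _ _ _ _).

Lemma ptime_comp (g : Y -> Z) (f : X -> Y) :
  ptime g -> ptime f -> ptime (fun x => g (f x)).
Proof.
case=> Pg [d run_g] [Pf [e run_f]].
apply: (ptime_intro (P := Seq Pf Pg)
  (g := fun n => n.+2 ^ e + (n.+2 ^ e).+2 ^ d)
  (h := fun n => (n.+2 ^ e).+2 ^ d)).
- by poly_bounded.
- by poly_bounded.
- move=> x; have [exec_f le_f] := run_f x; have [exec_g _] := run_g (f x).
  apply: tree_exec_Seq exec_f _; apply: tree_exec_weaken exec_g _.
  by apply: leq_exp2r_homo; lia.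
- move=> x; have [_ le_f] := run_f x; have [_ le_g] := run_g (f x).
  by apply: leq_trans le_g _; apply: leq_exp2r_homo; lia.
Qed.

Lemma ptime_pair (f : X -> Y) (g : X -> Z) :
  ptime f -> ptime g -> ptime (fun x => (f x, g x)).
Proof.
case=> Pf [d run_f] [Pg [e run_g]].
apply: (ptime_intro (P := pair_prog Pf Pg)
  (g := fun n => n.+2 ^ d + n.+2 ^ e + 100 * (n + n.+2 ^ d + n.+2 ^ e))
  (h := fun n => (n.+2 ^ d + n.+2 ^ e).+1)).
- by poly_bounded.
- by poly_bounded.
- move=> x; have [exec_f le_f] := run_f x; have [exec_g le_g] := run_g x.
  apply: tree_exec_weaken; first exact: tree_exec_pair exec_f exec_g.
  by rewrite -/(enc_size x) -/(enc_size (f x)) -/(enc_size (g x)); lia.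
- move=> x; have [_ le_f] := run_f x; have [_ le_g] := run_g x.
  by rewrite enc_size_pair; lia.
Qed.

Lemma ptime_if (b : X -> bool) (f g : X -> Y) : ptime b -> ptime f -> ptime g ->
  ptime (fun x => if b x then f x else g x).
Proof.
case=> Pb [c run_b] [Pf [d run_f]] [Pg [e run_g]].
apply: (ptime_intro (P := if_prog Pb Pf Pg)
   (g := fun n => n.+2 ^ c + (n.+2 ^ d + n.+2 ^ e) + 200 * n)
   (h := fun n => n.+2 ^ d + n.+2 ^ e)).
- by poly_bounded.
- by poly_bounded.
- move=> x; have [exec_b _] := run_b x; apply: tree_exec_if exec_b _.
  have [[exec_f _] [exec_g _]] := (run_f x, run_g x); case: (b x).
    by apply: tree_exec_weaken exec_f _; lia.
  by apply: tree_exec_weaken exec_g _; lia.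
- move=> x; have [_ le_f] := run_f x; have [_ le_g] := run_g x.
  by case: (b x); lia.
Qed.

End PtimeClosure.

Lemma ptime_id {I : finType} {X} {eX : Encoding X} : ptime I (fun x : X => x).
Proof. exact: ptime_cast. Qed.

Section PtimeApp2.
Context {I : finType} {X A B C : Type}.
Context {eX : Encoding X} {eA : Encoding A} {eB : Encoding B} {eC : Encoding C}.

Lemma ptime_comp2 (F : A -> B -> C) (a : X -> A) (b : X -> B) :
  ptime I (fun p : A * B => F p.1 p.2) -> ptime I a -> ptime I b ->
  ptime I (fun x => F (a x) (b x)).
Proof.
move=> pF pa pb.
exact: (ptime_comp (f := fun x => (a x, b x)) pF (ptime_pair pa pb)).
Qed.

Lemma ptime_fst (f : X -> A * B) : ptime I f -> ptime I (fun x => (f x).1).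
Proof.
apply: ptime_comp; apply: (ptime_intro (P := fst_prog I) (g := fun n => 100 * n)
  (h := id)); try poly_bounded.
  by case=> a b; apply: tree_exec_fst.
by case=> a b; rewrite enc_size_pair /=; lia.
Qed.

Lemma ptime_snd (f : X -> A * B) : ptime I f -> ptime I (fun x => (f x).2).
Proof.
apply: ptime_comp; apply: (ptime_intro (P := snd_prog I) (g := fun n => 100 * n)
  (h := id)); try poly_bounded.
  by case=> a b; apply: tree_exec_snd.
by case=> a b; rewrite enc_size_pair /=; lia.
Qed.

End PtimeApp2.

Definition is_node (t : tree) : bool := if t is Node _ _ then true else false.
Definition tree_left (t : tree) : tree := if t is Node l _ then l else Leaf.
Definition tree_right (t : tree) : tree := if t is Node _ r then r else Leaf.

Section PtimeTree.
Context {I : finType} {X Y : Type} {eX : Encoding X} {eY : Encoding Y}.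

Lemma ptime_is_node (t : X -> tree) :
  ptime I t -> ptime I (fun x => is_node (t x)).
Proof.
apply: ptime_comp; apply: (ptime_intro
  (g := fun n => (20 * n + 6).+2) (h := fun=> 3)
  (P := case_prog (const_prog I (enc true)) (const_prog I (enc false))));
  try poly_bounded; last by case.
case=> [|l r].
  by apply: tree_exec_weaken; first exact/tree_exec_case_Leaf/tree_exec_const.
exact/tree_exec_case_Node/tree_exec_const.
Qed.

Lemma ptime_tree_left (t : X -> tree) :
  ptime I t -> ptime I (fun x => tree_left (t x)).
Proof.
apply: ptime_comp; apply: (ptime_intro (g := fun n => (100 * n).+2) (h := id)
  (P := case_prog (fst_prog I) Skip)); try poly_bounded.
  case=> [|l r]; last exact/tree_exec_case_Node/tree_exec_fst.
  by apply: tree_exec_weaken; first exact/tree_exec_case_Leaf/tree_exec_Skip.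
by case=> [|l r] //=; rewrite !enc_size_tree tree_size_Node; lia.
Qed.

Lemma ptime_tree_right (t : X -> tree) :
  ptime I t -> ptime I (fun x => tree_right (t x)).
Proof.
apply: ptime_comp; apply: (ptime_intro (g := fun n => (100 * n).+2) (h := id)
  (P := case_prog (snd_prog I) Skip)); try poly_bounded.
  case=> [|l r]; last exact/tree_exec_case_Node/tree_exec_snd.
  by apply: tree_exec_weaken; first exact/tree_exec_case_Leaf/tree_exec_Skip.
by case=> [|l r] //=; rewrite !enc_size_tree tree_size_Node; lia.
Qed.

Lemma ptime_on_tree (f : X -> Y) (F : tree -> tree) : ptime I F ->
  (forall x, enc (f x) = F (enc x)) -> ptime I f.
Proof.
case=> P [d run_F] fE; exists P, d => x; rewrite /enc_size !fE.
exact: run_F (enc x).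
Qed.

End PtimeTree.

Create HintDb ptime.
#[export] Hint Constants Opaque : ptime.
#[export] Hint Resolve ptime_const ptime_id | 0 : ptime.
#[export] Hint Resolve ptime_pair ptime_fst ptime_snd ptime_if ptime_is_node
  ptime_tree_left ptime_tree_right : ptime.
(* Unification may hand back eta-contracted functions, on which the lemmas above
   do not match. *)
#[export] Hint Extern 2 (@ptime ?I ?X ?Y ?eX ?eY ?f) =>
  lazymatch f with
  | (fun _ => _) => fail
  | _ => change (@ptime I X Y eX eY (fun x => f x))
  end : ptime.
#[export] Hint Extern 3 (@ptime _ _ _ _ _ (fun x => ?h (@?a x))) =>
  match goal with
  | H : ptime _ h |- _ => refine (ptime_comp (g := h) (f := a) H _)
  end : ptime.
Ltac ptime := solve [eauto 60 with ptime nocore].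

Fixpoint tree_eq (t u : tree) : bool :=
  match t, u with
  | Leaf, Leaf => true
  | Node l r, Node l' r' => tree_eq l l' && tree_eq r r'
  | _, _ => false
  end.

Lemma tree_eqP : Equality.axiom tree_eq.
Proof.
move=> t u; apply: (iffP idP) => [|<-]; last by elim: t => //= l -> r ->.
by elim: t u => [|l IHl r IHr] [|l' r'] //= /andP[/IHl -> /IHr ->].
Qed.

Section PtimeFinite.
Context {I : finType}.

Lemma ptime_tree_eq (t : tree) : ptime I (tree_eq t).
Proof.
elim: t => [|l IHl r IHr].
  by apply: (eq_ptime (f := fun u => if is_node u then false else true));
    [case | ptime].
apply: (eq_ptime (f := fun u => if is_node u then
    if tree_eq l (tree_left u) then tree_eq r (tree_right u) else false
  else false)); first by case.
have := ptime_comp IHl (ptime_tree_left ptime_id).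
have := ptime_comp IHr (ptime_tree_right ptime_id).
by ptime.
Qed.

Lemma ptime_enc {X} {eX : Encoding X} : ptime I (fun x : X => enc x).
Proof. exact: ptime_cast. Qed.

Lemma ptime_of_enc {X Y} {eX : Encoding X} {eY : Encoding Y} (F : tree -> Y)
  (f : X -> Y) : ptime I F -> (forall x, f x = F (enc x)) -> ptime I f.
Proof.
move=> pF fE; apply: eq_ptime (fun x => esym (fE x)) _.
exact: (ptime_comp (f := enc) pF ptime_enc).
Qed.

Lemma ptime_finite {A : finType} {T} {eA : Encoding A} {eT : Encoding T}
  (f : A -> T) : ptime I f.
Proof.
have [a0 _|A0] := pickP (@predT A); last by exists Skip, 0 => x; have := A0 x.
suff [g pg fg] : exists2 g, @ptime I A T eA eT g & {in enum A, f =1 g}.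
  by apply: eq_ptime pg => a; rewrite fg ?mem_enum.
elim: (enum A) => [|a s [g pg fg]].
  by exists (fun=> f a0); first exact: ptime_const.
exists (fun b => if tree_eq (enc a) (enc b) then f a else g b).
  have eq_a : ptime I (fun b : A => tree_eq (enc a) (enc b)).
    exact: ptime_of_enc (ptime_tree_eq (enc a)) _.
  by ptime.
move=> b; rewrite inE; case: tree_eqP => [/(@enc_inj A eA)->//|ne].
case/predU1P=> [ba|/fg//].
by rewrite ba in ne.
Qed.

End PtimeFinite.

Section PtimeBasic.
Context {I : finType} {X A : Type} {eX : Encoding X} {eA : Encoding A}.

Lemma ptime_succ (a : X -> nat) : ptime I a -> ptime I (fun x => (a x).+1).
Proof.
move=> pa.
apply: (ptime_comp (g := fun p : unit * nat => p.2.+1)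
  (f := fun x => (tt, a x))).
  exact: ptime_cast.
by ptime.
Qed.

Lemma ptime_pred (a : X -> nat) : ptime I a -> ptime I (fun x => (a x).-1).
Proof.
by apply: ptime_comp; apply: (ptime_on_tree (F := tree_right)); [ptime | case].
Qed.

Lemma ptime_eq0 (a : X -> nat) : ptime I a -> ptime I (fun x => a x == 0).
Proof.
move=> pa; apply: (ptime_comp (g := fun n => n == 0) _ pa).
by apply: (ptime_of_enc (ptime_tree_eq Leaf)); case.
Qed.

Lemma ptime_cons (a : X -> A) (l : X -> seq A) :
  ptime I a -> ptime I l -> ptime I (fun x => a x :: l x).
Proof. by apply: ptime_comp2; apply: ptime_cast. Qed.

Lemma ptime_behead (l : X -> seq A) :
  ptime I l -> ptime I (fun x => behead (l x)).
Proof.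
by apply: ptime_comp; apply: (ptime_on_tree (F := tree_right)); [ptime | case].
Qed.

Lemma ptime_head c (l : X -> seq A) :
  ptime I l -> ptime I (fun x => head c (l x)).
Proof.
apply: ptime_comp.
apply: (ptime_on_tree (F := fun t => if is_node t then tree_left t else enc c)).
  by ptime.
by case.
Qed.

Lemma ptime_nilp (l : X -> seq A) : ptime I l -> ptime I (fun x => nilp (l x)).
Proof.
by apply: ptime_comp; apply: (ptime_of_enc (ptime_tree_eq Leaf)); case.
Qed.

Lemma ptime_Some (a : X -> A) : ptime I a -> ptime I (fun x => Some (a x)).
Proof.
move=> pa.
apply: (ptime_comp (g := fun p : unit * A => Some p.2)
  (f := fun x => (tt, a x))).
  exact: ptime_cast.
by ptime.
Qed.

Lemma ptime_isSome (a : X -> option A) :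
  ptime I a -> ptime I (fun x => isSome (a x)).
Proof.
by apply: ptime_comp; apply: (ptime_of_enc (F := is_node)); [ptime | case].
Qed.

Lemma ptime_odflt c (a : X -> option A) :
  ptime I a -> ptime I (fun x => odflt c (a x)).
Proof.
apply: ptime_comp.
apply: (ptime_on_tree
  (F := fun t => if is_node t then tree_right t else enc c)).
  by ptime.
by case.
Qed.

Lemma ptime_nseq_tt (n : X -> nat) : ptime I n ->
  ptime I (fun x => nseq (n x) tt).
Proof.
by apply: ptime_comp; apply: ptime_cast; elim=> //= m IH; rewrite enc_cons IH.
Qed.

Lemma ptime_negb (a : X -> bool) : ptime I a -> ptime I (fun x => ~~ a x).
Proof. by apply: ptime_comp; apply: ptime_finite. Qed.

Lemma ptime_andb (a b : X -> bool) :
  ptime I a -> ptime I b -> ptime I (fun x => a x && b x).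
Proof. by apply: ptime_comp2; apply: ptime_finite. Qed.

Lemma ptime_orb (a b : X -> bool) :
  ptime I a -> ptime I b -> ptime I (fun x => a x || b x).
Proof. by apply: ptime_comp2; apply: ptime_finite. Qed.

Lemma ptime_implyb (a b : X -> bool) :
  ptime I a -> ptime I b -> ptime I (fun x => a x ==> b x).
Proof. by apply: ptime_comp2; apply: ptime_finite. Qed.

Lemma ptime_addb (a b : X -> bool) :
  ptime I a -> ptime I b -> ptime I (fun x => a x (+) b x).
Proof. by apply: ptime_comp2; apply: ptime_finite. Qed.

Lemma ptime_eq_finType {B : finType} {eB : Encoding B} (a b : X -> B) :
  ptime I a -> ptime I b -> ptime I (fun x => a x == b x).
Proof. by apply: ptime_comp2; apply: ptime_finite. Qed.

Lemma ptime_eqb (a b : X -> bool) :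
  ptime I a -> ptime I b -> ptime I (fun x => a x == b x).
Proof. exact: ptime_eq_finType. Qed.

End PtimeBasic.

#[export] Hint Resolve ptime_succ ptime_pred ptime_eq0 ptime_cons ptime_behead
  ptime_head ptime_nilp ptime_Some ptime_isSome ptime_odflt ptime_nseq_tt
  ptime_negb ptime_andb ptime_orb ptime_implyb ptime_addb ptime_eqb : ptime.

Section PtimeFoldl.
Context {I : finType} {X A S : Type}.
Context {eX : Encoding X} {eA : Encoding A} {eS : Encoding S}.
Variables (F : X -> S -> A -> S) (s0 : X -> S) (l : X -> seq A).
Hypotheses (ptime_s0 : ptime I s0) (ptime_l : ptime I l).
Hypothesis ptime_F : ptime I (fun p : X * S * A => F p.1.1 p.1.2 p.2).

Lemma ptime_foldl B : poly_bounded B ->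
  (forall x k,
    enc_size (foldl (F x) (s0 x) (take k (l x))) <= B (enc_size x)) ->
  ptime I (fun x => foldl (F x) (s0 x) (l x)).
Proof.
move=> pB hB; pose G (p : X * S) (a : A) := (p.1, F p.1 p.2 a).
have foldlG x s t : foldl G (x, s) t = (x, foldl (F x) s t).
  by elim: t s => //= a t IH s; rewrite IH.
have ptime_G : ptime I (fun q : A * (X * S) => G q.2 q.1).
  have := ptime_comp (f := fun q : A * (X * S) => (q.2, q.1)) ptime_F.
  by rewrite /G; ptime.
have ptime_init : ptime I (fun x => (l x, (x, s0 x))) by ptime.
case: ptime_G => P [d execP]; case: (ptime_size_bound ptime_l) => b pb hb.
apply: (eq_ptime (f := fun x => (foldl G (x, s0 x) (l x)).2)).
  by move=> x; rewrite foldlG.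
apply: ptime_snd; case: ptime_init => Q [e execQ].
apply: (ptime_intro (P := Seq Q (fold_prog P)) (h := fun n => (n + B n).+1)
  (g := fun n => n.+2 ^ e + (b n * ((b n + (n + B n).+1).+3 ^ d
    + 2000 * (b n + (n + B n).+1).+1) + 3))).
- by poly_bounded.
- by poly_bounded.
- move=> x; have [eQ _] := execQ x; apply: tree_exec_Seq eQ _.
  have le_m k : enc_size (foldl G (x, s0 x) (take k (l x)))
      <= (enc_size x + B (enc_size x)).+1.
    by rewrite foldlG enc_size_pair ltnS leq_add2l.
  apply: tree_exec_weaken.
    apply: (tree_exec_foldl (time := fun n => n.+2 ^ d) _ _ le_m).
      by move=> m n le; apply: leq_exp2r_homo.
    by move=> a p; have [] := execP (a, p).
  apply: leq_add => //; apply: leq_mul.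
    exact: leq_trans (size_le_enc_size _) (hb x).
  have le_b := hb x; apply: leq_add; last by lia.
  by apply: leq_exp2r_homo; lia.
- move=> x; rewrite foldlG enc_size_pair ltnS leq_add2l.
  by have := hB x (size (l x)); rewrite take_size.
Qed.

Lemma ptime_foldl_additive C : poly_bounded C ->
  (forall x s a,
    enc_size (F x s a) <= enc_size s + C (enc_size x + enc_size a)) ->
  ptime I (fun x => foldl (F x) (s0 x) (l x)).
Proof.
case=> d hC hF.
have [b0 pb0 hb0] := ptime_size_bound ptime_s0.
have [b pb hb] := ptime_size_bound ptime_l.
pose D n := (n + b n).+2 ^ d.
have size_foldl x s t : enc_size t <= b (enc_size x) ->
    enc_size (foldl (F x) s t) <= enc_size s + size t * D (enc_size x).
  elim: t s => [|a t IH] s /=; first by rewrite addn0.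
  rewrite enc_size_cons => le; apply: leq_trans (IH _ _) _; first lia.
  rewrite mulSn addnA leq_add2r (leq_trans (hF x s a)) // leq_add2l.
  by apply: leq_trans (hC _) _; apply: leq_exp2r_homo; lia.
apply: (@ptime_foldl (fun n => b0 n + b n * D n)).
  by rewrite /D; poly_bounded.
move=> x k; have le : enc_size (take k (l x)) <= b (enc_size x).
  exact: leq_trans (enc_size_take _ _) (hb x).
apply: leq_trans (size_foldl _ _ _ le) _.
by rewrite leq_add // leq_mul // (leq_trans (size_le_enc_size _)).
Qed.

End PtimeFoldl.

Section PtimeIter.
Context {I : finType} {X S : Type} {eX : Encoding X} {eS : Encoding S}.
Variables (F : X -> S -> S) (s0 : X -> S) (n : X -> nat).
Hypotheses (ptime_s0 : ptime I s0) (ptime_n : ptime I n).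
Hypothesis ptime_F : ptime I (fun p : X * S => F p.1 p.2).

Let foldl_nseq x k :
  foldl (fun s _ => F x s) (s0 x) (nseq k tt) = iter k (F x) (s0 x).
Proof.
by elim: k (s0 x) => //= k IH s; rewrite IH -iterSr.
Qed.

Let ptime_step : ptime I (fun p : X * S * unit => F p.1.1 p.1.2).
Proof.
by apply: (ptime_comp (f := fun p : X * S * unit => p.1) ptime_F); ptime.
Qed.

Lemma ptime_iter B : poly_bounded B ->
  (forall x k, k <= n x -> enc_size (iter k (F x) (s0 x)) <= B (enc_size x)) ->
  ptime I (fun x => iter (n x) (F x) (s0 x)).
Proof.
move=> pB hB; apply: (eq_ptime
    (f := fun x => foldl (fun s _ => F x s) (s0 x) (nseq (n x) tt))).
  by move=> x; rewrite foldl_nseq.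
apply: (ptime_foldl _ _ ptime_step pB) => //; first by ptime.
move=> x k; have -> : take k (nseq (n x) tt) = nseq (minn k (n x)) tt.
  apply: (@eq_from_nth _ tt) => [|i _]; last by case: nth; case: nth.
  by rewrite size_take_min !size_nseq.
by rewrite foldl_nseq hB ?geq_minr.
Qed.

Lemma ptime_iter_additive C : poly_bounded C ->
  (forall x s, enc_size (F x s) <= enc_size s + C (enc_size x)) ->
  ptime I (fun x => iter (n x) (F x) (s0 x)).
Proof.
move=> [d hC] hF; apply: (eq_ptime
    (f := fun x => foldl (fun s _ => F x s) (s0 x) (nseq (n x) tt))).
  by move=> x; rewrite foldl_nseq.
apply: (ptime_foldl_additive _ _ ptime_step (C := fun n => n.+2 ^ d)) => //.
- by ptime.
- by poly_bounded.
move=> x s u; apply: leq_trans (hF x s) _; rewrite leq_add2l.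
by apply: leq_trans (hC _) _; apply: leq_exp2r_homo; lia.
Qed.

End PtimeIter.

Section PtimeNat.
Context {I : finType} {X : Type} {eX : Encoding X}.
Implicit Types a b : X -> nat.

Lemma ptime_addn a b : ptime I a -> ptime I b -> ptime I (fun x => a x + b x).
Proof.
move=> pa pb; apply: (eq_ptime (f := fun x => iter (a x) succn (b x))).
  by move=> x; rewrite iter_succn addnC.
apply: (ptime_iter_additive _ _ _ (C := fun=> 2)) => //;
  [by ptime | by poly_bounded |].
by move=> x s; rewrite !enc_size_nat; lia.
Qed.

Lemma ptime_subn a b : ptime I a -> ptime I b -> ptime I (fun x => a x - b x).
Proof.
move=> pa pb; apply: (eq_ptime (f := fun x => iter (b x) predn (a x))).
  by move=> x; rewrite iter_predn.
apply: (ptime_iter_additive _ _ _ (C := fun=> 0)) => //;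
  [by ptime | by poly_bounded |].
by move=> x s; rewrite !enc_size_nat; lia.
Qed.

End PtimeNat.

#[export] Hint Resolve ptime_addn ptime_subn : ptime.

Section PtimeMul.
Context {I : finType} {X : Type} {eX : Encoding X}.
Implicit Types a b : X -> nat.

Lemma ptime_muln a b : ptime I a -> ptime I b -> ptime I (fun x => a x * b x).
Proof.
move=> pa pb; have [h ph hh] := ptime_size_bound pa.
apply: (eq_ptime (f := fun x => iter (b x) (addn (a x)) 0)).
  by move=> x; rewrite iter_addn_0.
apply: (ptime_iter_additive _ _ _ (C := h)) => //; first by ptime.
  by apply: ptime_addn; [apply: ptime_comp pa _; ptime | ptime].
by move=> x s; have := hh x; rewrite !enc_size_nat; lia.
Qed.

Lemma ptime_expn a k : ptime I a -> ptime I (fun x => a x ^ k).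
Proof.
move=> pa; elim: k => [|k IH]; first exact: ptime_const.
apply: (eq_ptime (f := fun x => a x * a x ^ k)); last exact: ptime_muln.
by move=> x; rewrite expnS.
Qed.

Lemma ptime_leq a b : ptime I a -> ptime I b -> ptime I (fun x => a x <= b x).
Proof. by move=> pa pb; apply/ptime_eq0/ptime_subn. Qed.

Lemma ptime_eqn a b : ptime I a -> ptime I b -> ptime I (fun x => a x == b x).
Proof.
move=> pa pb; apply: (eq_ptime (f := fun x => (a x <= b x) && (b x <= a x))).
  by move=> x; rewrite eqn_leq.
by apply: ptime_andb; apply: ptime_leq.
Qed.

End PtimeMul.

#[export] Hint Resolve ptime_muln ptime_expn ptime_leq
  ptime_eqn : ptime.

Section PtimeSeq.
Context {I : finType} {X A : Type} {eX : Encoding X} {eA : Encoding A}.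
Implicit Types l m : X -> seq A.

Lemma ptime_catrev l m :
  ptime I l -> ptime I m -> ptime I (fun x => catrev (l x) (m x)).
Proof.
move=> pl pm.
apply: (eq_ptime (f := fun x => foldl (fun s a => a :: s) (m x) (l x))).
  by move=> x; elim: (l x) (m x) => //= a t IH s.
apply: (ptime_foldl_additive _ _ _ (C := S)) => //;
  [by ptime | by poly_bounded |].
by move=> x s a; rewrite enc_size_cons; lia.
Qed.

Lemma ptime_rev l : ptime I l -> ptime I (fun x => rev (l x)).
Proof. by move=> pl; apply: ptime_catrev => //; apply: ptime_const. Qed.

Lemma ptime_drop l (n : X -> nat) :
  ptime I l -> ptime I n -> ptime I (fun x => drop (n x) (l x)).
Proof.
move=> pl pn; apply: (eq_ptime (f := fun x => iter (n x) behead (l x))).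
  by move=> x; rewrite drop_behead.
apply: (ptime_iter_additive _ _ _ (C := fun=> 0)) => //;
  [by ptime | by poly_bounded |].
by move=> x s; rewrite addn0 enc_size_behead.
Qed.

Lemma ptime_nth c l (n : X -> nat) :
  ptime I l -> ptime I n -> ptime I (fun x => nth c (l x) (n x)).
Proof.
move=> pl pn; apply: (eq_ptime (f := fun x => head c (drop (n x) (l x)))).
  by move=> x; rewrite -nth0 nth_drop addn0.
exact/ptime_head/ptime_drop.
Qed.

Lemma ptime_size l : ptime I l -> ptime I (fun x => size (l x)).
Proof.
move=> pl; apply: (eq_ptime (f := fun x => foldl (fun n _ => n.+1) 0 (l x))).
  move=> x; rewrite -[RHS]addn0; elim: (l x) 0 => //= a t IH n.
  by rewrite IH addnS.
apply: (ptime_foldl_additive _ _ _ (C := fun=> 2)) => //;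
  [by ptime | by ptime | by poly_bounded |].
by move=> x n a; rewrite !enc_size_nat; lia.
Qed.

Lemma ptime_cat l m : ptime I l -> ptime I m -> ptime I (fun x => l x ++ m x).
Proof.
move=> pl pm; apply: (eq_ptime (f := fun x => catrev (rev (l x)) (m x))).
  by move=> x; rewrite catrevE revK.
by apply: ptime_catrev => //; apply: ptime_rev.
Qed.

Lemma ptime_rcons l (a : X -> A) :
  ptime I l -> ptime I a -> ptime I (fun x => rcons (l x) (a x)).
Proof.
move=> pl pa; apply: (eq_ptime (f := fun x => l x ++ [:: a x])).
  by move=> x; rewrite cats1.
by apply: ptime_cat; ptime.
Qed.

End PtimeSeq.

#[export] Hint Resolve ptime_rev ptime_drop ptime_nth ptime_size ptime_cat
  ptime_rcons : ptime.

Lemma ptime_map {I : finType} {X A B : Type} {eX : Encoding X}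
    {eA : Encoding A} {eB : Encoding B} (f : X -> A -> B) (l : X -> seq A) :
  ptime I l -> ptime I (fun p : X * A => f p.1 p.2) ->
  ptime I (fun x => [seq f x a | a <- l x]).
Proof.
move=> pl pf; have [h ph hh] := ptime_size_bound pf.
apply: (eq_ptime
    (f := fun x => rev (foldl (fun s a => f x a :: s) [::] (l x)))).
  move=> x; rewrite -[RHS]revK; congr rev; rewrite -[RHS]cats0 -catrevE.
  by elim: (l x) [::] => //= a t IH s.
apply/ptime_rev/(ptime_foldl_additive _ _ _ (C := fun n => (h n.+1).+1)) => //.
- by ptime.
- apply: ptime_cons; last by ptime.
  by apply: (ptime_comp (f := fun p : X * seq B * A => (p.1.1, p.2)) pf); ptime.
- by apply/poly_bounded_S/poly_bounded_comp => //; poly_bounded.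
by move=> x s a; rewrite enc_size_cons; have := hh (x, a);
  rewrite enc_size_pair /=; lia.
Qed.

#[export] Hint Resolve ptime_map : ptime.

Section PtimeFilter.
Context {I : finType} {X A : Type} {eX : Encoding X} {eA : Encoding A}.
Implicit Types (l : X -> seq A) (p : X -> A -> bool).

Lemma ptime_flatten (l : X -> seq (seq A)) :
  ptime I l -> ptime I (fun x => flatten (l x)).
Proof.
move=> pl; apply: (eq_ptime (f := fun x => foldl cat [::] (l x))).
  move=> x; rewrite -[RHS]/([::] ++ _).
  by elim: (l x) [::] => [|a t IH] s /=; rewrite ?cats0 // IH catA.
apply: (ptime_foldl_additive _ _ _ (C := id)) => //;
  [by ptime | by ptime | by poly_bounded |].
by move=> x s a; rewrite -ltnS enc_size_cat; lia.
Qed.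

Lemma ptime_filter p l : ptime I l -> ptime I (fun q : X * A => p q.1 q.2) ->
  ptime I (fun x => [seq a <- l x | p x a]).
Proof.
move=> pl pp; apply: (eq_ptime (f := fun x =>
    flatten [seq if p x a then [:: a] else [::] | a <- l x]));
  last by apply: ptime_flatten; ptime.
by move=> x; elim: (l x) => //= a t ->; case: (p x a).
Qed.

Lemma ptime_has p l : ptime I l -> ptime I (fun q : X * A => p q.1 q.2) ->
  ptime I (fun x => has (p x) (l x)).
Proof.
move=> pl pp; apply: (eq_ptime (f := fun x => ~~ nilp [seq a <- l x | p x a])).
  by move=> x; rewrite /nilp size_filter has_count lt0n.
exact/ptime_negb/ptime_nilp/ptime_filter.
Qed.

Lemma ptime_all p l : ptime I l -> ptime I (fun q : X * A => p q.1 q.2) ->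
  ptime I (fun x => all (p x) (l x)).
Proof.
move=> pl pp.
apply: (eq_ptime (f := fun x => ~~ has (fun a => ~~ p x a) (l x))).
  by move=> x; rewrite -all_predC; apply: eq_all => a /=; rewrite negbK.
by apply/ptime_negb/ptime_has => //; apply: ptime_negb.
Qed.

End PtimeFilter.

#[export] Hint Resolve ptime_flatten ptime_filter ptime_has ptime_all : ptime.

Lemma ptime_pmap {I : finType} {X T} {B : finType}
  {eX : Encoding X} {eT : Encoding T} {eB : Encoding B}
  (f : B -> option T) (l : X -> seq B) :
  ptime I l -> ptime I (fun x => pmap f (l x)).
Proof.
move=> pl; apply: (eq_ptime (f := fun x =>
    flatten [seq seq_of_opt (f b) | b <- l x])).
  by move=> x; elim: (l x) => //= b t ->; case: (f b).
apply/ptime_flatten/ptime_map => //.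
exact: (ptime_comp (ptime_finite (fun b => seq_of_opt (f b)))
  (ptime_snd ptime_id)).
Qed.

#[export] Hint Resolve ptime_pmap : ptime.

Lemma ptime_mem {I : finType} {X : Type} {A : eqType}
    {eX : Encoding X} {eA : Encoding A} (a : X -> A) (l : X -> seq A) :
  ptime I (fun p : A * A => p.1 == p.2) -> ptime I a -> ptime I l ->
  ptime I (fun x => a x \in l x).
Proof.
move=> peq pa pl.
apply: (eq_ptime (f := fun x => has (fun b => a x == b) (l x))).
  by move=> x; rewrite -has_pred1; apply: eq_has => b; rewrite /= eq_sym.
apply: ptime_has => //.
apply: (ptime_comp2 peq); last by ptime.
exact: ptime_comp pa (ptime_fst ptime_id).
Qed.

Lemma ptime_uniq {I : finType} {X : Type} {A : eqType}
    {eX : Encoding X} {eA : Encoding A} (l : X -> seq A) :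
  ptime I (fun p : A * A => p.1 == p.2) -> ptime I l ->
  ptime I (fun x => uniq (l x)).
Proof.
pose step (s : bool * seq A) a := (s.1 && (a \notin s.2), a :: s.2).
have foldl_step s : foldl step (true, [::]) s = (uniq (rev s), rev s).
  elim/last_ind: s => // s a IH.
  by rewrite foldl_rcons IH rev_rcons /step /= andbC.
move=> peq pl.
apply: (eq_ptime (f := fun x => (foldl step (true, [::]) (l x)).1)).
  by move=> x; rewrite foldl_step rev_uniq.
apply/ptime_fst/(ptime_foldl_additive _ _ _ (C := fun n => n + 4)) => //.
- by ptime.
- rewrite /step; apply: ptime_pair; last by ptime.
  by apply: ptime_andb; last (apply/ptime_negb/ptime_mem => //); ptime.
- by poly_bounded.
move=> x [b s] a; rewrite /step !enc_size_pair enc_size_cons /=.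
case: (_ && _); case: b; rewrite /enc_size /tree_size /=; lia.
Qed.

#[export] Hint Resolve ptime_uniq : ptime.

Lemma enc_size_iota0 (n : nat) : enc_size (iota 0 n) <= (n * n.*2.+2).+1.
Proof.
elim: n => // n IH; rewrite -addn1 iotaD cats1 enc_size_rcons enc_size_nat.
by rewrite addn1 add0n; lia.
Qed.

Section PtimeIota.
Context {I : finType} {X : Type} {eX : Encoding X}.
Implicit Types m n : X -> nat.

Lemma ptime_iota0 n : ptime I n -> ptime I (fun x => iota 0 (n x)).
Proof.
have iterE k : iter k (fun s => rcons s (size s)) [::] = iota 0 k.
  by elim: k => // k IH; rewrite iterS IH size_iota -addn1 iotaD cats1.
move=> pn; have [h ph hh] := ptime_size_bound pn.
apply: (eq_ptime (f := fun x => iter (n x) (fun s => rcons s (size s)) [::])).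
  by move=> x; rewrite iterE.
apply: (ptime_iter _ _ _ (B := fun j => (h j * (h j).*2.+2).+1)) => //.
- by ptime.
- by ptime.
- apply/poly_bounded_S/poly_bounded_mul => //.
  apply: poly_bounded_le
    (poly_bounded_add (poly_bounded_add ph ph) (poly_bounded_const 2)).
  by move=> j; lia.
move=> x k le; rewrite iterE; apply: leq_trans (enc_size_iota0 k) _.
have := hh x; rewrite enc_size_nat => le'.
by rewrite ltnS leq_mul //; lia.
Qed.

Lemma ptime_iota m n :
  ptime I m -> ptime I n -> ptime I (fun x => iota (m x) (n x)).
Proof.
move=> pm pn.
apply: (eq_ptime (f := fun x => [seq m x + i | i <- iota 0 (n x)])).
  by move=> x; rewrite -iotaDl addn0.
apply: ptime_map; first exact: ptime_iota0.
by apply: ptime_addn; [exact: ptime_comp pm (ptime_fst ptime_id) | ptime].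
Qed.

End PtimeIota.

#[export] Hint Resolve ptime_iota : ptime.

(** * Input and output *)

(* Keeps [lia] from distinguishing convertible forms of [#|T|]. *)
Definition card_type (T : finType) : nat := #|T|.

Section InputOutput.
Variable I : finType.
Notation sym := (I + bool)%type.
Notation one := (inr true : sym).
Notation zero := (inr false : sym).
Notation cmd := (cmd I bool 5).

Fixpoint dispatch (r : 'I_6) (s : seq I) (K : I -> cmd) : cmd :=
  if s is a :: s' then If r (pred1 (Some (inl a))) (K a) (dispatch r s' K)
  else Skip.

Lemma exec_dispatch r s K a s1 s2 n :
  ohead (get_stack s1 r) = Some (inl a) -> a \in s -> exec (K a) s1 s2 n ->
  exec (dispatch r s K) s1 s2 (n + size s + 2).
Proof.
move=> top; elim: s => //= b s IH; rewrite inE; have [<-|ne] /= := eqVneq a b.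
  move=> _ e; apply: (@ExecWeaken _ _ _ _ _ _ n.+2); last by lia.
  by apply: ExecIfTrue e; rewrite top; apply: eqxx.
move=> a_s e; apply: (@ExecWeaken _ _ _ _ _ _ (n + size s + 2).+1); last by lia.
apply: ExecIfFalse (IH a_s e).
by rewrite top; apply: contra_neqN ne => /eqP[].
Qed.

Definition encode_symbol (a : I) : cmd :=
  Seq (Pop (aux_reg true))
    (Seq (push_bits I (tree_bits (enc a))) (Push main_reg one)).

Definition encode_loop : cmd :=
  While (aux_reg true) isSome (dispatch (aux_reg true) (enum I) encode_symbol).

Lemma enc_size_finType (a : I) : enc_size a <= 2 * card_type I.
Proof.
have lt : enum_rank a < card_type I := ltn_ord _.
rewrite -[enc_size a]/(enc_size (nat_of_ord (enum_rank a))) enc_size_nat.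
by lia.
Qed.

Lemma enc_size_word (w : seq I) :
  enc_size w <= size w * (2 * card_type I + 1) + 1.
Proof.
elim: w => // a w IH; rewrite enc_size_cons; have := enc_size_finType a.
by rewrite /=; lia.
Qed.

Lemma exec_encode_loop (u v : seq I) :
  exec encode_loop
    (stacks true [::] (tree_word I (enc v)) (map inl u) [::] [::] [::])
    (main_word [::] (tree_word I (enc (catrev u v))) [::])
    (size u * (5 * card_type I + 20) + 1).
Proof.
elim: u v => [|a u IH] v; first exact: ExecWhileFalse.
apply: ExecWeaken.
  apply: ExecWhileTrue (IH (a :: v)) => //.
  apply: exec_dispatch; [by [] | by rewrite mem_enum |].
  apply: ExecSeq (ExecPop _ _) _.
  apply: ExecSeq (exec_push_bits true _ _ _ _ _ _ _) _.
  by rewrite enc_cons tree_word_Node; apply: ExecPush.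
rewrite -cardE -/(card_type I) [size (a :: u)]/= [(size u).+1 * _]mulSn.
by have := enc_size_finType a; rewrite /enc_size /tree_size; lia.
Qed.

Definition load_prog : cmd := Seq (drain input_reg [:: aux_reg true])
  (Seq (Push main_reg zero) encode_loop).

Lemma exec_load (w : seq I) :
  exec load_prog (main_word (map inl w) [::] [::])
    (main_word [::] (tree_word I (enc w)) [::])
    (size w * (5 * card_type I + 30) + 10).
Proof.
apply: ExecWeaken.
  apply: ExecSeq (exec_drain _ _ _) _ => //.
  apply: ExecSeq (ExecPush _ _ _) _.
  have := exec_encode_loop (rev w) [::]; rewrite catrevE revK cats0 map_rev.
  by rewrite /rev; exact.
by rewrite /= size_map size_rev; lia.
Qed.

Section Print.
Variables (B : finType) (g : B -> I).

Fixpoint decode (s : seq B) : cmd :=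
  if s is b :: s' then
    If main_reg (@is_one I)
      (Seq (Pop main_reg) (Seq (Pop main_reg) (decode s')))
      (Seq (Pop main_reg) (Push (aux_reg true) (inl (g b))))
  else Skip.

Lemma exec_decode b0 s k i d a b c o : k < size s ->
  exec (decode s) (stacks true i (tree_word I (enc k) ++ d) a b c o)
    (stacks true i d (inl (g (nth b0 s k)) :: a) b c o) (4 * k + 4).
Proof.
elim: s k => // x s IH [|k] lt_k.
  by apply: ExecIfFalse => //; apply: ExecSeq (ExecPop _ _) (ExecPush _ _ _).
rewrite (_ : enc k.+1 = Node Leaf (enc k)) // tree_word_Node.
apply: (@ExecWeaken _ _ _ _ _ _ (1 + (1 + (4 * k + 4))).+2); last by lia.
apply: ExecIfTrue => //; apply: ExecSeq (ExecPop _ _) _.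
by apply: ExecSeq (ExecPop _ _) _; apply: IH.
Qed.

Definition decode_loop : cmd :=
  While main_reg (@is_one I) (Seq (Pop main_reg) (decode (enum B))).

Lemma exec_decode_loop (u : seq B) v :
  exec decode_loop
    (stacks true [::] (tree_word I (enc u)) v [::] [::] [::])
    (stacks true [::] [:: zero] (catrev (map (inl \o g) u) v) [::] [::] [::])
    (size u * (4 * card_type B + 10) + 1).
Proof.
elim: u v => [|b u IH] v; first exact: ExecWhileFalse.
have lt_b : enum_rank b < size (enum B) by rewrite -cardE ltn_ord.
have exec_b d := exec_decode b [::] d v [::] [::] [::] lt_b.
rewrite nth_enum_rank in exec_b.
rewrite enc_cons tree_word_Node; apply: ExecWeaken.
  apply: ExecWhileTrue (IH (inl (g b) :: v)) => //.
  by apply: ExecSeq (ExecPop _ _) _; apply: exec_b.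
have lt : enum_rank b < card_type B := ltn_ord _.
by rewrite [size (b :: u)]/= [(size u).+1 * _]mulSn; lia.
Qed.

Definition print_prog : cmd :=
  Seq decode_loop (drain (aux_reg true) [:: output_reg]).

Lemma exec_print (u : seq B) :
  exec print_prog (main_word [::] (tree_word I (enc u)) [::])
    (main_word [::] [:: zero] (map (inl \o g) u))
    (size u * (4 * card_type B + 20) + 2).
Proof.
apply: ExecWeaken.
  apply: ExecSeq (exec_decode_loop u [::]) _.
  rewrite catrevE cats0 -[map _ u in X in exec _ _ X]revK -[rev (rev _)]cats0.
  rewrite -catrevE; exact: exec_drain.
by rewrite /= size_rev size_map; lia.
Qed.

End Print.
End InputOutput.

Lemma poly_bounded_horner g :
  poly_bounded g -> exists p : {poly nat}, forall n, g n <= p.[n]%R.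
Proof.
have natrX (a k : nat) : (a ^+ k)%R = a ^ k.
  by elim: k => // k IH; rewrite exprS expnS -IH.
case=> d hd; exists (('X + 2%:P) ^+ d)%R => n; rewrite !hornerE natrX.
apply: leq_trans (hd n) _; apply: leq_exp2r_homo.
by change (n.+2 <= n + 1 + 1); lia.
Qed.

Lemma get_input_store (I : finType) (w : seq I) (r : 'I_6) :
  get_stack (main_word (map inl w) [::] [::]) r =
    if r == ord0 then map inl w else [::].
Proof. by case: r => -[|[|[|[|[|[|i]]]]]]. Qed.

Theorem inP_ptime (I : finType) (L : language I) (f : seq I -> bool) :
  ptime I f -> (forall w, L w <-> f w) -> inP L.
Proof.
case=> P [d HP] HL; pose N := card_type I.
pose g n := (n * (5 * N + 30) + 10 + (n * (2 * N + 1) + 1).+2 ^ d).+1.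
have [p hp] : exists p : {poly nat}, forall n, g n <= p.[n]%R.
  by apply: poly_bounded_horner; rewrite /g; poly_bounded.
pose prog := Seq (load_prog I) P.
exists (machine (halting_code prog main_reg (@is_one I))), p => w.
have [/(_ [::] [::] [::]) execP _] := HP w; rewrite !cats0 in execP.
have [m le_m [hlt acc _]] := run_halting_code main_reg (@is_one I)
  (get_input_store w) (ExecSeq (exec_load w) execP).
exists m; split=> //; last by rewrite HL acc; case: (f w).
apply: leq_trans le_m _; apply: leq_trans (hp _); rewrite ltnS leq_add2l.
by apply: leq_exp2r_homo; rewrite !ltnS enc_size_word.
Qed.

Lemma nonblank_prefix_map (S : Type) (s : seq S) m :
  nonblank_prefix (map Some s ++ nseq m None) = s.
Proof. by elim: s => [|a s IH] /=; [case: m | rewrite IH]. Qed.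

Definition inl_part {S T : Type} (s : S + T) : option S :=
  if s is inl a then Some a else None.

Definition inr_part {S T : Type} (s : S + T) : option T :=
  if s is inr b then Some b else None.

Lemma pmap_inl_part {S T : Type} (s : seq S) (t : seq T) :
  pmap inl_part (map inl s ++ map inr t) = s.
Proof. by rewrite pmap_cat map_pK //; elim: t => [|b t]; rewrite ?cats0. Qed.

Lemma pmap_inr_part {S T : Type} (s : seq S) (t : seq T) :
  pmap inr_part (map inl s ++ map inr t) = t.
Proof. by rewrite pmap_cat map_pK //; elim: s. Qed.

Theorem poly_time_ptime (A B : finType) (f : seq A -> seq B) :
  ptime (A + B)%type f -> poly_time f.
Proof.
move=> pf; pose N := card_type (A + B)%type; pose nB := card_type B.
have : ptime (A + B)%type (fun w : seq (A + B) => f (pmap inl_part w)).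
  by apply: ptime_comp pf _; ptime.
case=> P [d HP].
pose T n := (n * (2 * N + 1) + 1).+2 ^ d.
pose g n := (n * (5 * N + 30) + 10 + (T n + (T n * (4 * nB + 20) + 2))).+1.
have [p hp] : exists p : {poly nat}, forall n, g n <= p.[n]%R.
  by apply: poly_bounded_horner; rewrite /g /T; poly_bounded.
pose prog := Seq (load_prog (A + B)%type) (Seq P (print_prog (@inr A B))).
exists (machine (halting_code prog main_reg pred0)), p => w.
set v : seq (A + B)%type := map inl w.
have [/(_ [::] [::] [::])] := HP v.
rewrite (map_pK (f := inl_part)) // !cats0 => execP le_fw.
have [m le_m [hlt _ tps]] := run_halting_code main_reg pred0
  (get_input_store v)
  (ExecSeq (exec_load v) (ExecSeq execP (exec_print inr (f w)))).
have le_v : enc_size v <= size w * (2 * N + 1) + 1.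
  by have := enc_size_word v; rewrite size_map.
have le_T : (enc_size v).+2 ^ d <= T (size w) by apply: leq_exp2r_homo; lia.
have le_out : size (f w) <= T (size w).
  exact: leq_trans (size_le_enc_size _) (leq_trans le_fw le_T).
exists m; split; [| exact: hlt |].
  apply: leq_trans le_m _; apply: leq_trans (hp _); rewrite ltnS size_map.
  apply: leq_add; first by [].
  by apply: leq_add => //; rewrite leq_add2r leq_mul.
have [j ej] := tps output_reg.
rewrite /output (_ : ord_max = output_reg); last exact: val_inj.
by rewrite ej nonblank_prefix_map.
Qed.

(** * Words, points and selections of cells *)

Definition field_step (s : seq (seq bool) * seq bool) (a : option bool) :=
  if isSome a then (s.1, rcons s.2 (odflt false a)) else (rcons s.1 s.2, [::]).

(* The complete fields of a word and the unterminated rest. *)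
Definition split_fields (w : seq (option bool)) : seq (seq bool) * seq bool :=
  foldl field_step ([::], [::]) w.

Lemma fields_word_cat f g :
  fields_word (f ++ g) = fields_word f ++ fields_word g.
Proof. by rewrite /fields_word map_cat flatten_cat. Qed.

Lemma split_fieldsE w :
  w = fields_word (split_fields w).1 ++ map Some (split_fields w).2.
Proof.
elim/last_ind: w => // w a {1}->; rewrite /split_fields foldl_rcons.
case: (foldl _ _ w) => f r; rewrite /field_step; case: a => [b|] /=.
  by rewrite map_rcons -!cats1 catA.
by rewrite -!cats1 fields_word_cat /fields_word /= !cats0 -cats1 !catA.
Qed.

Lemma fields_wordK f : split_fields (fields_word f) = (f, [::]).
Proof.
have bits_step g r b : foldl field_step (g, r) (map Some b) = (g, r ++ b).
  by elim: b r => [|x b IH] r /=; rewrite ?cats0 // IH cat_rcons.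
rewrite /split_fields -[f in RHS]cat0s; elim: f [::] => [|b f IH] g /=.
  by rewrite cats0.
rewrite /fields_word /= -/(fields_word f) foldl_cat -cats1 foldl_cat bits_step.
by rewrite /= IH cat_rcons.
Qed.

Section Flatten2.
Variable T : Type.
Implicit Types (L : seq (T * T)) (r : seq T).

Definition flatten2 L : seq T := flatten [seq [:: e.1; e.2] | e <- L].

Definition entry (x0 : T) r k : T * T :=
  (nth x0 r (2 * k), nth x0 r (2 * k).+1).

Lemma size_flatten2 L : size (flatten2 L) = 2 * size L.
Proof. by elim: L => //= e L IH; rewrite IH; lia. Qed.

Lemma entry_cons2 x0 a b r k : entry x0 [:: a, b & r] k.+1 = entry x0 r k.
Proof. by rewrite /entry mulnS. Qed.

Lemma entries_cons2 x0 a b r n :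
  [seq entry x0 [:: a, b & r] k | k <- iota 0 n.+1] =
  (a, b) :: [seq entry x0 r k | k <- iota 0 n].
Proof.
rewrite /= (iotaDl 1 0) -map_comp; congr (_ :: _).
by apply: eq_map => k /=; rewrite add1n entry_cons2.
Qed.

Lemma entries_flatten2 x0 L :
  [seq entry x0 (flatten2 L) k | k <- iota 0 (size L)] = L.
Proof.
by elim: L => // -[a b] L IH; rewrite [size _]/= entries_cons2 IH.
Qed.

Lemma flatten2_entries x0 r n : size r = 2 * n ->
  flatten2 [seq entry x0 r k | k <- iota 0 n] = r.
Proof.
elim: n r => [|n IH] [|a [|b r]] //; rewrite ?mulnS // => -[sz].
by rewrite entries_cons2 /flatten2 /= -/(flatten2 _) IH.
Qed.

End Flatten2.

Definition dimension_field (w : seq (option bool)) : seq bool :=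
  head [::] (split_fields w).1.

Definition dimension w : nat := bits_val (dimension_field w).

Definition entry_fields w : seq (seq bool) := behead (split_fields w).1.

Definition entries (n : nat) w : seq (seq bool * seq bool) :=
  [seq entry [::] (entry_fields w) k | k <- iota 0 (n ^ 4)].

Definition well_formed n w : bool :=
  [&& nilp (split_fields w).2, ~~ nilp (split_fields w).1,
      size (entry_fields w) == 2 * n ^ 4
    & all (fun e => has id e.2) (entries n w)].

Definition frac_val (e : seq bool * seq bool) : rat :=
  ((bits_val e.1)%:R / (bits_val e.2)%:R)%R.

Lemma frac_val_ge0 e : (0 <= frac_val e)%R.
Proof. by rewrite divr_ge0 ?ler0n. Qed.

Definition cell_index (n : nat) (p : nat * nat) : nat := p.1 * n + p.2.

Definition entry_index (n : nat) (p q : nat * nat) : nat :=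
  cell_index n p * n ^ 2 + cell_index n q.

Definition entry_at n w (p q : nat * nat) : rat :=
  frac_val (nth ([::], [::]) (entries n w) (entry_index n p q)).

Definition nat_cell n (a : 'I_n * 'I_n) : nat * nat := (a.1 : nat, a.2 : nat).

Lemma bits_val_rcons b x : bits_val (rcons b x) = (bits_val b).*2 + x.
Proof. by rewrite /bits_val foldl_rcons. Qed.

Lemma bits_val_gt0 b : (0 < bits_val b) = has id b.
Proof.
elim/last_ind: b => // b x IH; rewrite bits_val_rcons has_rcons /= -IH.
by case: x; lia.
Qed.

Lemma nth_allpairs (S T R : Type) (f : S -> T -> R) s t x0 y0 z0 i j :
  i < size s -> j < size t ->
  nth z0 [seq f x y | x <- s, y <- t] (i * size t + j)
    = f (nth x0 s i) (nth y0 t j).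
Proof.
elim: s i => // x s IH [|i] lti ltj /=; rewrite nth_cat size_map.
  by rewrite ltj (nth_map y0).
by rewrite mulSn -addnA ltnNge leq_addr /= addKn IH.
Qed.

Lemma iota_mul m n :
  iota 0 (m * n) = [seq i * n + j | i <- iota 0 m, j <- iota 0 n].
Proof.
elim: m => // m IH; rewrite mulSnr iotaD IH -addn1 iotaD add0n allpairs_cat /=.
by rewrite cats0 -iotaDl addn0.
Qed.

Lemma size_index_pairs n : size (index_pairs n) = n ^ 2.
Proof. by rewrite size_allpairs size_enum_ord. Qed.

Lemma cell_index_lt n (a : 'I_n * 'I_n) : cell_index n (nat_cell a) < n ^ 2.
Proof.
by have := ltn_ord a.1; have := ltn_ord a.2; rewrite /cell_index /=; nia.
Qed.

Lemma entry_index_lt n (a b : 'I_n * 'I_n) :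
  entry_index n (nat_cell a) (nat_cell b) < n ^ 4.
Proof.
rewrite /entry_index -[4]/(2 + 2) expnD.
by have := cell_index_lt a; have := cell_index_lt b; nia.
Qed.

Lemma nth_index_pairs n x0 (a : 'I_n * 'I_n) :
  nth x0 (index_pairs n) (cell_index n (nat_cell a)) = a.
Proof.
have := @nth_allpairs _ _ _ (@pair 'I_n 'I_n) (enum 'I_n) (enum 'I_n)
  a.1 a.2 x0 a.1 a.2.
by rewrite !size_enum_ord !nth_ord_enum -surjective_pairing; apply.
Qed.

Section PairsTable.
Variables (n : nat) (R : Type).
Implicit Type f : 'I_n * 'I_n -> 'I_n * 'I_n -> R.

Definition pairs_table f : seq R :=
  [seq f a b | a <- index_pairs n, b <- index_pairs n].

Lemma size_pairs_table f : size (pairs_table f) = n ^ 4.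
Proof. by rewrite size_allpairs size_index_pairs -expnD. Qed.

Lemma nth_pairs_table z0 f a b :
  nth z0 (pairs_table f) (entry_index n (nat_cell a) (nat_cell b)) = f a b.
Proof.
rewrite /entry_index -(size_index_pairs n) (@nth_allpairs _ _ _ _ _ _ a b);
  by rewrite ?nth_index_pairs // size_index_pairs cell_index_lt.
Qed.

End PairsTable.

Definition nat_cells (n : nat) : seq (nat * nat) :=
  [seq (i, j) | i <- iota 0 n, j <- iota 0 n].

Lemma map_nat_cell n : map (@nat_cell n) (index_pairs n) = nat_cells n.
Proof.
by rewrite map_allpairs /nat_cells -!val_enum_ord allpairs_mapl allpairs_mapr.
Qed.

Lemma pairs_table_nat_cell n (R : Type) (g : nat * nat -> nat * nat -> R) :
  pairs_table (fun a b : 'I_n * 'I_n => g (nat_cell a) (nat_cell b)) =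
  [seq g p q | p <- nat_cells n, q <- nat_cells n].
Proof. by rewrite -!map_nat_cell allpairs_mapl allpairs_mapr. Qed.

Lemma map_cell_index n : map (cell_index n) (nat_cells n) = iota 0 (n ^ 2).
Proof. by rewrite map_allpairs -mulnn iota_mul. Qed.

Lemma pairs_table_entry_index n :
  pairs_table (fun a b : 'I_n * 'I_n => entry_index n (nat_cell a) (nat_cell b))
    = iota 0 (n ^ 4).
Proof.
rewrite pairs_table_nat_cell -[4]/(2 + 2) expnD iota_mul -!map_cell_index.
by rewrite allpairs_mapl allpairs_mapr.
Qed.

Lemma pairs_table_nth n (R : Type) (z0 : R) L : size L = n ^ 4 ->
  pairs_table (fun a b : 'I_n * 'I_n =>
    nth z0 L (entry_index n (nat_cell a) (nat_cell b))) = L.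
Proof.
move=> szL; rewrite -[RHS](mkseq_nth z0) /mkseq szL -pairs_table_entry_index.
by rewrite map_allpairs.
Qed.

Lemma encodesP w n (x : point n) : encodes w x <->
  [/\ dimension w = n, well_formed n w
    & forall a b, x a b = entry_at n w (nat_cell a) (nat_cell b)].
Proof.
split.
  case=> bn [num [den [bnE den_gt0 xE wE]]].
  pose L := pairs_table (fun a b => (num a b, den a b)).
  have fieldsE : split_fields w = (bn :: flatten2 L, [::]).
    by rewrite wE fields_wordK /flatten2 [map _ L]map_allpairs.
  have szL : size L = n ^ 4 by rewrite size_pairs_table.
  have entriesE : entries n w = L.
    by rewrite /entries /entry_fields fieldsE -szL entries_flatten2.
  split=> [||a b]; first by rewrite /dimension /dimension_field fieldsE.
    rewrite /well_formed entriesE /entry_fields fieldsE /= size_flatten2 szL.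
    rewrite eqxx; apply/allP => _ /allpairsP[[a b] [_ _ ->]].
    by rewrite /= -bits_val_gt0.
  by rewrite /entry_at entriesE nth_pairs_table xE.
case=> dimensionE /and4P[/nilP rest0 fields0 /eqP sz /allP dens] xE.
pose e (a b : 'I_n * 'I_n) :=
  nth ([::], [::]) (entries n w) (entry_index n (nat_cell a) (nat_cell b)).
have szE : size (entries n w) = n ^ 4 by rewrite size_map size_iota.
exists (dimension_field w), (fun a b => (e a b).1), (fun a b => (e a b).2).
split=> //.
  move=> a b; rewrite bits_val_gt0; apply/(dens (e a b))/mem_nth.
  by rewrite szE entry_index_lt.
have <- : entry_fields w
    = flatten (pairs_table (fun a b => [:: (e a b).1; (e a b).2])).
  rewrite -[LHS](flatten2_entries [::] sz) -/(entries n w).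
  by rewrite -(pairs_table_nth ([::], [::]) szE) /flatten2 map_allpairs.
rewrite {1}[w]split_fieldsE rest0 cats0 /dimension_field /entry_fields.
by congr fields_word; case: (split_fields w).1 fields0.
Qed.

Fixpoint pairs (T : Type) (l : seq T) : seq (T * T) :=
  if l is a :: l' then [seq (a, b) | b <- l'] ++ pairs l' else [::].

Lemma mem_pairs (T : eqType) (l : seq T) p :
  p \in pairs l -> (p.1 \in l) && (p.2 \in l).
Proof.
elim: l => //= a l IH; rewrite mem_cat.
case/orP=> [/mapP[b b_l ->]|/IH/andP[in1 in2]] /=.
  by rewrite !inE eqxx b_l orbT.
by rewrite !inE in1 in2 !orbT.
Qed.

Local Open Scope ring_scope.

Lemma sum_pairs (V : nmodType) (T : Type) (m : nat) (f : 'I_m -> T)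
    (F : T -> T -> V) :
  \sum_(p <- pairs (map f (enum 'I_m))) F p.1 p.2 =
  \sum_(r < m) \sum_(s < m | (r < s)%N) F (f r) (f s).
Proof.
elim: m f => [|m IH] f.
  by rewrite big_ord0 (size0nil (size_enum_ord 0)) big_nil.
rewrite enum_ordSl /= big_cat /= big_map big_ord_recl; congr (_ + _).
  rewrite -map_comp big_map big_enum /= [RHS]big_mkcond big_ord_recl /= add0r.
  by apply: eq_bigr.
rewrite -map_comp IH; apply: eq_bigr => r _.
by rewrite [RHS]big_mkcond big_ord_recl /= add0r -big_mkcond.
Qed.

Definition inequality_lhs (y : nat * nat -> nat * nat -> rat)
    (sel : seq (nat * nat)) : rat :=
  \sum_(p <- sel) y p p - \sum_(u <- pairs sel) y u.1 u.2.

Definition admissible (n : nat) (sel : seq (nat * nat)) : bool :=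
  [&& (7 <= size sel)%N, all (fun p => (p.1 < n)%N && (p.2 < n)%N) sel,
      uniq (unzip1 sel) & uniq (unzip2 sel)].

Lemma admissible_size n sel : admissible n sel -> (size sel <= n)%N.
Proof.
case/and4P=> _ /allP lt_n u1 _; rewrite -(size_map fst) -(size_iota 0 n).
apply: uniq_leq_size => // _ /mapP[p /lt_n/andP[lt _] ->].
by rewrite mem_iota.
Qed.

Definition selection n m (i j : 'I_m -> 'I_n) : seq (nat * nat) :=
  [seq nat_cell (i r, j r) | r <- enum 'I_m].

Lemma admissible_selection n m (i j : 'I_m -> 'I_n) :
  (7 <= m)%N -> injective i -> injective j -> admissible n (selection i j).
Proof.
move=> m7 inj_i inj_j; apply/and4P; split.
- by rewrite size_map size_enum_ord.
- by apply/allP=> _ /mapP[r _ ->]; rewrite !ltn_ord.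
- by rewrite /unzip1 -map_comp map_inj_uniq ?enum_uniq // => r s /val_inj/inj_i.
- by rewrite /unzip2 -map_comp map_inj_uniq ?enum_uniq // => r s /val_inj/inj_j.
Qed.

Lemma admissibleP n sel : admissible n sel ->
  exists m (i j : 'I_m -> 'I_n),
    [/\ (7 <= m)%N, injective i, injective j & sel = selection i j].
Proof.
move=> adm; have := admissible_size adm.
case/and4P: adm => m7 /allP lt_n u1 u2; case: n => [|n] in lt_n * => le_n.
  by rewrite leqn0 in le_n; rewrite (eqP le_n) in m7.
pose cell (r : 'I_(size sel)) := nth (0, 0)%N sel r.
have lt_cell r : ((cell r).1 < n.+1)%N && ((cell r).2 < n.+1)%N.
  exact/lt_n/mem_nth.
exists (size sel), (fun r => inord (cell r).1), (fun r => inord (cell r).2).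
split=> // [r s /(congr1 val)|r s /(congr1 val)|] /=.
- have [/andP[lt_r _] /andP[lt_s _]] := (lt_cell r, lt_cell s).
  rewrite !inordK // -!(nth_map _ 0%N fst) // => /eqP.
  by rewrite nth_uniq ?size_map // => /eqP/val_inj.
- have [/andP[_ lt_r] /andP[_ lt_s]] := (lt_cell r, lt_cell s).
  rewrite !inordK // -!(nth_map _ 0%N snd) // => /eqP.
  by rewrite nth_uniq ?size_map // => /eqP/val_inj.
rewrite -{1}(mkseq_nth (0, 0)%N sel) /mkseq -val_enum_ord -map_comp.
apply: eq_map => r; have /andP[lt1 lt2] := lt_cell r.
by rewrite /nat_cell /= !inordK // -surjective_pairing.
Qed.

Section NatPoint.
Variables (n : nat) (x : point n) (y : nat * nat -> nat * nat -> rat).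
Hypothesis xy : forall a b, x a b = y (nat_cell a) (nat_cell b).

Lemma inequality_lhs_selection m (i j : 'I_m -> 'I_n) :
  inequality_lhs y (selection i j) =
  \sum_(r < m) x (i r, j r) (i r, j r)
    - \sum_(r < m) \sum_(s < m | (r < s)%N) x (i r, j r) (i s, j s).
Proof.
rewrite /inequality_lhs big_map big_enum sum_pairs.
congr (_ - _); apply: eq_bigr => r _; first by rewrite xy.
by apply: eq_bigr => s _; rewrite xy.
Qed.

Lemma satisfies_inequalitiesE : satisfies_inequalities x <->
  forall sel, admissible n sel -> inequality_lhs y sel <= 1.
Proof.
split=> [sat sel adm|sat m m7 n7 i j inj_i inj_j]; last first.
  by rewrite -inequality_lhs_selection sat // admissible_selection.
have [m [i [j [m7 inj_i inj_j selE]]]] := admissibleP adm.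
rewrite selE inequality_lhs_selection; apply: sat => //.
by have := leq_card i inj_i; rewrite !card_ord; apply: leq_trans.
Qed.

End NatPoint.

Lemma inequalities_problemE w : inequalities_problem w <->
  well_formed (dimension w) w
  /\ forall sel, admissible (dimension w) sel ->
      inequality_lhs (entry_at (dimension w) w) sel <= 1.
Proof.
split=> [[n [x [/encodesP[-> wf xE] _ sat]]]|[wf sat]].
  by split=> //; apply/(satisfies_inequalitiesE xE).
set n := dimension w in wf sat *.
exists n, (fun a b => entry_at n w (nat_cell a) (nat_cell b)); split.
- exact/encodesP.
- by move=> a b; apply: frac_val_ge0.
- exact/(@satisfies_inequalitiesE _ _ (entry_at n w)).
Qed.

Lemma inequalities_problem_encodes w n (x : point n) y :
  encodes w x -> (forall a b, x a b = y (nat_cell a) (nat_cell b)) ->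
  inequalities_problem w <->
  forall sel, admissible n sel -> inequality_lhs y sel <= 1.
Proof.
case/encodesP=> dimensionE wf xE xy; rewrite inequalities_problemE dimensionE.
rewrite -(satisfies_inequalitiesE xE) (satisfies_inequalitiesE xy).
by split=> [[]|].
Qed.

Local Close Scope ring_scope.

(** * Binary arithmetic *)

(* Least significant bit first, unlike [bits_val]. *)
Definition bin_val (l : seq bool) : nat :=
  foldr (fun (b : bool) v => b + 2 * v) 0 l.

Lemma bin_val_rcons l (b : bool) :
  bin_val (rcons l b) = bin_val l + 2 ^ size l * b.
Proof. by elim: l => [|x l IH] /=; rewrite ?expnS ?IH; lia. Qed.

Lemma bin_val_rev b : bin_val (rev b) = bits_val b.
Proof.
by elim/last_ind: b => // b x IH; rewrite rev_rcons /= IH bits_val_rcons; lia.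
Qed.

Lemma bin_val_head_behead l :
  bin_val l = head false l + 2 * bin_val (behead l).
Proof. by case: l. Qed.

Definition zeros (k : nat) : seq bool := [seq false | _ <- nseq k tt].

Lemma size_zeros k : size (zeros k) = k.
Proof. by rewrite size_map size_nseq. Qed.

Definition pad (l m : seq bool) : seq bool := l ++ zeros (size m - size l).

Lemma bin_val_pad l m : bin_val (pad l m) = bin_val l.
Proof.
rewrite /pad; elim: l (_ - _) => [|x l IH] k /=; last by rewrite IH.
by elim: k => //= k ->.
Qed.

Lemma size_pad l m : size (pad l m) = maxn (size l) (size m).
Proof. by rewrite size_cat size_zeros; lia. Qed.

(* The state is (carry, remaining bits of the second summand, output). *)
Definition add_step (s : bool * seq bool * seq bool) (x : bool) :=
  let c := s.1.1 in let y := head false s.1.2 in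
  ((x && y) || (c && (x (+) y)), behead s.1.2, rcons s.2 (x (+) y (+) c)).

Definition bin_add (a b : seq bool) : seq bool :=
  let s := foldl add_step (false, b, [::]) (pad a b) in rcons s.2 s.1.1.

Lemma foldl_add_step a c b o : size b <= size a ->
  let s := foldl add_step (c, b, o) a in
  bin_val (rcons s.2 s.1.1)
    = bin_val o + 2 ^ size o * (c + bin_val a + bin_val b)
  /\ size s.2 = size o + size a.
Proof.
elim: a c b o => [|x a IH] c b o.
  by case: b => //= _; rewrite bin_val_rcons addn0 !addn0.
move=> le; have le' : size (behead b) <= size a by case: b le.
pose y := head false b.
have [valE sizeE] := IH ((x && y) || (c && (x (+) y))) (behead b)
  (rcons o (x (+) y (+) c)) le'.
split; last by apply: etrans sizeE _; rewrite size_rcons addSnnS.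
apply: etrans valE _; rewrite size_rcons bin_val_rcons expnS.
rewrite [bin_val b]bin_val_head_behead -/y /=.
by case: x {le IH sizeE}; case: y; case: c => /=; nia.
Qed.

Lemma bin_val_add a b : bin_val (bin_add a b) = bin_val a + bin_val b.
Proof.
have le : size b <= size (pad a b) by rewrite size_pad leq_maxr.
have [e _] := foldl_add_step false [::] le.
by rewrite /bin_add e /= bin_val_pad; lia.
Qed.

Lemma size_bin_add a b : size (bin_add a b) = (maxn (size a) (size b)).+1.
Proof.
have le : size b <= size (pad a b) by rewrite size_pad leq_maxr.
have [_ e] := foldl_add_step false [::] le.
by rewrite /bin_add size_rcons e size_pad.
Qed.

Definition mul_step (a acc : seq bool) (x : bool) : seq bool :=
  if x then bin_add (false :: acc) a else false :: acc.

Definition bin_mul (a b : seq bool) : seq bool :=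
  foldl (mul_step a) [::] (rev b).

Lemma bin_val_mul a b : bin_val (bin_mul a b) = bin_val a * bin_val b.
Proof.
rewrite /bin_mul; elim: b => [|x b IH]; first by rewrite muln0.
rewrite rev_cons foldl_rcons; move: (foldl _ _ _) IH => acc IH.
by rewrite /mul_step; case: x; rewrite ?bin_val_add /= IH; lia.
Qed.

Lemma size_foldl_mul_step a l :
  size (foldl (mul_step a) [::] l) <= size a + 2 * size l.
Proof.
elim/last_ind: l => // l x; rewrite foldl_rcons size_rcons.
move: (foldl _ _ l) => acc IH; rewrite /mul_step.
by case: x; rewrite ?size_bin_add /=; lia.
Qed.

Lemma size_bin_mul a b : size (bin_mul a b) <= size a + 2 * size b.
Proof. by apply: leq_trans (size_foldl_mul_step _ _) _; rewrite size_rev. Qed.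

Definition gt_step (s : bool * seq bool) (x : bool) : bool * seq bool :=
  (if x == head false s.2 then s.1 else x, behead s.2).

Definition bin_gt (a b : seq bool) : bool :=
  (foldl gt_step (false, b) (pad a b)).1.

Lemma foldl_gt_step a b (r : bool) : size b <= size a ->
  (foldl gt_step (r, b) a).1 =
    if bin_val a == bin_val b then r else bin_val b < bin_val a.
Proof.
elim: a b r => [|x a IH] b r le; first by case: b le.
rewrite /= IH; last by case: b le.
rewrite [bin_val b]bin_val_head_behead.
move: (head false b) (bin_val (behead b)) => y v.
case: x {le}; case: y => /=; case: (ltngtP (bin_val a) v) => ?; case: eqP.
all: by lia.
Qed.

Lemma bin_gtE a b : bin_gt a b = (bin_val b < bin_val a).
Proof.
rewrite /bin_gt foldl_gt_step ?bin_val_pad; first by case: ltngtP.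
by rewrite size_pad leq_maxr.
Qed.

Notation bin_frac := (seq bool * seq bool)%type.

Definition frac_add (e f : bin_frac) : bin_frac :=
  (bin_add (bin_mul e.1 f.2) (bin_mul e.2 f.1), bin_mul e.2 f.2).

Definition frac_sum (l : seq bin_frac) : bin_frac :=
  foldl frac_add ([::], [:: true]) l.

Definition frac_diff_gt1 (e f : bin_frac) : bool :=
  bin_gt (bin_mul e.1 f.2) (bin_mul (bin_add f.1 f.2) e.2).

Section BinFracVal.
Local Open Scope ring_scope.

Definition bin_frac_val (e : bin_frac) : rat :=
  (bin_val e.1)%:R / (bin_val e.2)%:R.

Definition proper_frac (e : bin_frac) : bool := (0 < bin_val e.2)%N.

Lemma proper_frac_neq0 e : proper_frac e -> (bin_val e.2)%:R != 0 :> rat.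
Proof. by rewrite pnatr_eq0 -lt0n. Qed.

Lemma frac_addE e f : proper_frac e -> proper_frac f ->
  proper_frac (frac_add e f)
  /\ bin_frac_val (frac_add e f) = bin_frac_val e + bin_frac_val f.
Proof.
move=> pe pf; rewrite /proper_frac /bin_frac_val /= bin_val_add !bin_val_mul.
rewrite muln_gt0 [(0 < _)%N]pe [(0 < _)%N]pf natrD !natrM; split=> //.
by field; rewrite !proper_frac_neq0.
Qed.

Lemma frac_sumE l : all proper_frac l ->
  proper_frac (frac_sum l)
  /\ bin_frac_val (frac_sum l) = \sum_(e <- l) bin_frac_val e.
Proof.
elim/last_ind: l => [|l e IH]; first by rewrite big_nil /bin_frac_val mul0r.
rewrite all_rcons => /andP[pe /IH[pl sumE]].
rewrite /frac_sum foldl_rcons -/(frac_sum l).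
have [p_add ->] := frac_addE pl pe; split=> //.
by rewrite sumE -cats1 big_cat big_seq1.
Qed.

Lemma frac_diff_gt1E e f : proper_frac e -> proper_frac f ->
  frac_diff_gt1 e f = (1 < bin_frac_val e - bin_frac_val f).
Proof.
move=> pe pf; rewrite /frac_diff_gt1 bin_gtE !bin_val_mul bin_val_add.
rewrite ltrBrDr /bin_frac_val.
have -> : 1 + (bin_val f.1)%:R / (bin_val f.2)%:R
    = (bin_val f.1 + bin_val f.2)%:R / (bin_val f.2)%:R :> rat.
  by rewrite natrD; field; rewrite proper_frac_neq0.
rewrite ltr_pdivrMr ?ltr0n // mulrAC ltr_pdivlMr ?ltr0n //.
by rewrite -!natrM ltr_nat.
Qed.

End BinFracVal.

Lemma enc_size_bits (l : seq bool) : enc_size l <= 4 * size l + 1.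
Proof.
elim: l => // b l IH; rewrite enc_size_cons; have := enc_size_bool b.
by rewrite /=; lia.
Qed.

Section PtimeBinary.
Context {I : finType} {X : Type} {eX : Encoding X}.

Lemma ptime_pad (a b : X -> seq bool) :
  ptime I a -> ptime I b -> ptime I (fun x => pad (a x) (b x)).
Proof. by move=> pa pb; rewrite /pad /zeros; ptime. Qed.

Lemma ptime_bin_add (a b : X -> seq bool) :
  ptime I a -> ptime I b -> ptime I (fun x => bin_add (a x) (b x)).
Proof.
move=> pa pb.
have pfold : ptime I (fun x =>
    foldl add_step (false, b x, [::]) (pad (a x) (b x))).
  apply: (ptime_foldl_additive _ _ _ (C := fun=> 10)).
  - by ptime.
  - exact: ptime_pad.
  - by rewrite /add_step; ptime.
  - by poly_bounded.
  move=> x [[c y] o] z; rewrite /add_step !enc_size_pair enc_size_rcons /=.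
  move: (_ || _) (_ (+) _ (+) _) => u v.
  have := enc_size_bool u; have := enc_size_bool v.
  have c_gt0 : 0 < enc_size c by exact: enc_size_gt0.
  have le_y : enc_size (behead y) <= enc_size y by exact: enc_size_behead.
  by lia.
by rewrite /bin_add; apply: ptime_rcons; ptime.
Qed.

Lemma ptime_bin_gt (a b : X -> seq bool) :
  ptime I a -> ptime I b -> ptime I (fun x => bin_gt (a x) (b x)).
Proof.
move=> pa pb; apply/ptime_fst/(ptime_foldl_additive _ _ _ (C := fun=> 10)).
- by ptime.
- exact: ptime_pad.
- by rewrite /gt_step; ptime.
- by poly_bounded.
move=> x [r y] z; rewrite !enc_size_pair /gt_step /=.
move: (if _ then _ else _) => u.
have r_gt0 : 0 < enc_size r by exact: enc_size_gt0.
have le_y : enc_size (behead y) <= enc_size y by exact: enc_size_behead.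
by have := enc_size_bool u; lia.
Qed.

End PtimeBinary.

#[export] Hint Resolve ptime_bin_add ptime_bin_gt : ptime.

Lemma ptime_bin_mul {I : finType} {X} {eX : Encoding X} (a b : X -> seq bool) :
  ptime I a -> ptime I b -> ptime I (fun x => bin_mul (a x) (b x)).
Proof.
apply: ptime_comp2; apply: (ptime_foldl _ _ _ (B := fun n => 12 * n + 1)).
- by ptime.
- by ptime.
- by rewrite /mul_step; ptime.
- by poly_bounded.
move=> [u v] k /=; apply: leq_trans (enc_size_bits _) _; rewrite leq_add2r.
have := size_foldl_mul_step u (take k (rev v)).
have : size (take k (rev v)) <= size v by rewrite size_take_min size_rev; lia.
have le_u : size u <= enc_size u by exact: size_le_enc_size.
have le_v : size v <= enc_size v by exact: size_le_enc_size.
by rewrite enc_size_pair; lia.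
Qed.

#[export] Hint Resolve ptime_bin_mul : ptime.

Lemma size_frac_sum (l : seq bin_frac) :
  size (frac_sum l).1 <= 1 + 2 * enc_size l
  /\ size (frac_sum l).2 <= 1 + 2 * enc_size l.
Proof.
elim/last_ind: l => // l [p q] [IH1 IH2].
rewrite /frac_sum foldl_rcons -/(frac_sum l) /frac_add enc_size_rcons.
rewrite enc_size_pair size_bin_add /=.
have := size_bin_mul (frac_sum l).1 q; have := size_bin_mul (frac_sum l).2 q.
have := size_bin_mul (frac_sum l).2 p.
have le_p : size p <= enc_size p by exact: size_le_enc_size.
have le_q : size q <= enc_size q by exact: size_le_enc_size.
by lia.
Qed.

Lemma ptime_frac_sum {I : finType} {X} {eX : Encoding X}
    (l : X -> seq bin_frac) :
  ptime I l -> ptime I (fun x => frac_sum (l x)).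
Proof.
apply: ptime_comp; apply: (ptime_foldl _ _ _ (B := fun n => 16 * n + 20)).
- by ptime.
- by ptime.
- by rewrite /frac_add; ptime.
- by poly_bounded.
move=> s k; rewrite -/(frac_sum (take k s)).
have [] := size_frac_sum (take k s).
case: (frac_sum _) => u v /= le1 le2; rewrite enc_size_pair.
have := enc_size_bits u; have := enc_size_bits v.
have le_s : enc_size (take k s) <= enc_size s by exact: enc_size_take.
by lia.
Qed.

Lemma ptime_frac_diff_gt1 {I : finType} {X} {eX : Encoding X}
    (e f : X -> bin_frac) :
  ptime I e -> ptime I f -> ptime I (fun x => frac_diff_gt1 (e x) (f x)).
Proof. by move=> pe pf; rewrite /frac_diff_gt1; ptime. Qed.

#[export] Hint Resolve ptime_frac_sum ptime_frac_diff_gt1 : ptime.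

(** * Membership in coNP *)

Lemma ptime_minn {I : finType} {X} {eX : Encoding X} (a b : X -> nat) :
  ptime I a -> ptime I b -> ptime I (fun x => minn (a x) (b x)).
Proof. by move=> pa pb; rewrite /minn; ptime. Qed.

Lemma ptime_nat_of_bool {I : finType} {X} {eX : Encoding X} (b : X -> bool) :
  ptime I b -> ptime I (fun x => nat_of_bool (b x)).
Proof. by apply: ptime_comp; apply: ptime_finite. Qed.

#[export] Hint Resolve ptime_minn ptime_nat_of_bool : ptime.

Section PtimeParsing.
Context {I : finType} {X : Type} {eX : Encoding X}.

Lemma ptime_split_fields (w : X -> seq (option bool)) :
  ptime I w -> ptime I (fun x => split_fields (w x)).
Proof.
apply: ptime_comp; apply: (ptime_foldl_additive _ _ _ (C := fun=> 10)).
- by ptime.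
- by ptime.
- by rewrite /field_step; ptime.
- by poly_bounded.
move=> x [f r] [b|]; rewrite /field_step !enc_size_pair enc_size_rcons /=.
  by have := enc_size_bool b; lia.
by rewrite enc_size_nil; lia.
Qed.

Lemma ptime_entry {T} {eT : Encoding T} (x0 : T) (r : X -> seq T)
    (k : X -> nat) :
  ptime I r -> ptime I k -> ptime I (fun x => entry x0 (r x) (k x)).
Proof. by move=> pr pk; rewrite /entry; ptime. Qed.

Lemma ptime_pairs {T} {eT : Encoding T} (x0 : T) (l : X -> seq T) :
  ptime I l -> ptime I (fun x => pairs (l x)).
Proof.
move=> pl; apply: (eq_ptime (f := fun x => flatten
    [seq [seq (nth x0 (l x) r, b) | b <- drop r.+1 (l x)]
    | r <- iota 0 (size (l x))])).
  move=> x; elim: (l x) => //= a s IH; rewrite drop0; congr (_ ++ _).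
  by rewrite -IH (iotaDl 1 0) -map_comp.
by ptime.
Qed.

End PtimeParsing.

#[export] Hint Resolve ptime_split_fields ptime_entry : ptime.

Lemma ptime_dimension_field {I : finType} {X} {eX : Encoding X}
    (w : X -> seq (option bool)) :
  ptime I w -> ptime I (fun x => dimension_field (w x)).
Proof. by move=> pw; rewrite /dimension_field; ptime. Qed.

Lemma ptime_entry_fields {I : finType} {X} {eX : Encoding X}
    (w : X -> seq (option bool)) :
  ptime I w -> ptime I (fun x => entry_fields (w x)).
Proof. by move=> pw; rewrite /entry_fields; ptime. Qed.

#[export] Hint Resolve ptime_dimension_field ptime_entry_fields : ptime.

Section PtimeEntries.
Context {I : finType} {X : Type} {eX : Encoding X}.
Implicit Types (n : X -> nat) (w : X -> seq (option bool)).

Lemma ptime_entries n w :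
  ptime I n -> ptime I w -> ptime I (fun x => entries (n x) (w x)).
Proof. by move=> pn pw; rewrite /entries; ptime. Qed.

Lemma ptime_well_formed n w :
  ptime I n -> ptime I w -> ptime I (fun x => well_formed (n x) (w x)).
Proof.
move=> pn pw; have pe := ptime_entries pn pw.
by rewrite /well_formed; ptime.
Qed.

End PtimeEntries.

#[export] Hint Resolve ptime_entries ptime_well_formed : ptime.

(* Well-formed words are longer than the dimension they announce, so truncating
   it loses nothing and keeps its unary form short. *)
Definition small_dimension (w : seq (option bool)) : nat :=
  minn (size w).+1 (dimension w).

Definition small_dimension_step (w : seq (option bool)) (n : nat)
    (b : bool) : nat :=
  minn (size w).+1 (n + n + b).

Lemma foldl_small_dimension_step w b :
  foldl (small_dimension_step w) 0 b = minn (size w).+1 (bits_val b).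
Proof.
elim/last_ind: b => [|b x IH]; first by rewrite minn0.
by rewrite foldl_rcons bits_val_rcons IH /small_dimension_step; lia.
Qed.

Lemma ptime_small_dimension (I : finType) : ptime I small_dimension.
Proof.
apply: (eq_ptime
    (f := fun w => foldl (small_dimension_step w) 0 (dimension_field w))).
  by move=> w; rewrite foldl_small_dimension_step.
apply: (ptime_foldl _ _ _ (B := fun n => 2 * n + 3)).
- by ptime.
- by ptime.
- by rewrite /small_dimension_step; ptime.
- by poly_bounded.
move=> w k; rewrite foldl_small_dimension_step enc_size_nat.
have le_w : size w <= enc_size w by exact: size_le_enc_size.
by lia.
Qed.

Lemma size_split_fields w : size (split_fields w).1 <= size w.
Proof.
rewrite {2}[w]split_fieldsE size_cat; apply: leq_trans (leq_addr _ _).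
elim: (split_fields w).1 => //= b f IH.
by rewrite /fields_word /= size_cat size_rcons -/(fields_word f); lia.
Qed.

Lemma well_formed_size n w : well_formed n w -> n <= size w.
Proof.
case/and4P=> _ _ /eqP sz _.
have le_n : n <= n ^ 4.
  by case: n {sz} => // n; rewrite -{1}(expn1 n.+1) leq_pexp2l.
by have := size_split_fields w; rewrite /entry_fields size_behead in sz *; lia.
Qed.

Lemma well_formed_small_dimension w :
  well_formed (small_dimension w) w = well_formed (dimension w) w.
Proof.
rewrite /small_dimension; case: (leqP (dimension w) (size w)) => [le|lt].
  by rewrite (minn_idPr _) // leqW.
rewrite (minn_idPl lt); apply/idP/idP => /well_formed_size.
  by rewrite ltnn.
by rewrite leqNgt lt.
Qed.

Lemma small_dimension_well_formed w :
  well_formed (dimension w) w -> small_dimension w = dimension w.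
Proof. by move/well_formed_size=> le; apply/minn_idPr/leqW. Qed.

Definition bin_entry (n : nat) (es : seq bin_frac)
    (p q : nat * nat) : bin_frac :=
  let e := nth ([::], [::]) es (entry_index n p q) in (rev e.1, rev e.2).

Definition violates (n : nat) (es : seq bin_frac)
    (sel : seq (nat * nat)) : bool :=
  admissible n sel && frac_diff_gt1
    (frac_sum [seq bin_entry n es p p | p <- sel])
    (frac_sum [seq bin_entry n es u.1 u.2 | u <- pairs sel]).

Lemma violatesE n w sel : well_formed n w ->
  violates n (entries n w) sel =
    admissible n sel && (1 < inequality_lhs (entry_at n w) sel)%R.
Proof.
case/and4P=> _ _ _ /allP dens; apply: andb_id2l => /and4P[_ /allP lt_n _ _].
have valE p q : bin_frac_val (bin_entry n (entries n w) p q) = entry_at n w p q.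
  by rewrite /bin_frac_val /= !bin_val_rev.
have proper p q : p \in sel -> q \in sel ->
    proper_frac (bin_entry n (entries n w) p q).
  case: p q => [p1 p2] [q1 q2] /lt_n/andP[lt1 lt2] /lt_n/andP[lt3 lt4].
  rewrite /proper_frac /= bin_val_rev bits_val_gt0; apply/dens/mem_nth.
  rewrite size_map size_iota.
  exact: (entry_index_lt (Ordinal lt1, Ordinal lt2) (Ordinal lt3, Ordinal lt4)).
have [|p1 s1] := @frac_sumE [seq bin_entry n (entries n w) p p | p <- sel].
  by rewrite all_map; apply/allP => p p_sel; apply: proper.
have [|p2 s2] := @frac_sumE
    [seq bin_entry n (entries n w) u.1 u.2 | u <- pairs sel].
  by rewrite all_map; apply/allP => u /mem_pairs/andP[]; apply: proper.
rewrite frac_diff_gt1E // s1 s2 !big_map; congr (_ < _ - _)%R.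
  by apply: eq_bigr.
by apply: eq_bigr.
Qed.

Definition sel_step (s : seq (nat * nat) * option nat * nat) (b : bool) :=
  if b then (s.1, s.2.+1)
  else if isSome s.1.2 then (rcons s.1.1 (odflt 0 s.1.2, s.2), None, 0)
  else (s.1.1, Some s.2, 0).

Definition decode_selection (c : seq bool) : seq (nat * nat) :=
  (foldl sel_step ([::], None, 0) c).1.1.

Definition encode_selection (sel : seq (nat * nat)) : seq bool :=
  flatten [seq rcons (nseq p.1 true) false ++ rcons (nseq p.2 true) false
          | p <- sel].

Lemma encode_selectionK : cancel encode_selection decode_selection.
Proof.
have count_true s n k : foldl sel_step (s, k) (nseq n true) = (s, k + n).
  by elim: n k => [|n IH] k /=; rewrite ?addn0 ?IH ?addnS ?addSn.
rewrite /decode_selection /encode_selection => sel; rewrite -[RHS]cat0s.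
elim: sel [::] => [|[i j] sel IH] l /=; first by rewrite cats0.
by rewrite !foldl_cat !foldl_rcons !count_true /= IH cat_rcons.
Qed.

Lemma size_encode_selection n sel : admissible n sel ->
  size (encode_selection sel) <= n * (2 * n).
Proof.
move=> adm; apply: (@leq_trans (size sel * (2 * n))); last first.
  by rewrite leq_mul2r (admissible_size adm) orbT.
case/and4P: adm => _ + _ _; rewrite /encode_selection.
elim: sel => //= p sel IH /andP[/andP[lt1 lt2] /IH le].
by rewrite !size_cat !size_rcons !size_nseq mulSn; lia.
Qed.

Definition check (w : seq (option bool)) (c : seq bool) : bool :=
  let n := small_dimension w in
  well_formed n w ==> violates n (entries n w) (decode_selection c).

Lemma check_sound w c : check w c -> ~ inequalities_problem w.
Proof.
rewrite /check well_formed_small_dimension => ok.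
case/inequalities_problemE => wf sat; move: ok.
rewrite wf small_dimension_well_formed //= violatesE // => /andP[adm].
by rewrite ltNge sat.
Qed.

Lemma check_complete w : ~ inequalities_problem w ->
  exists2 c, size c <= size w * (2 * size w) & check w c.
Proof.
rewrite inequalities_problemE /check well_formed_small_dimension => not_sat.
have [wf|_] := boolP (well_formed (dimension w) w); last by exists [::].
rewrite small_dimension_well_formed //=; apply: NNPP => no_cert.
apply: not_sat; split=> // sel adm; rewrite leNgt; apply/negP => gt1.
apply: no_cert; exists (encode_selection sel).
  apply: leq_trans (size_encode_selection adm) _.
  by have := well_formed_size wf; nia.
by rewrite encode_selectionK violatesE // adm gt1.
Qed.

Section PtimeCheck.
Context {I : finType} {X : Type} {eX : Encoding X}.

Lemma ptime_decode_selection (c : X -> seq bool) :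
  ptime I c -> ptime I (fun x => decode_selection (c x)).
Proof.
move=> pc; do 2! apply: ptime_fst.
apply: (ptime_foldl_additive _ _ _ (C := fun=> 20)) => //.
- by ptime.
- by rewrite /sel_step; ptime.
- by poly_bounded.
move=> x [[s [i|]] k] []; rewrite /sel_step /=.
all: rewrite !enc_size_pair ?enc_size_rcons ?enc_size_pair.
all: by rewrite ?enc_size_Some ?enc_size_None !enc_size_nat; lia.
Qed.

Lemma ptime_admissible (n : X -> nat) (sel : X -> seq (nat * nat)) :
  ptime I n -> ptime I sel -> ptime I (fun x => admissible (n x) (sel x)).
Proof.
by move=> pn psel; rewrite /admissible /unzip1 /unzip2; ptime.
Qed.

Lemma ptime_bin_entry (n : X -> nat) (es : X -> seq bin_frac)
    (p q : X -> nat * nat) :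
  ptime I n -> ptime I es -> ptime I p -> ptime I q ->
  ptime I (fun x => bin_entry (n x) (es x) (p x) (q x)).
Proof.
by move=> pn pes pp pq; rewrite /bin_entry /entry_index /cell_index; ptime.
Qed.

End PtimeCheck.

#[export] Hint Resolve ptime_decode_selection ptime_admissible
  ptime_bin_entry : ptime.

Lemma ptime_violates {I : finType} {X} {eX : Encoding X}
    (n : X -> nat) (es : X -> seq bin_frac) (sel : X -> seq (nat * nat)) :
  ptime I n -> ptime I es -> ptime I sel ->
  ptime I (fun x => violates (n x) (es x) (sel x)).
Proof.
move=> pn pes psel; have := ptime_pairs (0, 0) psel.
by rewrite /violates; ptime.
Qed.

#[export] Hint Resolve ptime_violates : ptime.

Lemma ptime_check {I : finType} {X} {eX : Encoding X}
  (w : X -> seq (option bool)) (c : X -> seq bool) :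
  ptime I w -> ptime I c -> ptime I (fun x => check (w x) (c x)).
Proof.
by move=> pw pc; have := @ptime_small_dimension I; rewrite /check; ptime.
Qed.

Theorem inequalities_in_coNP : in_coNP inequalities_problem.
Proof.
have [p hp] : exists p : {poly nat}, forall n, n * (2 * n) <= p.[n]%R.
  by apply: poly_bounded_horner; poly_bounded.
exists (fun z => check (pmap inl_part z) (pmap inr_part z)), p; split.
  by apply: inP_ptime (fun z => iff_refl _); apply: ptime_check; ptime.
have certE w (c : seq bool) : check (pmap inl_part (map inl w ++ map inr c))
    (pmap inr_part (map inl w ++ map inr c)) = check w c.
  by rewrite pmap_inl_part pmap_inr_part.
move=> w; split=> [/check_complete[c le ok]|[c [_]]]; last first.
  by rewrite certE => /check_sound.
by exists c; rewrite certE; split=> //; apply: leq_trans (hp _).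
Qed.

(** * From cliques to points *)

Definition bin_of_nat (n : nat) : seq bool :=
  iter n (fun l => bin_add l [:: true]) [::].

Lemma bin_of_natS n : bin_of_nat n.+1 = bin_add (bin_of_nat n) [:: true].
Proof. by []. Qed.

Definition nat_bits (n : nat) : seq bool := rev (bin_of_nat n).

Lemma bits_val_nat_bits n : bits_val (nat_bits n) = n.
Proof.
rewrite -bin_val_rev revK; elim: n => // n IH.
by rewrite bin_of_natS bin_val_add IH /= addn1.
Qed.

Lemma ptime_nat_bits {I : finType} {X} {eX : Encoding X} (n : X -> nat) :
  ptime I n -> ptime I (fun x => nat_bits (n x)).
Proof.
have size_le k : size (bin_of_nat k) <= k.+1.
  by elim: k => // k IH; rewrite bin_of_natS size_bin_add /=; lia.
move=> pn; apply/ptime_rev/(ptime_comp (g := bin_of_nat)) => //.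
apply: (ptime_iter _ _ _ (B := fun k => 4 * k + 5)).
- by ptime.
- by ptime.
- by ptime.
- by poly_bounded.
move=> k i le; apply: leq_trans (enc_size_bits _) _; rewrite enc_size_nat.
by have := size_le i; rewrite /bin_of_nat; lia.
Qed.

#[export] Hint Resolve ptime_nat_bits : ptime.

Section CliqueInstance.
Variables (V : eqType) (v0 : V) (compat : rel V).
Variables (T : nat) (vs : seq V).
Let n := size vs.
Let adj (i k : nat) : bool := compat (nth v0 vs i) (nth v0 vs k).

Definition clique_fields (p q : nat * nat) : seq bool * seq bool :=
  if (p.1 == p.2) && (q.1 == q.2) then
    if p.1 == q.1 then ([:: true], nat_bits T)
    else if compat (nth v0 vs p.1) (nth v0 vs q.1) then ([::], [:: true])
    else ([:: true], [:: true])
  else ([::], [:: true]).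

Definition clique_word : seq (option bool) :=
  fields_word (nat_bits n :: flatten2
    [seq clique_fields p q | p <- nat_cells n, q <- nat_cells n]).

Local Open Scope ring_scope.

Definition clique_point (p q : nat * nat) : rat :=
  if (p.1 == p.2) && (q.1 == q.2) then
    if p.1 == q.1 then 1 / T%:R else if adj p.1 q.1 then 0 else 1
  else 0.

Lemma clique_fieldsE p q : frac_val (clique_fields p q) = clique_point p q.
Proof.
rewrite /clique_fields /clique_point; case: ifP => _; last first.
  by rewrite /frac_val mul0r.
case: ifP => _; first by rewrite /frac_val bits_val_nat_bits.
by rewrite /adj; case: ifP => _; rewrite /frac_val ?mul0r //= divr1.
Qed.

Lemma clique_point_ge0 p q : 0 <= clique_point p q.
Proof.
rewrite /clique_point; case: ifP => // _; case: ifP => [_|_]; last by case: ifP.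
by rewrite divr_ge0.
Qed.

Lemma clique_point_diag i k : clique_point (i, i) (k, k) =
  if i == k then 1 / T%:R else if adj i k then 0 else 1.
Proof. by rewrite /clique_point !eqxx. Qed.

Lemma inequality_lhs_cons y p sel : inequality_lhs y (p :: sel) =
  y p p - \sum_(q <- sel) y p q + inequality_lhs y sel.
Proof. by rewrite /inequality_lhs big_cons big_cat big_map /=; lra. Qed.

Lemma inequality_lhs_clique D : uniq D -> pairwise adj D ->
  inequality_lhs clique_point [seq (i, i) | i <- D] = (size D)%:R / T%:R.
Proof.
elim: D => [|i D IH] /=; first by rewrite /inequality_lhs !big_nil subrr mul0r.
case/andP=> /memPn ni u /andP[/allP adj_i pD].
rewrite inequality_lhs_cons IH // big_map big_seq big1 => [|k kD].
  by rewrite clique_point_diag eqxx subr0 -natr1 mulrDl addrC.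
by rewrite clique_point_diag eq_sym (negbTE (ni k kD)) adj_i.
Qed.

Lemma admissible_diagonal m (D : seq nat) : (7 <= size D)%N ->
  {in D, forall i, i < m}%N -> uniq D -> admissible m [seq (i, i) | i <- D].
Proof.
move=> D7 lt_m u; apply/and4P; split; first by rewrite size_map.
- by apply/allP=> _ /mapP[i /lt_m lt_i ->]; rewrite /= lt_i.
- by rewrite /unzip1 -map_comp map_id.
- by rewrite /unzip2 -map_comp map_id.
Qed.

Hypothesis T_gt0 : (0 < T)%N.

Lemma clique_word_encodes : encodes clique_word
  (fun a b : 'I_n * 'I_n => clique_point (nat_cell a) (nat_cell b)).
Proof.
exists (nat_bits n), (fun a b => (clique_fields (nat_cell a) (nat_cell b)).1),
  (fun a b => (clique_fields (nat_cell a) (nat_cell b)).2); split.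
- exact: bits_val_nat_bits.
- move=> a b; rewrite /clique_fields.
  by do 2! [case: ifP => // _]; [rewrite bits_val_nat_bits | case: ifP].
- by move=> a b; rewrite -clique_fieldsE.
by rewrite /clique_word -pairs_table_nat_cell /flatten2 map_allpairs.
Qed.

Lemma clique_point_missing_edge i sel :
  (exists2 k, (k, k) \in sel & (i != k) && ~~ adj i k) ->
  clique_point (i, i) (i, i) <= \sum_(q <- sel) clique_point (i, i) q.
Proof.
case=> k k_sel /andP[ne nadj]; rewrite (big_rem _ k_sel) /=.
rewrite !clique_point_diag eqxx (negbTE ne) (negbTE nadj).
apply: (@le_trans _ _ 1); last first.
  by rewrite lerDl; apply: sumr_ge0 => q _; apply: clique_point_ge0.
by rewrite ler_pdivrMr ?ltr0n // mul1r ler1n.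
Qed.

(* Scanning the selection from its end, a cell is kept when it is diagonal and
   compatible with all cells kept so far; dropping it otherwise does not
   decrease the left-hand side. *)
Lemma inequality_lhs_le_clique sel : uniq (unzip1 sel) ->
  exists C : seq nat, [/\ {in C, forall i, (i, i) \in sel}, pairwise adj C
    & inequality_lhs clique_point sel <= (size C)%:R / T%:R].
Proof.
elim: sel => [|[i j] sel IH] /=.
  by exists [::]; rewrite /inequality_lhs !big_nil mul0r subrr; split.
case/andP=> ni /IH[C [C_sel pC le]]; rewrite inequality_lhs_cons.
have sum_ge0 : 0 <= \sum_(q <- sel) clique_point (i, j) q.
  by apply: sumr_ge0 => q _; apply: clique_point_ge0.
have C_sel' : {in C, forall k, (k, k) \in (i, j) :: sel}.
  by move=> k /C_sel; rewrite inE orbC => ->.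
have drop :
    clique_point (i, j) (i, j) <= \sum_(q <- sel) clique_point (i, j) q ->
    exists C, [/\ {in C, forall k, (k, k) \in (i, j) :: sel}, pairwise adj C
      & clique_point (i, j) (i, j) - \sum_(q <- sel) clique_point (i, j) q
        + inequality_lhs clique_point sel <= (size C)%:R / T%:R].
  by move=> le0; exists C; split=> //; lra.
have [eij|nij] := eqVneq i j; last first.
  by apply: drop; rewrite {1}/clique_point /= (negbTE nij).
rewrite -{}eij in sum_ge0 C_sel' drop *.
have [adj_i|/allPn[k kC nadj]] := boolP (all (adj i) C); last first.
  apply/drop/clique_point_missing_edge; exists k; first exact: C_sel.
  rewrite nadj andbT; apply: contraNneq ni => ->.
  exact: (map_f fst (C_sel k kC)).
exists (i :: C); split=> [k||].
- by rewrite inE => /predU1P[->|/C_sel' //]; rewrite mem_head.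
- by rewrite /= adj_i.
by rewrite clique_point_diag eqxx /= -natr1 mulrDl; lra.
Qed.

End CliqueInstance.

Theorem clique_wordP (V : eqType) (v0 : V) (compat : rel V) T vs :
  irreflexive compat -> (7 <= T)%N ->
  inequalities_problem (clique_word v0 compat T vs) <->
  ~ exists C : seq V,
      [/\ {subset C <= vs}, pairwise compat C & (T < size C)%N].
Proof.
move=> compat_irr T7; have T_gt0 : (0 < T)%N by apply: leq_trans T7.
have T_gt0' : (0 < T%:R :> rat)%R by rewrite ltr0n.
have enc_word := clique_word_encodes v0 compat vs T_gt0.
rewrite (inequalities_problem_encodes enc_word) //.
split=> [sat [C [sC pC ltC]]|no_clique sel adm].
  pose D := map (index^~ vs) C.
  have pD : pairwise (fun i k => compat (nth v0 vs i) (nth v0 vs k)) D.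
    rewrite pairwise_map (eq_in_pairwise (P := mem vs) (r' := compat)) ?pC //.
      by move=> u v u_vs v_vs /=; rewrite !nth_index.
    exact/allP.
  have uD : uniq D by apply: pairwise_uniq pD => i; apply: compat_irr.
  have lt_D : {in D, forall i, i < size vs}.
    by move=> _ /mapP[v /sC v_vs ->]; rewrite index_mem.
  have D7 : 7 <= size D by rewrite size_map (leq_trans T7) // ltnW.
  have := sat _ (admissible_diagonal D7 lt_D uD).
  rewrite (inequality_lhs_clique _ uD pD) ler_pdivrMr // mul1r ler_nat size_map.
  by rewrite leqNgt ltC.
rewrite leNgt; apply/negP => gt1; apply: no_clique.
have /and4P[_ /allP lt_n u _] := adm.
have [C [C_sel pC le]] := inequality_lhs_le_clique v0 compat vs T_gt0 u.
exists (map (nth v0 vs) C); split; rewrite ?pairwise_map //.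
  by move=> _ /mapP[i /C_sel/lt_n/andP[lt_i _] ->]; apply: mem_nth.
rewrite size_map -(ltr_nat rat) -[X in (X < _)%R]mul1r -ltr_pdivlMr //.
exact: lt_le_trans gt1 le.
Qed.

Lemma ptime_clique_fields {I : finType} {V : eqType} {eV : Encoding V}
    {X} {eX : Encoding X} (v0 : V) (compat : rel V) (T : X -> nat)
    (vs : X -> seq V) (p q : X -> nat * nat) :
  ptime I (fun p : V * V => compat p.1 p.2) ->
  ptime I T -> ptime I vs -> ptime I p -> ptime I q ->
  ptime I (fun x => clique_fields v0 compat (T x) (vs x) (p x) (q x)).
Proof.
move=> pc pT pvs pp pq; rewrite /clique_fields.
have pcompat : ptime I (fun x =>
    compat (nth v0 (vs x) (p x).1) (nth v0 (vs x) (q x).1)).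
  by apply: (ptime_comp2 pc); ptime.
by ptime.
Qed.

#[export] Hint Resolve ptime_clique_fields : ptime.

Lemma ptime_nat_cells {I : finType} {X} {eX : Encoding X} (n : X -> nat) :
  ptime I n -> ptime I (fun x => nat_cells (n x)).
Proof. by move=> pn; rewrite /nat_cells; ptime. Qed.

Lemma ptime_flatten2 {I : finType} {X T} {eX : Encoding X} {eT : Encoding T}
  (l : X -> seq (T * T)) : ptime I l -> ptime I (fun x => flatten2 (l x)).
Proof. by move=> pl; rewrite /flatten2; ptime. Qed.

Lemma ptime_fields_word {I : finType} {X} {eX : Encoding X}
  (fs : X -> seq (seq bool)) :
  ptime I fs -> ptime I (fun x => fields_word (fs x)).
Proof. by move=> pfs; rewrite /fields_word; ptime. Qed.

#[export] Hint Resolve ptime_nat_cells ptime_flatten2 ptime_fields_word : ptime.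

Lemma ptime_clique_word {I : finType} {V : eqType} {eV : Encoding V}
    {X} {eX : Encoding X} (v0 : V) (compat : rel V) (T : X -> nat)
    (vs : X -> seq V) :
  ptime I (fun p : V * V => compat p.1 p.2) -> ptime I T -> ptime I vs ->
  ptime I (fun x => clique_word v0 compat (T x) (vs x)).
Proof. by move=> pc pT pvs; rewrite /clique_word; ptime. Qed.

(** * Views of a run *)

Definition move_head (d : direction) (h : nat) : nat :=
  match d with MoveLeft => h.-1 | Stay => h | MoveRight => h.+1 end.

Section Cells.
Variable S : Type.
Implicit Type t : tape S.

(* The content of the absolute position [z] when the head stands at [h]. *)
Definition cell t (h z : nat) : option S :=
  if h <= z then nth None (tcur t :: tright t) (z - h)
  else nth None (tleft t) (h - z).-1.

Lemma cell_cur t h : cell t h h = tcur t.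
Proof. by rewrite /cell leqnn subnn. Qed.

Lemma cell_write a t h z :
  cell (tape_write a t) h z = if z == h then a else cell t h z.
Proof.
rewrite /cell /=; case: ltngtP => [lt|//|->]; last by rewrite subnn.
by rewrite -(subnSK lt).
Qed.

Lemma nth_head_behead (s : seq (option S)) i :
  nth None (head None s :: behead s) i = nth None s i.
Proof. by case: s i => [|a s] [|i] //=; rewrite !nth_nil. Qed.

Lemma cell_move d t h z :
  0 < h -> cell (tape_move d t) (move_head d h) z = cell t h z.
Proof.
case: h => // h _; case: d => //=; rewrite /cell /=.
- case: (ltngtP h z) => [lt|lt|->].
  + by rewrite -(subnSK lt).
  + by rewrite nth_behead; congr nth; lia.
  + by rewrite subnn subSnn /= nth0.
- case: (ltngtP h.+1 z) => [lt|lt|<-].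
  + by rewrite nth_head_behead -(subnSK lt).
  + by rewrite (_ : (h.+2 - z).-1 = (h.+1 - z).-1.+1) //; lia.
  + by rewrite subnn subSnn.
Qed.

End Cells.

Section Views.
Variables (J : finType) (M : TM J).
Notation tape_index := 'I_(tm_k M).+1.
Notation sym := (J + tm_work M)%type.

Definition view : finType :=
  (tm_state M * {ffun tape_index -> option sym})%type.

Definition view_step (g : view) :
    tm_state M * {ffun tape_index -> option sym * direction} :=
  if tm_halt g.1 then (g.1, [ffun a => (g.2 a, Stay)]) else tm_trans g.1 g.2.

Definition written (g : view) (a : tape_index) : option sym :=
  ((view_step g).2 a).1.

Definition next_head (g : view) (a : tape_index) (h : nat) : nat :=
  move_head ((view_step g).2 a).2 h.

Implicit Type a : tape_index.

(* All heads start at the absolute position [T], so that they stay at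
   nonnegative positions for [T] steps. *)
Variables (u : seq J) (T : nat).

Definition view_at (t : nat) : view :=
  (cstate (run M u t), [ffun a => tcur (ctapes (run M u t) a)]).

Fixpoint head_at (a : tape_index) (t : nat) : nat :=
  if t is t'.+1 then next_head (view_at t') a (head_at a t') else T.

Lemma view_at_succ t : (view_at t.+1).1 = (view_step (view_at t)).1 /\
  forall a, ctapes (run M u t.+1) a =
    tape_move ((view_step (view_at t)).2 a).2
      (tape_write (written (view_at t) a) (ctapes (run M u t) a)).
Proof.
rewrite /written /view_at /run iterS -/(run M u t) /step /view_step /= /halted.
case: ifP => h; last first.
  by case: (tm_trans _ _) => q act; split=> // a; rewrite ffunE.
by split=> // a; rewrite !ffunE /=; case: (ctapes _ _).
Qed.

Lemma head_at_bounds a t : t <= T -> T - t <= head_at a t <= T + t.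
Proof.
elim: t => [|t IH] lt /=; first by rewrite subn0 addn0 !leqnn.
have := IH (ltnW lt); rewrite /next_head.
by case: ((view_step _).2 a).2 => /=; lia.
Qed.

Definition cell_at a t z : option sym :=
  cell (ctapes (run M u t) a) (head_at a t) z.

Lemma cell_at_succ a t z : t < T -> cell_at a t.+1 z =
  if z == head_at a t then written (view_at t) a else cell_at a t z.
Proof.
move=> lt; rewrite /cell_at (view_at_succ t).2.
rewrite -[head_at a t.+1]/(next_head (view_at t) a (head_at a t)).
rewrite cell_move ?cell_write //.
by have := head_at_bounds a (ltnW lt); lia.
Qed.

Lemma view_at_read a t : (view_at t).2 a = cell_at a t (head_at a t).
Proof. by rewrite /cell_at cell_cur ffunE. Qed.

Lemma cell_at_init a z : cell_at a 0 z =
  if (a == ord0) && (T <= z)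
  then nth None (map (fun x => Some (inl x)) u) (z - T) else None.
Proof.
rewrite /cell_at /cell /= ffunE; case: eqP => _ /=; last first.
  case: ifP => _; last by rewrite nth_nil.
  by case: (z - T) => // m; rewrite /= nth_nil.
case: leqP => _; last by case: (u) => [|x v] /=; rewrite nth_nil.
case: (u) => [|x v] /=; first by case: (z - T) => // m; rewrite /= nth_nil.
by rewrite -map_comp.
Qed.

(* One plus the time of the last visit of [p] before [t], or 0. *)
Fixpoint last_visit a (t p : nat) : nat :=
  if t is t'.+1 then if head_at a t' == p then t'.+1 else last_visit a t' p
  else 0.

Lemma cell_at_last_visit a t p : t <= T -> cell_at a t p =
  if last_visit a t p is s.+1 then written (view_at s) a else cell_at a 0 p.
Proof.
elim: t => // t IH lt; rewrite cell_at_succ // IH 1?ltnW //= eq_sym.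
by case: eqP.
Qed.

Lemma last_visit_le a t p : last_visit a t p <= t.
Proof. by elim: t => //= t IH; case: eqP => // _; apply: leqW. Qed.

Lemma last_visit_head a t p s : last_visit a t p = s.+1 -> head_at a s = p.
Proof. by elim: t => //= t IH; case: eqP => // <- [<-]. Qed.

Lemma last_visit_after a t p s :
  last_visit a t p <= s -> s < t -> head_at a s != p.
Proof.
elim: t => //= t IH; case: eqP => [_|ne]; first by lia.
move=> le; rewrite ltnS leq_eqVlt => /predU1P[->|]; first exact/eqP.
exact: IH.
Qed.

Lemma last_visit_unique a t p l : l <= t ->
  (forall s, s < t -> l = s.+1 -> head_at a s = p) ->
  (forall s, s < t -> l <= s -> head_at a s != p) -> last_visit a t p = l.
Proof.
elim: t => [|t IH] le visit after; first by move: le; rewrite leqn0 => /eqP.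
rewrite /=; move: le; rewrite leq_eqVlt => /predU1P[e|lt].
  by rewrite (visit t) ?eqxx.
rewrite (negbTE (after t _ _)) //; apply: IH => // s ls e.
  by apply: visit e; apply: ltnW.
by apply: after e; apply: ltnW.
Qed.

End Views.

Lemma run_halted (J : finType) (M : TM J) u t t' :
  halted (run M u t) -> t <= t' -> run M u t' = run M u t.
Proof.
move=> h; elim: t' => [|t' IH]; first by case: t h.
rewrite leq_eqVlt => /predU1P[->//|lt].
by rewrite /run iterS -/(run M u t') IH // /step h.
Qed.

(** * The tableau of a verifier *)

Fixpoint seqs_over (T : Type) (s : seq T) (n : nat) : seq (seq T) :=
  if n is n'.+1 then [seq a :: l | a <- s, l <- seqs_over s n'] else [:: [::]].

Lemma mem_seqs_over (T : eqType) (s : seq T) n l :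
  (l \in seqs_over s n) = (size l == n) && all (mem s) l.
Proof.
elim: n l => [|n IH] [|a l] //=; first by apply/allpairsP => -[[b m] []].
rewrite eqSS [RHS]andbCA -IH; apply/allpairsP/andP.
  by case=> [[b m] /= [? ? [-> ->]]].
by case=> a_s l_s; exists (a, l).
Qed.

Section Tableau.
Variables (A : finType) (M : TM (A + bool)%type).
Notation tape_index := 'I_(tm_k M).+1.
Notation sym := ((A + bool) + tm_work M)%type.

(* Time, view, certificate length, and for each tape the head position and the
   last visit of it. *)
Definition vertex : eqType := ((nat * view M) * (nat * seq (nat * nat)))%type.

Implicit Types (v : vertex) (a : tape_index).

Definition vertex_time v : nat := v.1.1.
Definition vertex_view v : view M := v.1.2.
Definition vertex_cert_size v : nat := v.2.1.
Definition vertex_head v a : nat := (nth (0, 0) v.2.2 a).1.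
Definition vertex_last v a : nat := (nth (0, 0) v.2.2 a).2.

Definition input_cell (x : A) : option sym := Some (inl (inl x)).
Definition cert_cell (b : bool) : option sym := Some (inl (inr b)).

Section Vertices.
Variables (T : nat) (w : seq A).

Definition in_cert (len : nat) a (p : nat) : bool :=
  [&& a == ord0, T + size w <= p & p < T + size w + len].

Definition initial_cell a (p : nat) : option sym :=
  if (a == ord0) && (T <= p) then nth None (map input_cell w) (p - T) else None.

Definition initial_ok (len : nat) a (p : nat) (r : option sym) : bool :=
  if in_cert len a p then (r == cert_cell false) || (r == cert_cell true)
  else r == initial_cell a p.

Definition vertex_ok v : bool :=
  [&& (vertex_time v == 0) ==> ((vertex_view v).1 == tm_start M) &&
        [forall a, vertex_head v a == T],
      (vertex_time v == T) ==> tm_accept (vertex_view v).1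
    & [forall a, (vertex_last v a <= vertex_time v) &&
        ((vertex_last v a == 0) ==> initial_ok (vertex_cert_size v) a
           (vertex_head v a) ((vertex_view v).2 a))]].

Definition edge_ok v v' : bool :=
  [&& vertex_cert_size v == vertex_cert_size v',
      (vertex_time v' == (vertex_time v).+1) ==>
        ((vertex_view v').1 == (view_step (vertex_view v)).1) &&
        [forall a, vertex_head v' a
           == next_head (vertex_view v) a (vertex_head v a)]
    & [forall a, if vertex_last v' a == (vertex_time v).+1
         then (vertex_head v a == vertex_head v' a) &&
              ((vertex_view v').2 a == written (vertex_view v) a)
         else (vertex_last v' a <= vertex_time v) ==>
              (vertex_head v a != vertex_head v' a)]].

Definition tableau (f : nat -> vertex) : Prop :=
  (forall t, t <= T -> vertex_time (f t) = t /\ vertex_ok (f t)) /\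
  (forall s t, s < t -> t <= T -> edge_ok (f s) (f t)).

End Vertices.

Section RunTableau.
Variables (T : nat) (w : seq A).
Let input (c : seq bool) : seq (A + bool) := map inl w ++ map inr c.

Lemma cell_at_initial c a p : cell_at (input c) T a 0 p =
  if in_cert T w (size c) a p then cert_cell (nth false c (p - T - size w))
  else initial_cell T w a p.
Proof.
rewrite cell_at_init /in_cert /initial_cell.
case: (a == ord0) => //=; case: (leqP T p) => [le_T|lt_T]; last first.
  by rewrite leqNgt ltn_addr.
have -> : (T + size w <= p) = (size w <= p - T) by lia.
rewrite /input map_cat -!map_comp nth_cat size_map.
case: (ltnP (p - T) (size w)) => //= le_w.
have -> : (p < T + size w + size c) = (p - T - size w < size c) by lia.
case: ltnP => [lt_c|le_c]; first by rewrite (nth_map false).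
by rewrite !nth_default ?size_map.
Qed.

Lemma initial_ok_cell c a p :
  initial_ok T w (size c) a p (cell_at (input c) T a 0 p).
Proof.
rewrite cell_at_initial /initial_ok; case: (in_cert _ _ _ _ _) => //.
by case: (nth false _ _); rewrite eqxx ?orbT.
Qed.

Definition run_vertex (c : seq bool) (t : nat) : vertex :=
  ((t, view_at M (input c) t),
   (size c, [seq (head_at (input c) T a t,
                  last_visit (input c) T a t (head_at (input c) T a t))
            | a <- enum tape_index])).

Lemma nth_map_enum_ord (R : Type) n x0 (f : 'I_n -> R) (i : 'I_n) :
  nth x0 (map f (enum 'I_n)) i = f i.
Proof. by rewrite (nth_map i) ?size_enum_ord // nth_ord_enum. Qed.

Lemma run_vertex_head c t a :
  vertex_head (run_vertex c t) a = head_at (input c) T a t.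
Proof. by rewrite /vertex_head nth_map_enum_ord. Qed.

Lemma run_vertex_last c t a : vertex_last (run_vertex c t) a =
  last_visit (input c) T a t (head_at (input c) T a t).
Proof. by rewrite /vertex_last nth_map_enum_ord. Qed.

Lemma run_vertex_ok c t : tm_accept (cstate (run M (input c) T)) -> t <= T ->
  vertex_ok T w (run_vertex c t).
Proof.
move=> acc le_T; apply/and3P; split.
- apply/implyP=> /eqP t0; rewrite [t]t0 eqxx.
  by apply/forallP => a; rewrite run_vertex_head.
- by apply/implyP=> /eqP tT; rewrite [t]tT.
apply/forallP => a; rewrite run_vertex_last run_vertex_head last_visit_le.
apply/implyP=> /eqP no_visit; rewrite [vertex_view _]/(view_at M (input c) t).
rewrite (view_at_read _ T) cell_at_last_visit // no_visit.
exact: initial_ok_cell.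
Qed.

Lemma run_vertex_edge c s t : s < t -> t <= T ->
  edge_ok (run_vertex c s) (run_vertex c t).
Proof.
move=> lt le; apply/and3P; split; first exact: eqxx.
  apply/implyP=> /eqP tE; rewrite [t]tE (view_at_succ M (input c) s).1 eqxx.
  by apply/forallP => a; rewrite !run_vertex_head.
apply/forallP => a; rewrite !run_vertex_head run_vertex_last.
case: eqP => [visit|_]; last by apply/implyP=> /last_visit_after; apply.
rewrite (last_visit_head visit) eqxx /=.
by rewrite (view_at_read _ T) cell_at_last_visit // visit.
Qed.

End RunTableau.

Section TableauRun.
Variables (T : nat) (w : seq A) (f : nat -> vertex).
Hypothesis tab : tableau T w f.
Let len := vertex_cert_size (f 0).
Let cert_pos (z : nat) : nat := T + size w + z.

Lemma tableau_time t : t <= T -> vertex_time (f t) = t.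
Proof. by case/tab.1. Qed.

Lemma tableau_cert_size t : t <= T -> vertex_cert_size (f t) = len.
Proof.
case: t => // t le; have /and3P[/eqP <- _ _] := tab.2 0 t.+1 isT le.
by [].
Qed.

Definition first_reads_true (z t : nat) : bool :=
  [&& vertex_last (f t) ord0 == 0, vertex_head (f t) ord0 == cert_pos z
    & (vertex_view (f t)).2 ord0 == cert_cell true].

Definition tableau_cert : seq bool :=
  mkseq (fun z => has (first_reads_true z) (iota 0 T.+1)) len.

Lemma size_tableau_cert : size tableau_cert = len.
Proof. exact: size_mkseq. Qed.

Lemma first_visit_unique s t : s <= T -> t <= T ->
  vertex_last (f s) ord0 = 0 -> vertex_last (f t) ord0 = 0 ->
  vertex_head (f s) ord0 = vertex_head (f t) ord0 -> s = t.
Proof.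
wlog lt : s t / s < t => [IH|].
  move=> sT tT ls lt e; case: (ltngtP s t) => // lt_st; first exact: IH.
  by apply/esym/IH.
move=> sT tT _ lt0 e; have /and3P[_ _ /forallP/(_ ord0)] := tab.2 s t lt tT.
by rewrite lt0 e eqxx.
Qed.

Lemma first_read_cert t : t <= T -> vertex_last (f t) ord0 = 0 ->
  in_cert T w len ord0 (vertex_head (f t) ord0) ->
  (vertex_view (f t)).2 ord0 =
    cert_cell (nth false tableau_cert (vertex_head (f t) ord0 - T - size w)).
Proof.
move=> tT no_visit on_cert; set z := _ - size w.
have /and3P[_ le_w lt_len] := on_cert.
have headE : vertex_head (f t) ord0 = cert_pos z by rewrite /cert_pos /z; lia.
have lt_z : z < len by rewrite /z; lia.
have [_ /and3P[_ _ /forallP/(_ ord0)/andP[_]]] := tab.1 t tT.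
rewrite no_visit eqxx /= /initial_ok (tableau_cert_size tT) on_cert.
rewrite nth_mkseq //.
case/orP=> /eqP readE; rewrite readE; congr cert_cell; apply/esym.
  apply/hasP => -[s]; rewrite mem_iota /= => sT /and3P[/eqP s0 /eqP sz].
  have est : s = t by apply: first_visit_unique => //; rewrite sz headE.
  by rewrite est readE.
apply/hasP; exists t; rewrite ?mem_iota // /first_reads_true.
by rewrite no_visit headE readE !eqxx.
Qed.

Let u := map inl w ++ map inr tableau_cert : seq (A + bool).

Definition agrees (t : nat) : Prop := vertex_view (f t) = view_at M u t /\
  forall a, vertex_head (f t) a = head_at u T a t.

Section Step.
Variable t : nat.
Hypotheses (tT : t <= T) (IH : forall s, s < t -> agrees s).

Lemma agrees_edge s : s < t ->
  agrees s /\ edge_ok (f s) (f t).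
Proof. by move=> lt; split; [exact: IH | apply: tab.2]. Qed.

Lemma agrees_head a : vertex_head (f t) a = head_at u T a t.
Proof.
have [time /and3P[init _ _]] := tab.1 t tT.
case tE: t => [|s].
  by move: init; rewrite time tE /= => /andP[_ /forallP/(_ a)/eqP].
have lt_st : s < t by rewrite tE.
have [[viewE headE] /and3P[_ + _]] := agrees_edge lt_st.
rewrite time tableau_time ?(leq_trans (ltnW lt_st)) // tE eqxx -tE.
by case/andP=> _ /forallP/(_ a)/eqP ->; rewrite viewE headE tE.
Qed.

Lemma agrees_state : (vertex_view (f t)).1 = cstate (run M u t).
Proof.
have [time /and3P[init _ _]] := tab.1 t tT.
case tE: t => [|s].
  by move: init; rewrite time tE /= => /andP[/eqP].
have lt_st : s < t by rewrite tE.
have [[viewE headE] /and3P[_ + _]] := agrees_edge lt_st.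
rewrite time tableau_time ?(leq_trans (ltnW lt_st)) // tE eqxx -tE.
by case/andP=> /eqP -> _; rewrite viewE -(view_at_succ M u s).1 tE.
Qed.

Lemma agrees_last a :
  last_visit u T a t (vertex_head (f t) a) = vertex_last (f t) a.
Proof.
have [time /and3P[_ _ /forallP/(_ a)/andP[le_last _]]] := tab.1 t tT.
apply: last_visit_unique => [|s lt e|s lt le]; first by rewrite -{2}time.
all: have [[_ <-] /and3P[_ _ /forallP/(_ a)]] := agrees_edge lt.
all: rewrite tableau_time ?(leq_trans (ltnW lt)) //.
  by rewrite e eqxx => /andP[/eqP].
by rewrite (ltn_eqF (le : vertex_last (f t) a < s.+1)) le.
Qed.

Lemma agrees_read a : (vertex_view (f t)).2 a = (view_at M u t).2 a.
Proof.
rewrite (view_at_read _ T) -agrees_head cell_at_last_visit // agrees_last.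
have [time /and3P[_ _ /forallP/(_ a)/andP[le_last init]]] := tab.1 t tT.
case lastE: (vertex_last (f t) a) => [|s].
  move: init; rewrite lastE /= (tableau_cert_size tT) cell_at_initial.
  rewrite size_tableau_cert /initial_ok.
  have [on_cert _|_ /eqP //] := boolP (in_cert T w len a (vertex_head (f t) a)).
  have a0 : a = ord0 by have /and3P[/eqP] := on_cert.
  by rewrite a0 in lastE on_cert *; apply: first_read_cert.
have lt : s < t by rewrite -lastE -{2}time.
have [[viewE _] /and3P[_ _ /forallP/(_ a)]] := agrees_edge lt.
rewrite tableau_time ?(leq_trans (ltnW lt)) // lastE eqxx => /andP[_ /eqP ->].
by rewrite viewE.
Qed.

End Step.

Lemma tableau_agrees t : t <= T -> agrees t.
Proof.
elim/ltn_ind: t => t IH tT.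
have agrees_before s : s < t -> agrees s.
  by move=> lt; apply: IH (leq_trans (ltnW lt) tT).
split; last exact: agrees_head.
rewrite [LHS]surjective_pairing [RHS]surjective_pairing; congr pair.
  exact: agrees_state.
by apply/ffunP=> a; apply: agrees_read.
Qed.

Lemma run_of_tableau : tm_accept (cstate (run M u T)).
Proof.
have [time /and3P[_ acc _]] := tab.1 T (leqnn T).
have [viewE _] := tableau_agrees (leqnn T).
by move: acc; rewrite time eqxx viewE.
Qed.

End TableauRun.

Definition compatible v v' : bool :=
  if vertex_time v < vertex_time v' then edge_ok v v'
  else (vertex_time v' < vertex_time v) && edge_ok v' v.

Lemma compatible_irr : irreflexive compatible.
Proof. by move=> v; rewrite /compatible ltnn. Qed.

Lemma compatible_sym : symmetric compatible.
Proof. by move=> v v'; rewrite /compatible; case: ltngtP. Qed.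

Lemma compatible_time v v' : compatible v v' -> vertex_time v != vertex_time v'.
Proof. by rewrite /compatible; case: ltngtP. Qed.

Lemma compatible_edge v v' :
  compatible v v' -> vertex_time v < vertex_time v' -> edge_ok v v'.
Proof. by rewrite /compatible => + lt; rewrite lt. Qed.

Definition head_visits (T : nat) : seq (nat * nat) :=
  [seq (p, l) | p <- iota 0 (T + T).+1, l <- iota 0 T.+1].

Definition vertices (T P : nat) (w : seq A) : seq vertex :=
  [seq v <- [seq (tg, lh)
            | tg <- [seq (t, g) | t <- iota 0 T.+1, g <- enum (view M)],
              lh <- [seq (l, h) | l <- iota 0 P.+1,
                                  h <- seqs_over (head_visits T) (tm_k M).+1]]
  | vertex_ok T w v].

Section Cliques.
Variables (T P : nat) (w : seq A).

Lemma verticesP v : v \in vertices T P w ->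
  [/\ vertex_ok T w v, vertex_time v <= T & vertex_cert_size v <= P].
Proof.
rewrite mem_filter => /andP[ok /allpairsP[[tg lh] [+ + vE]]].
move=> /allpairsP[[t g] [t_T _ tgE]] /allpairsP[[l h] [l_P _ lhE]]; split=> //.
  by rewrite vE /vertex_time /= [tg]tgE; rewrite mem_iota in t_T.
by rewrite vE /vertex_cert_size /= [lh]lhE; rewrite mem_iota in l_P.
Qed.

Lemma run_vertex_in_vertices (c : seq bool) t : size c <= P -> t <= T ->
  tm_accept (cstate (run M (map inl w ++ map inr c) T)) ->
  run_vertex T w c t \in vertices T P w.
Proof.
move=> le_P le_T acc; rewrite mem_filter run_vertex_ok //.
set v := run_vertex T w c t.
apply/allpairsP; exists v; split; last by case: (v).
  by apply/allpairsP; exists v.1; rewrite mem_iota mem_enum.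
apply/allpairsP; exists v.2; split; [by rewrite mem_iota | | by case: (v.2)].
rewrite mem_seqs_over size_map size_enum_ord eqxx.
apply/allP => _ /mapP[a _ ->]; apply: allpairs_f; rewrite mem_iota /=.
  have /andP[_ le_h] := head_at_bounds (map inl w ++ map inr c) a le_T.
  by apply: leq_ltn_trans le_h _; rewrite add0n ltnS leq_add2l.
exact: leq_ltn_trans (last_visit_le _ _ _ _ _) _.
Qed.

Lemma clique_of_run (c : seq bool) : size c <= P ->
  tm_accept (cstate (run M (map inl w ++ map inr c) T)) ->
  exists C,
    [/\ {subset C <= vertices T P w}, pairwise compatible C & T < size C].
Proof.
move=> le_P acc; exists [seq run_vertex T w c t | t <- iota 0 T.+1]; split.
- by move=> _ /mapP[t + ->]; rewrite mem_iota => /run_vertex_in_vertices; apply.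
- rewrite pairwise_map; have : pairwise ltn (iota 0 T.+1).
    by rewrite -sorted_pairwise ?iota_ltn_sorted //; apply: ltn_trans.
  apply: (@sub_in_pairwise _ (mem (iota 0 T.+1)) ltn); last exact/allP.
  move=> s t _; rewrite mem_iota /= => t_T lt; rewrite /compatible /= lt.
  exact: run_vertex_edge.
- by rewrite size_map size_iota.
Qed.

Lemma pairwise_mem (S : eqType) (r : rel S) C x y : symmetric r ->
  pairwise r C -> x \in C -> y \in C -> x != y -> r x y.
Proof.
move=> sym; elim: C => //= z C IH /andP[/allP r_z pC]; rewrite !inE.
case/predU1P=> [->|xC] /predU1P[->|yC]; rewrite ?eqxx // => ne.
- exact: r_z.
- by rewrite sym r_z.
- exact: IH.
Qed.

Section TableauOfClique.
Variable C : seq vertex.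
Hypotheses (sC : {subset C <= vertices T P w}) (pC : pairwise compatible C).
Hypothesis ltC : T < size C.

Let default_vertex : vertex := ((0, (tm_start M, [ffun=> None])), (0, [::])).

Definition vertex_of_time t : vertex :=
  head default_vertex [seq v <- C | vertex_time v == t].

Lemma vertex_of_timeP t : t <= T ->
  vertex_of_time t \in C /\ vertex_time (vertex_of_time t) = t.
Proof.
move=> le; have times_uniq : uniq (map vertex_time C).
  rewrite (pairwise_uniq (r := fun s t : nat => s != t)) // => [s|].
    by rewrite eqxx.
  by rewrite pairwise_map; apply: sub_pairwise pC => v v' /compatible_time.
have times_le : {subset map vertex_time C <= iota 0 T.+1}.
  by move=> _ /mapP[v /sC/verticesP[_ ? _] ->]; rewrite mem_iota.
have [|_ times] := uniq_min_size times_uniq times_le.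
  by rewrite size_iota size_map.
have : t \in map vertex_time C by rewrite times mem_iota.
case/mapP=> v vC tE; have : v \in [seq v <- C | vertex_time v == t].
  by rewrite mem_filter tE eqxx.
rewrite /vertex_of_time; case filterE: [seq _ <- _ | _] => [//|v' s] _ /=.
have : v' \in [seq v <- C | vertex_time v == t] by rewrite filterE mem_head.
by rewrite mem_filter => /andP[/eqP].
Qed.

Lemma tableau_of_clique : tableau T w vertex_of_time.
Proof.
split=> [t /vertex_of_timeP[tC ->]|s t lt le].
  by have [] := verticesP (sC tC).
have [tC tE] := vertex_of_timeP le.
have [sC' sE] := vertex_of_timeP (leq_trans (ltnW lt) le).
apply: compatible_edge; last by rewrite sE tE.
apply: (pairwise_mem compatible_sym pC) => //.
by apply/eqP => e; move: lt; rewrite -sE e tE ltnn.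
Qed.

End TableauOfClique.

Lemma run_of_clique C : {subset C <= vertices T P w} -> pairwise compatible C ->
  T < size C -> exists2 c : seq bool, size c <= P &
    tm_accept (cstate (run M (map inl w ++ map inr c) T)).
Proof.
move=> sC pC ltC; have tab := tableau_of_clique sC pC ltC.
exists (tableau_cert T w (vertex_of_time C)); last exact: run_of_tableau.
have [/sC/verticesP[_ _ le] _] := vertex_of_timeP sC pC ltC (leq0n T).
by rewrite size_tableau_cert.
Qed.

End Cliques.
End Tableau.

(** * The reduction *)

Lemma horner_nat_homo (p : {poly nat}) :
  {homo (fun n : nat => p.[n]%R : nat) : m n / m <= n}.
Proof.
move=> m n le; elim/poly_ind: p => [|p c IH]; first by rewrite !horner0.
by rewrite !hornerMXaddC leq_add2r leq_mul.
Qed.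

Lemma ptime_horner {I : finType} {X} {eX : Encoding X} (p : {poly nat})
    (n : X -> nat) :
  ptime I n -> ptime I (fun x => p.[n x]%R : nat).
Proof.
move=> pn; elim/poly_ind: p => [|p c IH].
  by apply: (eq_ptime (f := fun=> 0)); [move=> x; rewrite horner0 | ptime].
apply: (eq_ptime (f := fun x => p.[n x]%R * n x + c)); last by ptime.
by move=> x; rewrite hornerMXaddC.
Qed.

Lemma ptime_forall {I B : finType} {X} {eX : Encoding X} (F : X -> B -> bool) :
  ptime I (fun p : X * B => F p.1 p.2) -> ptime I (fun x => [forall b, F x b]).
Proof.
move=> pF; apply: (eq_ptime (f := fun x => all (F x) (enum B))); last by ptime.
move=> x; apply/allP/forallP => ok b; last by rewrite ok.
by apply: ok; rewrite mem_enum.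
Qed.

Lemma ptime_seqs_over {I : finType} {X T} {eX : Encoding X} {eT : Encoding T}
    (s : X -> seq T) (n : nat) :
  ptime I s -> ptime I (fun x => seqs_over (s x) n).
Proof.
elim: n X eX s => [|n IH] X eX s ps /=; first exact: ptime_const.
apply/ptime_flatten/ptime_map => //; apply: ptime_map; last by ptime.
by apply: IH; ptime.
Qed.

#[export] Hint Resolve ptime_horner ptime_forall ptime_seqs_over : ptime.

#[global] Instance enc_vertex (A : finType) (M : TM (A + bool)%type) :
  Encoding (vertex M) :=
  _ : Encoding ((nat * view M) * (nat * seq (nat * nat))).

Section PtimeVertexFields.
Context {I A : finType} {M : TM (A + bool)%type} {X : Type} {eX : Encoding X}.
Implicit Types (v : X -> vertex M) (a : X -> 'I_(tm_k M).+1).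

Lemma ptime_vertex_time v : ptime I v -> ptime I (fun x => vertex_time (v x)).
Proof. by move=> pv; rewrite /vertex_time; do 2! apply: ptime_fst. Qed.

Lemma ptime_vertex_view v : ptime I v -> ptime I (fun x => vertex_view (v x)).
Proof. by move=> pv; apply/ptime_snd/ptime_fst. Qed.

Lemma ptime_vertex_cert_size v :
  ptime I v -> ptime I (fun x => vertex_cert_size (v x)).
Proof. by move=> pv; apply/ptime_fst/ptime_snd. Qed.

Lemma ptime_nat_of_ord n (i : X -> 'I_n) :
  ptime I i -> ptime I (fun x => i x : nat).
Proof. by apply: ptime_comp; apply: ptime_finite. Qed.

Lemma ptime_vertex_head v a :
  ptime I v -> ptime I a -> ptime I (fun x => vertex_head (v x) (a x)).
Proof.
move=> pv pa; apply/ptime_fst/ptime_nth; last exact: ptime_nat_of_ord.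
by do 2! apply: ptime_snd.
Qed.

Lemma ptime_vertex_last v a :
  ptime I v -> ptime I a -> ptime I (fun x => vertex_last (v x) (a x)).
Proof.
move=> pv pa; apply/ptime_snd/ptime_nth; last exact: ptime_nat_of_ord.
by do 2! apply: ptime_snd.
Qed.

End PtimeVertexFields.

#[export] Hint Resolve ptime_vertex_time ptime_vertex_view
  ptime_vertex_cert_size ptime_vertex_head ptime_vertex_last : ptime.

Section PtimeTableau.
Context {I A : finType} {M : TM (A + bool)%type}.
Notation tape_index := 'I_(tm_k M).+1.

Notation sym := ((A + bool) + tm_work M)%type.
Context {X : Type} {eX : Encoding X}.
Implicit Types (g : X -> view M) (a : X -> tape_index) (h p : X -> nat).
Implicit Type r : X -> option sym.

Lemma ptime_next_head g a h : ptime I g -> ptime I a -> ptime I h ->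
  ptime I (fun x => next_head (g x) (a x) (h x)).
Proof.
move=> pg pa ph.
pose move_of (d : direction) : option bool :=
  match d with
  | MoveLeft => Some false | Stay => None | MoveRight => Some true
  end.
pose moves (g : view M) (a : tape_index) := move_of ((view_step g).2 a).2.
have pmoves : ptime I (fun x => moves (g x) (a x)).
  by apply: ptime_comp2 pg pa; apply: ptime_finite.
apply: (eq_ptime (f := fun x => if isSome (moves (g x) (a x)) then
    if odflt false (moves (g x) (a x)) then (h x).+1 else (h x).-1 else h x)).
  by move=> x; rewrite /next_head /moves; case: (_.2).
by ptime.
Qed.

Lemma ptime_initial_ok (T : X -> nat) (w : X -> seq A) (len : X -> nat) a p r :
  ptime I T -> ptime I w -> ptime I len ->
  ptime I a -> ptime I p -> ptime I r ->
  ptime I (fun x => initial_ok (T x) (w x) (len x) (a x) (p x) (r x)).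
Proof.
move=> pT pw plen pa pp pr; rewrite /initial_ok /in_cert /initial_cell.
have first_tape : ptime I (fun x => a x == ord0).
  exact: (ptime_comp (ptime_finite (fun a : tape_index => a == ord0)) pa).
have cert_symbol b : ptime I (fun x => r x == cert_cell M b).
  have is_cert : ptime I (fun r : option sym => r == cert_cell M b).
    exact: ptime_finite.
  exact: (ptime_comp is_cert pr).
have input_symbols : ptime I (fun x => map (input_cell M) (w x)).
  apply: (ptime_map (f := fun=> input_cell M)) => //.
  by apply: ptime_comp (ptime_finite _) _; ptime.
apply: ptime_if; [by ptime | exact: ptime_orb |].
by apply: ptime_eq_finType => //; ptime.
Qed.

End PtimeTableau.

#[export] Hint Resolve ptime_next_head ptime_initial_ok : ptime.

Section PtimeVertices.
Context {I A : finType} {M : TM (A + bool)%type} {X : Type} {eX : Encoding X}.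
Notation tape_index := 'I_(tm_k M).+1.
Implicit Type v : X -> vertex M.

Lemma ptime_vertex_ok (T : X -> nat) (w : X -> seq A) v :
  ptime I T -> ptime I w -> ptime I v ->
  ptime I (fun x => vertex_ok (T x) (w x) (v x)).
Proof.
move=> pT pw pv; rewrite /vertex_ok; have pview := ptime_vertex_view pv.
have start : ptime I (fun x => (vertex_view (v x)).1 == tm_start M).
  have is_start : ptime I (fun g : view M => g.1 == tm_start M).
    exact: ptime_finite.
  exact: (ptime_comp is_start pview).
have accept : ptime I (fun x => tm_accept (vertex_view (v x)).1).
  exact: (ptime_comp (ptime_finite (fun g : view M => tm_accept g.1)) pview).
have pv1 : ptime I (fun p : X * tape_index => v p.1).
  by apply: ptime_comp pv _; ptime.
have symbol : ptime I (fun p : X * tape_index => (vertex_view (v p.1)).2 p.2).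
  apply: (ptime_comp2 (F := fun (g : view M) a => g.2 a)); try by ptime.
  exact: ptime_finite.
by ptime.
Qed.

Lemma ptime_edge_ok v v' : ptime I v -> ptime I v' ->
  ptime I (fun x => edge_ok (v x) (v' x)).
Proof.
move=> pv pv'; rewrite /edge_ok.
have next_state : ptime I (fun x =>
    (vertex_view (v' x)).1 == (view_step (vertex_view (v x))).1).
  by apply: (ptime_comp2 (F := fun g' g : view M => g'.1 == (view_step g).1));
    [exact: ptime_finite | ptime | ptime].
have pv1 : ptime I (fun p : X * tape_index => v p.1).
  by apply: ptime_comp pv _; ptime.
have pv1' : ptime I (fun p : X * tape_index => v' p.1).
  by apply: ptime_comp pv' _; ptime.
have symbol_written : ptime I (fun p : X * tape_index =>
    (vertex_view (v' p.1)).2 p.2 == written (vertex_view (v p.1)) p.2).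
  apply: (ptime_comp2
    (F := fun (gg : view M * view M) a => gg.1.2 a == written gg.2 a)
    (a := fun p => (vertex_view (v' p.1), vertex_view (v p.1)))).
  - exact: ptime_finite.
  - by ptime.
  - by ptime.
by ptime.
Qed.

End PtimeVertices.

#[export] Hint Resolve ptime_vertex_ok ptime_edge_ok : ptime.

Lemma ptime_compatible {I A : finType} {M : TM (A + bool)%type} :
  ptime I (fun p : vertex M * vertex M => compatible p.1 p.2).
Proof. by rewrite /compatible; ptime. Qed.

Lemma ptime_head_visits {I : finType} {X} {eX : Encoding X} (T : X -> nat) :
  ptime I T -> ptime I (fun x => head_visits (T x)).
Proof. by move=> pT; rewrite /head_visits; ptime. Qed.

#[export] Hint Resolve ptime_head_visits : ptime.

Lemma ptime_vertices {I A : finType} {M : TM (A + bool)%type}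
    {X} {eX : Encoding X} (T P : X -> nat) (w : X -> seq A) :
  ptime I T -> ptime I P -> ptime I w ->
  ptime I (fun x => vertices M (T x) (P x) (w x)).
Proof.
move=> pT pP pw; rewrite /vertices; apply: ptime_filter; last by ptime.
apply/ptime_flatten/ptime_map; first by ptime.
by apply: ptime_map; [ptime | apply: ptime_pair; ptime].
Qed.

Section Reduction.
Variables (A : finType) (M : TM (A + bool)%type) (p q : {poly nat}).

Definition cert_bound (n : nat) : nat := p.[n]%R.

Definition time_bound (n : nat) : nat := q.[n + cert_bound n]%R + 7.

Definition reduction (w : seq A) : seq (option bool) :=
  let n := size w in
  clique_word ((0, (tm_start M, [ffun=> None])), (0, [::])) (@compatible A M)
    (time_bound n) (vertices M (time_bound n) (cert_bound n) w).

Lemma poly_time_reduction : poly_time reduction.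
Proof.
(* Mapping the identity changes the encoding of the letters, from the one used
   for options to the one used for finite types. *)
apply/poly_time_ptime/(eq_ptime (f := fun w => map id (reduction w))).
  by move=> w; rewrite map_id.
apply: (ptime_map (f := fun=> id)).
  have bound :
      ptime (A + option bool)%type (fun w : seq A => time_bound (size w)).
    by rewrite /time_bound /cert_bound; ptime.
  apply: ptime_clique_word => //; first exact: ptime_compatible.
  by apply: ptime_vertices; rewrite /cert_bound; ptime.
by apply: (ptime_comp (g := id)); [exact: ptime_finite | ptime].
Qed.

Lemma reductionP w : inequalities_problem (reduction w) <->
  ~ exists2 c : seq bool, size c <= cert_bound (size w)
    & tm_accept (cstate (run M (map inl w ++ map inr c) (time_bound (size w)))).
Proof.
rewrite (clique_wordP _ _ (@compatible_irr A M)) ?leq_addl //.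
split=> no [].
  by move=> c le acc; apply: no; apply: clique_of_run le acc.
by move=> C [sC pC ltC]; apply: no; apply: run_of_clique sC pC ltC.
Qed.

End Reduction.

Theorem inequalities_coNP_hard : coNP_hard inequalities_problem.
Proof.
move=> A L [V [p [[M [q decides_V]] certP]]].
exists (reduction M p q); split=> [|w]; first exact: poly_time_reduction.
rewrite reductionP.
have acceptE c : size c <= cert_bound p (size w) ->
    V (map inl w ++ map inr c) <-> tm_accept
      (cstate (run M (map inl w ++ map inr c) (time_bound p q (size w)))).
  move=> le; have [t [le_t halts ->]] := decides_V (map inl w ++ map inr c).
  rewrite (run_halted halts) //.
  apply: leq_trans le_t (leq_trans _ (leq_addr _ _)).
  by apply: horner_nat_homo; rewrite size_cat !size_map leq_add2l.
split=> [Lw [c le /(acceptE c le) Vc]|rejects].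
  by apply: (proj2 (certP w)) Lw; exists c.
apply: NNPP => /certP[c [le Vc]]; apply: rejects; exists c => //.
exact/acceptE.
Qed.

Theorem theorem5 : coNP_complete inequalities_problem.
Proof.
by split; [exact: inequalities_in_coNP | exact: inequalities_coNP_hard].
Qed.
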